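(* Consider the robust MDP $(\mathcal S,\mathcal A,\mathcal P^f,r,\gamma)$ with unknown nominal dynamics $f$ and with uncertainty sets defined by the $\chi^2$ distance with radius $\rho>0$, under the regularity assumptions listed in the context. There is a constant $C_0>0$ depending only on $\sigma,\lambda,k$ (not on $N,\epsilon,\delta$) such that the following holds. Let $\delta\in(0,1)$, $\epsilon\in(0,\tfrac1{1-\gamma})$, and let $N$ satisfy $$N\ \ge\ C_0\Big(\frac{1+2\rho}{\sqrt{1+2\rho}-1}\Big)^4\ \frac{\gamma^4\beta_N^2(\delta)\,d^2\,\Gamma_{Nd}}{(1-\gamma)^8\epsilon^4}.$$ Let $\hat f_N$ be the output of the MVR algorithm after $N$ simulator queries, let $\hat\pi_N$ be a robust optimal policy for the robust MDP with nominal dynamics $\hat f_N$, and let $\pi^*$ be a robust optimal policy for the robust MDP with nominal dynamics $f$. Then, with probability at least $1-\delta$, $$\max_{s\in\mathcal S}\big|V^{\mathrm R}_{\hat\pi_N,f}(s)-V^{\mathrm R}_{\pi^*,f}(s)\big|\le\epsilon .$$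
   Context: **Dynamics and regularity assumptions.** $\mathcal S\subset\mathbb R^d$ is the state space, $\mathcal A$ the action space, and $\mathcal S\times\mathcal A\subset\mathbb R^p$ is compact. The reward is $r:\mathcal S\times\mathcal A\to[0,1]$ and $\gamma\in(0,1)$ is the discount factor. The unknown nominal dynamics $f:\mathcal S\times\mathcal A\to\mathbb R^d$ is continuous. A simulator query at $(s,a)$ returns $s'=f(s,a)+\omega$ with $\omega\sim\mathcal N(0,\sigma^2 I)$, $\sigma>0$, independent across queries. Write $\mathcal I_d=\{1,\dots,d\}$, $\overline{\mathcal X}=\mathcal S\times\mathcal A\times\mathcal I_d$, and $f(s,a)=(\tilde f(s,a,1),\dots,\tilde f(s,a,d))$ with $\tilde f:\overline{\mathcal X}\to\mathbb R$. The function $k:\overline{\mathcal X}\times\overline{\mathcal X}\to\mathbb R$ is a continuous positive definite kernel with $k\le 1$, with RKHS $\mathcal H$ and norm $\|\cdot\|_k$; $\tilde f\in\mathcal H$ and $\|\tilde f\|_k\le B$. *Discretization assumption.* There is a constant $C$ such that for every $n\in\mathbb N$ and $R\ge B$ there is a finite $D\subset\mathcal S\times\mathcal A$ with $|D|\le C R^{p}n^{p/2}$ such that every $g\in\mathcal H$ with $\|g\|_k\le R$ satisfies $g(s,a,i)-g([s,a],i)\le 1/\sqrt n$ for all $(s,a,i)$, where $[s,a]$ is a point of $D$ nearest to $(s,a)$ in Euclidean norm. **Robust MDP.** For a function $g:\mathcal S\times\mathcal A\to\mathbb R^d$ let $P_g(s,a)=\mathcal N(g(s,a),\sigma^2I)$.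 The uncertainty set $\mathcal P^g$ consists of all transition kernels $P$ with $D(P(s,a)\|P_g(s,a))\le\rho$ for every $(s,a)$; here $D=\chi^2$, the $f$-divergence with generator $\frac12(t-1)^2$: $\chi^2(P\|Q)=\frac12\int(\frac{dP}{dQ}-1)^2\,dQ$ for $P\ll Q$ (and $+\infty$ otherwise). Next states lie in $\mathbb R^d$; policies, rewards and value functions at a next state $s'\notin\mathcal S$ are evaluated at $\Pi(s')$, where $\Pi:\mathbb R^d\to\mathcal S$ is a fixed measurable map with $\Pi=\mathrm{id}$ on $\mathcal S$. For a policy $\pi$, the robust value function is $$V^{\mathrm R}_{\pi,g}(s)=\inf_{P\in\mathcal P^g}\mathbb E_{P,\pi}\Big[\sum_{t=0}^\infty\gamma^t r(s_t,a_t)\,\Big|\,s_0=s\Big],$$ with $a_t\sim\pi(s_t)$, $s_{t+1}\sim P(s_t,a_t)$. It satisfies, for deterministic $\pi$, the robust Bellman equation $V^{\mathrm R}_{\pi,g}(s)=r(s,\pi(s))+\gamma\inf_{D(p\|P_g(s,\pi(s)))\le\rho}\mathbb E_{s'\sim p}[V^{\mathrm R}_{\pi,g}(s')]$. A robust optimal policy for $g$ is a deterministic policy $\pi$ with $V^{\mathrm R}_{\pi,g}(s)=\max_{\pi'}V^{\mathrm R}_{\pi',g}(s)$ for all $s$; such policies are taken to exist. **Multi-output GP posterior.** Fix $\lambda>0$. Given queries $x_i=(s_i,a_i)$, $1\le i\le n$, with responses $s_{i+1}\in\mathbb R^d$, let $y_{nd}=[s_{i+1,l}]_{i\le n,l\le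 d}\in\mathbb R^{nd}$ ($s_{i+1,l}$ the $l$-th component), $K_{nd}$ the $nd\times nd$ matrix with entries $k((x_i,l),(x_j,l'))$, and $k_{nd}(x,l)$ the row vector with entries $k((x,l),(x_i,l'))$. Put $\mu_{nd}(x,l)=k_{nd}(x,l)(K_{nd}+\lambda I_{nd})^{-1}y_{nd}$, $\ \sigma_{nd}^2(x,l)=k((x,l),(x,l))-k_{nd}(x,l)(K_{nd}+\lambda I_{nd})^{-1}k_{nd}(x,l)^T$, $\ \mu_n(s,a)=(\mu_{nd}(s,a,l))_{l\le d}$, $\ \sigma_n(s,a)=(\sigma_{nd}(s,a,l))_{l\le d}$. **MVR algorithm.** Start with $\mu_0=0$ and all components of $\sigma_0$ equal to $1$. For $i=1,\dots,n$: choose $(s_i,a_i)\in\arg\max_{(s,a)\in\mathcal S\times\mathcal A}\|\sigma_{i-1}(s,a)\|_2$, query the simulator at $(s_i,a_i)$, observe $s_{i+1}=f(s_i,a_i)+\omega_i$, and update $\mu_i,\sigma_i$. Output $\hat f_n=\mu_n$. **Constants.** $\Gamma_{m}=\Gamma_m(\overline{\mathcal X})=\max_{z_1,\dots,z_m\in\overline{\mathcal X}}\tfrac12\log\det(I_m+\lambda^{-1}[k(z_i,z_j)]_{i,j})$ is the maximum information gain. $\beta(\delta)=B+\frac{\sigma}{\lambda}\sqrt{2\log(2/\delta)}$ and $\beta_n(\delta)=2B+\beta\Big(\frac{\delta}{3Cd\,(B+\sqrt n\,\beta(2\delta/(3n)))^{p}n^{p/2}}\Big)$. *)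

(* Defs.v *)
From HB Require Import structures.
From mathcomp Require Import all_boot all_order all_algebra.
From mathcomp Require Import all_classical all_reals all_analysis.

Set Implicit Arguments.
Unset Strict Implicit.
Unset Printing Implicit Defensive.

Import Order.TTheory GRing.Theory Num.Theory.
Import numFieldNormedType.Exports.

Local Open Scope classical_set_scope.
Local Open Scope ring_scope.

(* Row vectors carry the sigma-algebra generated by the coordinates, which on
   R^n is the Borel sigma-algebra; this mirrors the library's instance on
   tuples. *)
Definition measure_rV_display : measure_display.
Proof. by constructor. Qed.

Section measurable_rV.
Variables (R : realType) (n : nat).

Let coors (i : 'I_n) (x : 'rV[R]_n) : R := x ord0 i.

Let rV_set0 : g_sigma_preimage coors set0.
Proof. exact: sigma_algebra0. Qed.

Let rV_setC E : g_sigma_preimage coors E -> g_sigma_preimage coors (~` E).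
Proof. exact: sigma_algebraC. Qed.

Let rV_bigcup (F : (set 'rV[R]_n)^nat) :
  (forall i, g_sigma_preimage coors (F i)) ->
  g_sigma_preimage coors (\bigcup_i F i).
Proof. exact: sigma_algebra_bigcup. Qed.

HB.instance Definition _ := @isMeasurable.Build measure_rV_display
  'rV[R]_n (g_sigma_preimage coors) rV_set0 rV_setC rV_bigcup.

Lemma measurable_coord (i : 'I_n) :
  measurable_fun [set: 'rV[R]_n] (fun x : 'rV[R]_n => x ord0 i).
Proof.
move=> _ Y mY; rewrite setTI; apply: sub_sigma_algebra => /=.
rewrite -bigcup_seq/=; exists i => /=; first by rewrite mem_index_enum.
by exists Y => //; rewrite setTI.
Qed.

Lemma measurable_fun_rV d (T : measurableType d) (f : T -> 'rV[R]_n) :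
  (forall i, measurable_fun [set: T] (fun t => f t ord0 i)) ->
  measurable_fun [set: T] f.
Proof.
move=> mf; apply: (@measurability _ _ _ _ _ _
  (\big[setU/set0]_(i < n) preimage_set_system setT (coors i) measurable)) => //.
move=> _ [B + <-]; rewrite -bigcup_seq/= => -[i _ [C mC <-]].
by rewrite setTI; exact: mf.
Qed.

End measurable_rV.

Section gaussian.
Variable R : realType.

Definition rV_cons (n : nat) (x : measurableTypeR R * 'rV[R]_n) : 'rV[R]_(1 + n) :=
  row_mx (const_mx (x.1 : R)) x.2.

Lemma measurable_rV_cons (n : nat) : measurable_fun setT (@rV_cons n).
Proof.
apply: measurable_fun_rV => i; rewrite /rV_cons.
case: (splitP i) => j ij.
  rewrite (_ : i = lshift n j); last exact: val_inj.
  by under eq_fun do rewrite row_mxEl mxE; exact: measurable_fst.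
rewrite (_ : i = rshift 1 j); last exact: val_inj.
under eq_fun do rewrite row_mxEr.
exact: (measurableT_comp (@measurable_coord R n j) measurable_snd).
Qed.

HB.instance Definition _ (n : nat) := isMeasurableFun.Build _ _ _ _
  (@rV_cons n) (@measurable_rV_cons n).

(* N(m, s ^ 2 I), as the product of the normal laws N(m_i, s ^ 2). *)
Fixpoint gaussian (s : R) (n : nat) : 'rV[R]_n -> probability 'rV[R]_n R :=
  match n with
  | 0 => fun _ => \d_(0 : 'rV[R]_0)
  | n'.+1 => fun m : 'rV[R]_(1 + n') =>
      distribution (normal_prob (m ord0 ord0) s \x gaussian s (rsubmx m))%E
        (@rV_cons n')
  end.

End gaussian.

Notation state_action S A := (set_type (S `*` A)%classic).

Section chi2.
Context {d} {T : measurableType d} {R : realType}.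
Local Open Scope ereal_scope.
Local Open Scope charge_scope.

Definition chi2_divergence (P Q : probability T R) : \bar R :=
  if pselect (P `<< Q)
  then 2^-1%:E *
    \int[Q]_x (('d (charge_of_finite_measure P) '/d Q) x - 1) ^+ 2
  else +oo.

End chi2.


Section kernel_at.
Context {d d'} {X : measurableType d} {Y : measurableType d'} {R : realType}.

Definition kernel_at (P : R.-pker X ~> Y) (x : X) : set Y -> \bar R := P x.

HB.instance Definition _ (P : R.-pker X ~> Y) (x : X) :=
  Measure.on (kernel_at P x).

Let kernel_at_setT (P : R.-pker X ~> Y) (x : X) : kernel_at P x setT = 1%E.
Proof. exact: prob_kernel. Qed.

HB.instance Definition _ (P : R.-pker X ~> Y) (x : X) :=
  Measure_isProbability.Build _ _ _ (kernel_at P x) (kernel_at_setT P x).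

End kernel_at.

Section robust_mdp.
Variables (R : realType) (n m : nat).
Variables (S : set 'rV[R]_n) (A : set 'rV[R]_m).
Variables (r : 'rV[R]_n * 'rV[R]_m -> R) (gamma rho sigma : R).
Variable proj : {mfun 'rV[R]_n >-> 'rV[R]_n}.

(* Policies and transition kernels are total measurable kernels of which only
   the values on S and on S `*` A matter. *)
Definition is_policy (pi : R.-pker 'rV[R]_n ~> 'rV[R]_m) : Prop :=
  forall s, S s -> pi s A = 1%E.

Definition is_deterministic_policy (pi : {mfun 'rV[R]_n >-> 'rV[R]_m}) : Prop :=
  forall s, S s -> A (pi s).

Definition deterministic (pi : {mfun 'rV[R]_n >-> 'rV[R]_m}) :
    R.-pker 'rV[R]_n ~> 'rV[R]_m :=
  kdirac (@measurable_funPT _ _ _ _ pi).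

(* Sigma-algebra generated by (st i, i < t) and (ac j, j < u). *)
Definition history {T : Type} (st : nat -> T -> 'rV[R]_n)
    (ac : nat -> T -> 'rV[R]_m) (t u : nat) : set (set T) :=
  <<s [set st i @^-1` E | i in `I_t & E in measurable] `|`
      [set ac j @^-1` E | j in `I_u & E in measurable] >>.

(* kappa is the conditional law of X given the sigma-algebra F. *)
Definition conditional_law {d d'} {T : measurableType d} {Y : measurableType d'}
    (Pr : probability T R) (F : set (set T)) (X : T -> Y)
    (kappa : T -> set Y -> \bar R) : Prop :=
  forall G E, F G -> measurable E ->
    Pr (G `&` X @^-1` E) = (\int[Pr]_(w in G) kappa w E)%E.

Record is_trajectory (pi : R.-pker 'rV[R]_n ~> 'rV[R]_m)
    (P : R.-pker ('rV[R]_n * 'rV[R]_m) ~> 'rV[R]_n) (s0 : 'rV[R]_n)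
    {d} {T : measurableType d} (Pr : probability T R)
    (st : nat -> {mfun T >-> 'rV[R]_n}) (ac : nat -> {mfun T >-> 'rV[R]_m})
    : Prop := {
  traj_init : forall w, st 0 w = s0;
  traj_action_space : forall t w, A (ac t w);
  traj_action : forall t,
    conditional_law Pr (history st ac t.+1 t) (ac t)
      (fun w => pi (proj (st t w)));
  traj_next_state : forall t,
    conditional_law Pr (history st ac t.+1 t.+1) (st t.+1)
      (fun w => P (proj (st t w), ac t w)) }.

Definition uncertainty_set (g : state_action S A -> 'rV[R]_n) :
    set (R.-pker ('rV[R]_n * 'rV[R]_m) ~> 'rV[R]_n) :=
  [set P | forall x : state_action S A,
    (chi2_divergence (kernel_at P (set_val x)) (gaussian sigma (g x))
       <= rho%:E)%E].

(* The expected return of pi under P from s0 only depends on the law of the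
   trajectory, hence it may be computed on any probability space carrying a
   trajectory; the infimum ranges over P and over all such realizations. *)
Definition robust_value (pi : R.-pker 'rV[R]_n ~> 'rV[R]_m)
    (g : state_action S A -> 'rV[R]_n) (s0 : 'rV[R]_n) : \bar R :=
  ereal_inf [set v : \bar R |
    exists P : R.-pker ('rV[R]_n * 'rV[R]_m) ~> 'rV[R]_n,
    exists (d : measure_display) (T : measurableType d) (Pr : probability T R),
    exists (st : nat -> {mfun T >-> 'rV[R]_n}),
    exists (ac : nat -> {mfun T >-> 'rV[R]_m}),
    [/\ uncertainty_set g P, is_trajectory pi P s0 Pr st ac &
      v = (\int[Pr]_w (\sum_(0 <= t <oo)
             (gamma ^+ t * r (proj (st t w), ac t w))%:E))%E]].

Definition robust_optimal (g : state_action S A -> 'rV[R]_n)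
    (pi : {mfun 'rV[R]_n >-> 'rV[R]_m}) : Prop :=
  is_deterministic_policy pi /\
  forall pi' : R.-pker 'rV[R]_n ~> 'rV[R]_m, is_policy pi' ->
    forall s, S s ->
      (robust_value pi' g s <= robust_value (deterministic pi) g s)%E.

End robust_mdp.

Section kernels.
Variables (R : realType) (Z : Type) (k : Z -> Z -> R).

Definition positive_definite_kernel : Prop :=
  (forall z z', k z z' = k z' z) /\
  forall (n : nat) (z : 'I_n -> Z) (c : 'I_n -> R),
    0 <= \sum_(i < n) \sum_(j < n) c i * c j * k (z i) (z j).

Definition ip_norm (ip : (Z -> R) -> (Z -> R) -> R) (g : Z -> R) : R :=
  Num.sqrt (ip g g).

(* (H, ip) is the Hilbert space of functions with reproducing kernel k; it is
   unique by the Moore-Aronszajn theorem. *)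
Record is_rkhs (H : set (Z -> R)) (ip : (Z -> R) -> (Z -> R) -> R) : Prop := {
  rkhs_zero : H (fun=> 0);
  rkhs_linear : forall (a : R) g h, H g -> H h -> H (fun z => a * g z + h z);
  rkhs_ip_sym : forall g h, H g -> H h -> ip g h = ip h g;
  rkhs_ip_linear : forall (a : R) g h u, H g -> H h -> H u ->
    ip (fun z => a * g z + h z) u = a * ip g u + ip h u;
  rkhs_ip_ge0 : forall g, H g -> 0 <= ip g g;
  rkhs_ip_definite : forall g, H g -> ip g g = 0 -> g = (fun=> 0);
  rkhs_complete : forall u : nat -> Z -> R, (forall i, H (u i)) ->
    (forall e : R, 0 < e -> exists N : nat, forall i j, (N <= i)%N ->
       (N <= j)%N -> ip_norm ip (fun z => u i z - u j z) < e) ->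
    exists2 g, H g & ip_norm ip (fun z => u i z - g z) @[i --> \oo] --> (0 : R);
  rkhs_kernel : forall z, H (k z);
  rkhs_reproducing : forall g z, H g -> ip g (k z) = g z }.

Definition gram (n : nat) (z : 'I_n -> Z) : 'M[R]_n :=
  \matrix_(i, j) k (z i) (z j).

Definition kernel_row (n : nat) (z : 'I_n -> Z) (w : Z) : 'rV[R]_n :=
  \row_j k w (z j).

Definition gp_mean (lambda : R) (n : nat) (z : 'I_n -> Z) (y : 'cV[R]_n)
    (w : Z) : R :=
  (kernel_row z w *m invmx (gram z + lambda%:M) *m y) ord0 ord0.

Definition gp_variance (lambda : R) (n : nat) (z : 'I_n -> Z) (w : Z) : R :=
  k w w - (kernel_row z w *m invmx (gram z + lambda%:M)
             *m (kernel_row z w)^T) ord0 ord0.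

Definition max_information_gain (lambda : R) (n : nat) : R :=
  sup [set 2^-1 * ln (\det (1%:M + lambda^-1 *: gram z)) | z in
         [set: 'I_n -> Z]].

End kernels.

Section multi_output_gp.
Variables (R : realType) (X : Type) (d : nat).
Variables (k : X * 'I_d -> X * 'I_d -> R) (lambda : R).

(* The pairs (i, l) are flattened to 'I_(n * d) in the same order as by the
   library's mxvec. *)
Definition query_output (x : nat -> X) (n : nat) (u : 'I_(n * d)) : X * 'I_d :=
  let il := enum_val (cast_ord (esym (mxvec_cast n d)) u) in
  (x (val il.1), il.2).

Definition responses (y : nat -> 'rV[R]_d) (n : nat) : 'cV[R]_(n * d) :=
  (mxvec (\matrix_(i < n, l < d) y i ord0 l))^T.

Definition posterior_mean (x : nat -> X) (y : nat -> 'rV[R]_d) (n : nat)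
    (w : X) : 'rV[R]_d :=
  \row_l gp_mean k lambda (@query_output x n) (responses y n) (w, l).

(* With no query all the components are 1 by convention, whatever k is. *)
Definition posterior_sd (x : nat -> X) (n : nat) (w : X) : 'rV[R]_d :=
  \row_l if n == 0%N then 1
         else Num.sqrt (gp_variance k lambda (@query_output x n) (w, l)).

Definition l2norm (v : 'rV[R]_d) : R :=
  Num.sqrt (\sum_(l < d) v ord0 l ^+ 2).

(* The posterior standard deviations do not depend on the responses, so the
   queries form a deterministic sequence. Queries are numbered from 0. *)
Definition mvr_queries (x : nat -> X) (N : nat) : Prop :=
  forall i, (i < N)%N -> forall w,
    l2norm (posterior_sd x i w) <= l2norm (posterior_sd x i (x i)).

End multi_output_gp.

Section regularity.
Variables (R : realType) (n m : nat).
Variables (S : set 'rV[R]_n) (A : set 'rV[R]_m).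

Definition state_action_dist (x y : 'rV[R]_n * 'rV[R]_m) : R :=
  Num.sqrt (\sum_(i < n) (x.1 ord0 i - y.1 ord0 i) ^+ 2 +
            \sum_(j < m) (x.2 ord0 j - y.2 ord0 j) ^+ 2).

(* The finite set D is given by an enumeration. *)
Definition discretization (H : set (state_action S A * 'I_n -> R))
    (ip : (state_action S A * 'I_n -> R) -> (state_action S A * 'I_n -> R) -> R) (B C : R) : Prop :=
  forall (N : nat) (rad : R), (0 < N)%N -> B <= rad ->
  exists (D : seq (state_action S A)) (near : state_action S A -> state_action S A),
  [/\ (size D)%:R <= C * rad ^+ (n + m) * N%:R `^ ((n + m)%:R / 2),
      (forall x, near x \in D /\ forall y, y \in D ->
         state_action_dist (set_val x) (set_val (near x)) <=
         state_action_dist (set_val x) (set_val y)) &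
      forall g, H g -> ip_norm ip g <= rad ->
        forall x i, g (x, i) - g (near x, i) <= (Num.sqrt N%:R)^-1].

End regularity.

Section noise.
Context {R : realType} {d} {T : measurableType d} (Pr : probability T R).

Definition iid_gaussian_noise (n : nat) (sigma : R)
    (noise : nat -> {mfun T >-> 'rV[R]_n}) : Prop :=
  (forall i E, measurable E -> Pr (noise i @^-1` E) = gaussian sigma 0 E) /\
  (forall (N : nat) (E : nat -> set 'rV[R]_n), (forall i, measurable (E i)) ->
     Pr (\bigcap_(i in `I_N) noise i @^-1` E i) =
     (\prod_(i < N) Pr (noise i @^-1` E i))%E).

End noise.

Section constants.
Variables (R : realType) (p d : nat) (B C sigma lambda : R).

Definition beta (delta : R) : R :=
  B + sigma / lambda * Num.sqrt (2 * ln (2 / delta)).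

Definition beta_ (n : nat) (delta : R) : R :=
  2 * B +
  beta (delta / (3 * C * d%:R *
          (B + Num.sqrt n%:R * beta (2 * delta / (3 * n%:R))) ^+ p *
          n%:R `^ (p%:R / 2))).

End constants.

(* Main.v *)
(* If the chi2-ball around P_{g1}(s, a) contains P1 and |g1 - g2| <= sigma u, an
   element P2 of the chi2-ball around P_{g2}(s, a) close to P1 is obtained by
   keeping the next state y ~ P1 with probability
   (1 - theta) min(1, dP_{g2}/dP_{g1}(y)) and resampling it from P_{g2} otherwise.
   The Gaussian overlap shows that P1 and P2 differ by O(sqrt u) on functions with
   values in [0, 1], so that the robust values of a policy for g1 and g2 differ by
   O(gamma sqrt u / (1 - gamma)^2). Trajectories under P2 exist because the given
   i.i.d. Gaussian noise can be transformed measurably into any transition kernel.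

   It remains to bound |f - fhat|. The posterior mean is linear in the responses:
   the bias at (x, l) is at most B sigma_N(x, l) by Cauchy-Schwarz in the RKHS, and
   the noise part is sub-Gaussian with standard deviation at most
   sigma sigma_N(x, l) / sqrt lambda. The noise part is itself a function of the
   RKHS of norm O(sqrt N), so that a union bound over the discretization points
   makes its control uniform. Finally, each query of MVR maximizes the posterior
   standard deviation, so that N ln (1 + sigma_N^2 / (d lambda)) is at most twice
   the information gain, whence sigma_N^2 = O(d Gamma_{Nd} / N). *)

Require Import Defs.
From HB Require Import structures.
From mathcomp Require Import all_boot all_order all_algebra.
From mathcomp Require Import all_classical all_reals all_analysis.
From mathcomp Require Import measurable_realfun.
From mathcomp Require Import ring lra.

Set Implicit Arguments.
Unset Strict Implicit.
Unset Printing Implicit Defensive.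

Import Order.TTheory GRing.Theory Num.Theory.
Import numFieldNormedType.Exports.

Local Open Scope classical_set_scope.
Local Open Scope ring_scope.

(** * Gaussian likelihood ratios *)

(** The density of an element P1 of a chi2-ball is controlled in L2 only, by 1 + 2 rho. The mass
    lost by truncating the likelihood ratio is therefore estimated by Cauchy-Schwarz, which is where
    sqrt (1 + 2 rho) comes from. As the loss is O(sqrt u) while u^2 is of the order of the squared
    error, that is 1 / N, the accuracy eps costs N of order eps^-4; this also produces the fourth
    power of the factor in rho and of gamma, and the eighth power of 1 - gamma.

    In the regression, the discretization assumption is one-sided, concerns a ball of fixed radius
    and leaves an error 1 / sqrt N. The noise part only lies in a multiple c of this ball, so the
    assumption is applied to its scalings by 1 / c and - 1 / c. The error c / sqrt N contains no
    information gain, whereas the target bound does. It is absorbed thanks to a lower bound on Gamma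
    given by a single observation, which is positive unless k vanishes on the diagonal: hence a case
    distinction, and a constant that depends on a value of k. *)

Section density.
Local Open Scope ereal_scope.

(** The change of variables is known for the Radon-Nikodym derivative, and [g] agrees with it almost
    everywhere because both have the same integral over every measurable set. *)
Lemma ge0_integral_density d (T : measurableType d) (R : realType)
    (nu : {finite_measure set T -> \bar R})
    (mu : {sigma_finite_measure set T -> \bar R}) (g : T -> R) :
  (forall x, 0 <= g x)%R -> measurable_fun setT g ->
  (forall A, measurable A -> nu A = \int[mu]_(x in A) (g x)%:E) ->
  forall h : T -> \bar R, (forall x, 0 <= h x) -> measurable_fun setT h ->
  \int[nu]_x h x = \int[mu]_x (h x * (g x)%:E).
Proof.
move=> g0 mg nug h h0 mh.
have numu : nu `<< mu.
  apply/null_content_dominatesP => A mA muA0; rewrite nug//.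
  apply: null_set_integral => //; apply: measurable_funTS.
  exact/measurable_EFinP.
rewrite -(Radon_Nikodym_SigmaFinite.change_of_variables numu)//.
set f := Radon_Nikodym_SigmaFinite.f nu mu.
have intf := Radon_Nikodym_SigmaFinite.f_integrable numu.
have mf : measurable_fun setT f by exact: measurable_int intf.
apply: ae_eq_integral => //.
- exact: emeasurable_funM.
- apply: emeasurable_funM => //; exact/measurable_EFinP.
apply: ae_eqe_mul2l.
apply: integral_ae_eq => //; first exact/measurable_EFinP.
by move=> A _ mA; rewrite -nug// -Radon_Nikodym_SigmaFinite.f_integral.
Qed.

End density.

Section gaussian_integral.
Variables (R : realType) (s : R).
Hypothesis s_gt0 : 0 < s.
Local Open Scope ereal_scope.

(** The density of N(m, s^2 I) with respect to N(m', s^2 I) at [x]. *)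
Definition gaussian_lr (n : nat) (m m' x : 'rV[R]_n) : R :=
  expR (\sum_(i < n) ((m ord0 i - m' ord0 i) * (x ord0 i - m' ord0 i) / s ^+ 2
    - (m ord0 i - m' ord0 i) ^+ 2 / (s ^+ 2 * 2)))%R.

Lemma gaussian_lr_gt0 n (m m' x : 'rV[R]_n) : (0 < gaussian_lr m m' x)%R.
Proof. exact: expR_gt0. Qed.

Lemma measurable_gaussian_lr d (T : measurableType d) n
    (m m' x : T -> 'rV[R]_n) :
  measurable_fun setT m -> measurable_fun setT m' -> measurable_fun setT x ->
  measurable_fun setT (fun t => gaussian_lr (m t) (m' t) (x t)).
Proof.
move=> mm mm' mx; apply: measurableT_comp => //=.
have mc (f : T -> 'rV[R]_n) i : measurable_fun setT f ->
    measurable_fun setT (fun t => f t ord0 i).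
  move=> mf; exact: (measurableT_comp (@measurable_coord R n i) mf).
apply: measurable_sum => i; apply: measurable_funB.
- apply: measurable_funM => //; apply: measurable_funM;
    by apply: measurable_funB; exact: mc.
- apply: measurable_funM => //; apply: measurable_funX.
  by apply: measurable_funB; exact: mc.
Qed.

Lemma ge0_integral_normal_shift (a b : R) (h : R -> \bar R) :
  (forall x, 0 <= h x) -> measurable_fun setT h ->
  \int[normal_prob a s]_x h x = \int[normal_prob b s]_x
    (h x * (expR ((a - b) * (x - b) / s ^+ 2
                  - (a - b) ^+ 2 / (s ^+ 2 * 2)))%:E).
Proof.
move=> h0 mh; have sn0 : s != 0%R by rewrite gt_eqF.
have mg c : measurable_fun setT (fun x : R => expR ((a - b) * (x - c) / s ^+ 2
                  - (a - b) ^+ 2 / (s ^+ 2 * 2)))%R.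
  apply: measurableT_comp => //; apply: measurable_funB => //.
  by apply: measurable_funM => //; apply: measurable_funM => //; exact: measurable_funB.
have dens c (h' : R -> \bar R) : (forall x, 0 <= h' x) -> measurable_fun setT h' ->
    \int[normal_prob c s]_x h' x =
    \int[@lebesgue_measure R]_x (h' x * (normal_pdf c s x)%:E).
  move=> h'0 mh'; apply: ge0_integral_density => //.
  - by move=> x; exact: normal_pdf_ge0.
  - exact: measurable_normal_pdf.
apply: etrans; first exact: dens.
apply: esym; apply: etrans.
  apply: dens; first by move=> x; rewrite mule_ge0// lee_fin expR_ge0.
  by apply: emeasurable_funM => //; exact/measurable_EFinP.
apply: esym.
apply: eq_integral => x _; rewrite -muleA -EFinM; congr (_ * _%:E).
rewrite !normal_pdfE// mulrCA; congr (_ * _)%R.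
rewrite /normal_fun -expRD; congr expR.
by field.
Qed.

Lemma ge0_integral_gaussianS n (m : 'rV[R]_(1 + n)) (h : 'rV[R]_(1 + n) -> \bar R) :
  (forall x, 0 <= h x) -> measurable_fun setT h ->
  \int[gaussian s m]_x h x = \int[normal_prob (m ord0 ord0) s]_a
    \int[gaussian s (rsubmx m)]_y h (rV_cons (a, y)).
Proof.
move=> h0 mh; rewrite /= ge0_integral_distribution//.
rewrite fubini_tonelli1//=; last first.
  by apply: measurableT_comp => //; exact: measurable_rV_cons.
Qed.

Lemma gaussian_lr_cons n (m m' : 'rV[R]_(1 + n)) a y :
  gaussian_lr m m' (rV_cons (a, y)) =
  (expR ((m ord0 ord0 - m' ord0 ord0) * (a - m' ord0 ord0) / s ^+ 2
                  - (m ord0 ord0 - m' ord0 ord0) ^+ 2 / (s ^+ 2 * 2)) *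
   gaussian_lr (rsubmx m) (rsubmx m') y)%R.
Proof.
rewrite /gaussian_lr -expRD; congr expR.
rewrite big_split_ord/= big_ord1; congr (_ + _)%R.
  by rewrite /rV_cons row_mxEl mxE/= (_ : lshift n ord0 = ord0)//; exact: val_inj.
by apply: eq_bigr => i _; rewrite /rV_cons row_mxEr !mxE.
Qed.

Lemma ge0_integral_gaussian_shift n (m m' : 'rV[R]_n) (h : 'rV[R]_n -> \bar R) :
  (forall x, 0 <= h x) -> measurable_fun setT h ->
  \int[gaussian s m]_x h x =
  \int[gaussian s m']_x (h x * (gaussian_lr m m' x)%:E).
Proof.
elim: n m m' h => [|n IH] m m' h h0 mh.
  rewrite /= !integral_dirac//=; last first.
    apply: emeasurable_funM => //; apply/measurable_EFinP.
    exact: measurable_gaussian_lr.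
  by rewrite !diracT !mul1e /gaussian_lr big_ord0 expR0 mule1.
move: m m' h h0 mh; rewrite -[n.+1]/(1 + n)%N => m m' h h0 mh.
have mg : measurable_fun setT (fun x => (gaussian_lr m m' x)%:E).
  by apply/measurable_EFinP; exact: measurable_gaussian_lr.
have mh2 a : measurable_fun setT (fun y : 'rV[R]_n => h (rV_cons (a, y))).
  by apply: measurableT_comp => //; apply: measurableT_comp => //;
    exact: measurable_rV_cons.
have mgr : measurable_fun setT
    (fun x => (gaussian_lr (rsubmx m) (rsubmx m') x)%:E).
  by apply/measurable_EFinP; exact: measurable_gaussian_lr.
have hl0 x : 0 <= h x * (gaussian_lr m m' x)%:E.
  by rewrite mule_ge0// lee_fin ltW// gaussian_lr_gt0.
apply: etrans; first exact: (@ge0_integral_gaussianS n m h h0 mh).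
apply: esym; apply: etrans.
  by apply: (@ge0_integral_gaussianS n m' _ hl0); exact: emeasurable_funM.
apply: esym; apply: etrans.
  apply: (ge0_integral_normal_shift _ (m' ord0 ord0)).
    by move=> x; exact: integral_ge0.
  apply: (measurable_fun_fubini_tonelli_F
    (m2 := gaussian s (rsubmx m)) (h \o @rV_cons R n)).
    by apply: measurableT_comp => //; exact: measurable_rV_cons.
  by move=> x; exact: h0.
apply: eq_integral => a _; rewrite (IH _ (rsubmx m'))//.
rewrite -ge0_integralZr//; last 2 first.
- by apply: emeasurable_funM.
- by move=> x _; rewrite mule_ge0// lee_fin ltW// gaussian_lr_gt0.
apply: eq_integral => y _; rewrite gaussian_lr_cons EFinM -!muleA.
by congr (_ * _); rewrite muleC.
Qed.

End gaussian_integral.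

Lemma integral_prob_cst d (T : measurableType d) (R : realType)
  (P : probability T R) (c : R) : (\int[P]_x c%:E = c%:E)%E.
Proof. by rewrite integral_cst//= probability_setT mule1. Qed.

Section gaussian_moments.
Variables (R : realType) (s : R).
Hypothesis s_gt0 : 0 < s.
Local Open Scope ereal_scope.

Lemma integral_gaussian_lr n (m m' : 'rV[R]_n) :
  \int[gaussian s m']_x (gaussian_lr s m m' x)%:E = 1.
Proof.
have := ge0_integral_gaussian_shift s_gt0 m m' (fun=> lee01) (measurable_cst 1).
rewrite integral_cst//= mul1e probability_setT => ->.
by apply: eq_integral => x _; rewrite mul1e.
Qed.

(** Exponential tilting: up to the factor on the right, the integrand is the likelihood ratio of the
    mean m + s^2 a with respect to m, whose integral is 1. *)
Lemma gaussian_mgf n (m a : 'rV[R]_n) :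
  \int[gaussian s m]_x (expR (\sum_(i < n) a ord0 i * (x ord0 i - m ord0 i)))%:E
  = (expR (s ^+ 2 / 2 * \sum_(i < n) a ord0 i ^+ 2))%:E.
Proof.
have sn0 : s != 0%R by rewrite gt_eqF.
rewrite -[RHS]mule1 -(integral_gaussian_lr (m + s ^+ 2 *: a)%R m).
rewrite -ge0_integralZl//; last 2 first.
- apply/measurable_EFinP; apply: measurable_gaussian_lr => //.
- by move=> x _; rewrite lee_fin expR_ge0.
apply: eq_integral => x _; rewrite -EFinM -expRD; congr (expR _)%:E.
rewrite mulr_sumr -big_split/=; apply: eq_bigr => i _; rewrite !mxE.
by field.
Qed.

(** One of the two factors moves the integral to N(m, s^2 I), where the other one is the exponential
    of an affine form. *)
Lemma gaussian_lr_second_moment n (m m' : 'rV[R]_n) :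
  \int[gaussian s m']_x (gaussian_lr s m m' x ^+ 2)%:E
  = (expR (\sum_(i < n) (m ord0 i - m' ord0 i) ^+ 2 / s ^+ 2))%:E.
Proof.
have sn0 : s != 0%R by rewrite gt_eqF.
under eq_integral do rewrite expr2 EFinM.
rewrite -(ge0_integral_gaussian_shift s_gt0 m m'
  (h := fun x => (gaussian_lr s m m' x)%:E)); last 2 first.
- by move=> x; rewrite lee_fin ltW// gaussian_lr_gt0.
- by apply/measurable_EFinP; exact: measurable_gaussian_lr.
pose a : 'rV[R]_n := ((s ^- 2) *: (m - m'))%R.
pose c : R := (\sum_(i < n) (m ord0 i - m' ord0 i) ^+ 2 / (s ^+ 2 * 2))%R.
under eq_integral => x _.
  rewrite (_ : gaussian_lr s m m' x =
    expR c * expR (\sum_(i < n) a ord0 i * (x ord0 i - m ord0 i)))%R; last first.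
    rewrite -expRD; congr expR; rewrite -big_split/=; apply: eq_bigr => i _.
    by rewrite !mxE; field.
  rewrite EFinM; over.
rewrite ge0_integralZl//; first last.
- apply/measurable_EFinP; apply: measurableT_comp => //.
  apply: measurable_sum => i; apply: measurable_funM => //.
  by apply: measurable_funB => //; exact: measurable_coord.
rewrite gaussian_mgf -EFinM -expRD mulr_sumr -big_split/=.
congr (expR _)%:E; apply: eq_bigr => i _.
by rewrite !mxE; field.
Qed.

(** For u >= 1/2 the integrand is at most 1. Otherwise it is at most (lr - 1)^2, whose integral
    exp(|m - m'|^2 / s^2) - 1 is at most 2 u^2. A bound linear in u covers both ranges. *)
Lemma gaussian_overlap n (m m' : 'rV[R]_n) (u : R) :
  (0 <= u)%R ->
  (\sum_(i < n) (m ord0 i - m' ord0 i) ^+ 2 <= (s * u) ^+ 2)%R ->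
  \int[gaussian s m']_x ((1 - Num.min 1 (gaussian_lr s m m' x)) ^+ 2)%:E
  <= (2 * u)%:E.
Proof.
move=> u0 mu.
have sn0 : s != 0%R by rewrite gt_eqF.
have mlr : measurable_fun setT (gaussian_lr s m m').
  exact: measurable_gaussian_lr.
have mmin : measurable_fun setT
    (fun x => ((1 - Num.min 1 (gaussian_lr s m m' x)) ^+ 2)%:E).
  apply/measurable_EFinP; apply: measurable_funX; apply: measurable_funB => //.
  exact: measurable_minr.
have min01 x : (0 <= Num.min 1 (gaussian_lr s m m' x) <= 1)%R.
  by rewrite le_min ler01 ltW ?gaussian_lr_gt0//= ge_min lexx.
have [u2|u2] := leP 2^-1%R u.
  apply: (@le_trans _ _ (\int[gaussian s m']_x 1)).
    apply: ge0_le_integral => //.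
    - by move=> x _; rewrite lee_fin sqr_ge0.
    - move=> x _; rewrite lee_fin; have /andP[] := min01 x; nra.
  by rewrite integral_prob_cst lee_fin; lra.
apply: (@le_trans _ _ (\int[gaussian s m']_x ((gaussian_lr s m m' x - 1) ^+ 2)%:E)).
  apply: ge0_le_integral => //.
  - by move=> x _; rewrite lee_fin sqr_ge0.
  - by apply/measurable_EFinP; apply: measurable_funX; exact: measurable_funB.
  - move=> x _; rewrite lee_fin /Num.min; case: ifP => _; last by nra.
    by rewrite subrr expr0n sqr_ge0.
(* Adding 2, the integral of 2 lr, replaces (lr - 1)^2 by lr^2 + 1, so that no difference of
   extended reals has to be formed. *)
rewrite -(@leeD2rE _ 2)//.
have -> : \int[gaussian s m']_x ((gaussian_lr s m m' x - 1) ^+ 2)%:E + 2 =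
    (expR (\sum_(i < n) (m ord0 i - m' ord0 i) ^+ 2 / s ^+ 2))%:E + 1.
  have meas2 : measurable_fun setT (fun x => (gaussian_lr s m m' x ^+ 2)%:E).
    by apply/measurable_EFinP; exact: measurable_funX.
  have measB : measurable_fun setT (fun x => ((gaussian_lr s m m' x - 1) ^+ 2)%:E).
    by apply/measurable_EFinP; apply: measurable_funX; exact: measurable_funB.
  have measM : measurable_fun setT (fun x => (2 * gaussian_lr s m m' x)%:E).
    by apply/measurable_EFinP; exact: measurable_funM.
  have <- : \int[gaussian s m']_x (2 * gaussian_lr s m m' x)%:E = 2.
    under eq_integral do rewrite EFinM.
    rewrite ge0_integralZl ?integral_gaussian_lr ?mule1//.
    - exact/measurable_EFinP.
    - by move=> x _; rewrite lee_fin ltW ?gaussian_lr_gt0.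
  rewrite -gaussian_lr_second_moment -(integral_prob_cst (gaussian s m') 1).
  rewrite -ge0_integralD//; last 2 first.
  - by move=> x _; rewrite lee_fin sqr_ge0.
  - by move=> x _; rewrite lee_fin mulr_ge0// ltW ?gaussian_lr_gt0.
  rewrite -ge0_integralD//; last by move=> x _; rewrite lee_fin sqr_ge0.
  by apply: eq_integral => x _; rewrite -!EFinD; congr _%:E; ring.
rewrite -!EFinD lee_fin.
set D := (\sum_(i < n) _)%R.
have Du : (D <= u ^+ 2)%R.
  by rewrite /D -mulr_suml ler_pdivrMr ?exprn_gt0// -exprMn mulrC mulrC [(u * s)%R]mulrC.
have e1 : (expR D <= expR (u ^+ 2))%R by rewrite ler_expR.
have e2 := expR_ge1Dx (- u ^+ 2)%R.
have e3 : (expR (u ^+ 2) * expR (- u ^+ 2) = 1)%R by rewrite -expRD subrr expR0.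
have e4 := expR_gt0 (u ^+ 2)%R.
(* With v = u^2 <= 1/4: exp(v) (1 - v) <= 1 <= (1 + 2 v) (1 - v). *)
suff : (expR (u ^+ 2) <= 1 + 2 * u ^+ 2)%R by nra.
have e5 : (u ^+ 2 <= 4^-1)%R by nra.
have e6 : (expR (u ^+ 2) * (1 - u ^+ 2) <= 1)%R by rewrite -[leRHS]e3 ler_wpM2l // ltW.
have : (1 <= (1 + 2 * u ^+ 2) * (1 - u ^+ 2))%R.
  have v0 := sqr_ge0 u; move: (u ^+ 2)%R v0 e5 => v v0 v4.
  have : (0 <= v * (1 - 2 * v))%R by apply: mulr_ge0 => //; lra.
  lra.
move=> /(le_trans e6); rewrite ler_pM2r//; lra.
Qed.

End gaussian_moments.

(** * Concentration of linear functionals of the noise *)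

Section independence.
Local Open Scope ereal_scope.

Lemma ge0_integral_indep d1 d2 d (T : measurableType d) (T1 : measurableType d1)
    (T2 : measurableType d2) (R : realType) (Pr : probability T R)
    (Q : probability T2 R) (X : T -> T1) (Y : T -> T2) (f : T1 * T2 -> \bar R) :
  measurable_fun setT X -> measurable_fun setT Y ->
  (forall A B, measurable A -> measurable B ->
     Pr (X @^-1` A `&` Y @^-1` B) = Pr (X @^-1` A) * Q B) ->
  measurable_fun setT f -> (forall z, 0 <= f z) ->
  \int[Pr]_w f (X w, Y w) = \int[Pr]_w \int[Q]_y f (X w, y).
Proof.
move=> mX mY XY mf f0.
pose mXi := isMeasurableFun.Build _ _ _ _ _ mX.
pose X' : {mfun T >-> T1} := HB.pack X mXi.
have mXY : measurable_fun setT (fun w => (X w, Y w)) by exact: measurable_fun_pair.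
pose mXYi := isMeasurableFun.Build _ _ _ _ _ mXY.
pose XY' : {mfun T >-> (T1 * T2)%type} := HB.pack (fun w => (X w, Y w)) mXYi.
have E : forall C, measurable C -> (distribution Pr X' \x Q) C = distribution Pr XY' C.
  apply: product_measure_unique => A B mA mB.
  by rewrite /= /pushforward -XY.
transitivity (\int[distribution Pr XY']_z f z).
  by rewrite ge0_integral_distribution.
transitivity (\int[(distribution Pr X' \x Q)%E]_z f z).
  by apply: eq_measure_integral => C mC _; apply: esym; exact: E.
rewrite fubini_tonelli1// ge0_integral_distribution//.
- exact: measurable_fun_fubini_tonelli_F.
- by move=> x; exact: integral_ge0.
Qed.

End independence.

Section noise_independence.
Context {R : realType} {d} {T : measurableType d} (Pr : probability T R).
Variables (n : nat) (sigma : R) (noise : nat -> {mfun T >-> 'rV[R]_n}).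
Hypothesis iid : iid_gaussian_noise Pr sigma noise.
Local Open Scope ereal_scope.

Definition noise_past (t : nat) : set (set T) :=
  [set noise i @^-1` E | i in `I_t & E in measurable].

Lemma noise_past_sub_measurable t : noise_past t `<=` measurable.
Proof. by move=> _ [i _ [E mE <-]]; exact: measurable_funPTI. Qed.

Lemma noise_past_measurable t G : <<s noise_past t >> G -> measurable G.
Proof.
apply: smallest_sub; first exact: sigma_algebra_measurable.
exact: noise_past_sub_measurable.
Qed.

(** Independence is given for intersections of events on single noises. These form an
    intersection-stable class generating the past, on which the two finite measures G |-> Pr (G and
    noise t in B) and G |-> Pr G times the Gaussian mass of B agree. *)
Lemma noise_indep t G B : <<s noise_past t >> G -> measurable B ->
  Pr (G `&` noise t @^-1` B) = Pr G * gaussian sigma 0 B.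
Proof.
move=> pG mB; case: iid => law indep.
pose C := [set \bigcap_(i in `I_t) noise i @^-1` E i |
            E in [set E : nat -> set 'rV[R]_n | forall i, measurable (E i)]].
have mC : C `<=` measurable.
  move=> _ [E mE <-]; apply: bigcap_measurableType => i _.
  exact: measurable_funPTI.
have CT : C setT.
  exists (fun=> setT) => //; apply/seteqP; split=> // w _ i _ //.
have CI : setI_closed C.
  move=> _ _ [E mE <-] [F mF <-]; exists (fun i => E i `&` F i).
    by move=> i; exact: measurableI.
  by rewrite -bigcapI; apply: eq_bigcapr => i _; rewrite preimage_setI.
have CG : <<s C >> G.
  move: G pG; apply: smallest_sub; first exact: smallest_sigma_algebra.
  move=> _ [i it [E mE <-]]; apply: sub_gen_smallest; exists (fun j => if j == i then E else setT).
    by move=> j; case: ifP.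
  apply/seteqP; split => [w /(_ i it)/=|w Ew j _ /=]; first by rewrite eqxx.
  by case: eqP => [->|].
have mN : measurable (noise t @^-1` B) by exact: measurable_funPTI.
have gB : gaussian sigma 0 B \is a fin_num by exact: fin_num_measure.
pose c : {nonneg R} := NngNum (fine_ge0 (measure_ge0 (gaussian sigma 0) B)).
have -> : Pr (G `&` noise t @^-1` B) = mrestr Pr mN G by [].
have -> : Pr G * gaussian sigma 0 B = mscale c Pr G.
  by rewrite /mscale /= fineK// muleC.
apply: (@g_sigma_algebra_measure_unique _ R _ C mC (fun=> setT)) => //.
- by rewrite bigcup_const//; exists 0%N.
- move=> _ [E mE <-]; rewrite /= /mscale /mrestr /c /= fineK//.
  (* The event on [noise t] is merged with the earlier ones into an event on the first t + 1
     noises. *)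
  pose F i := if i == t then B else E i.
  have mF i : measurable (F i) by rewrite /F; case: ifP.
  have -> : \bigcap_(i in `I_t) noise i @^-1` E i `&` noise t @^-1` B =
      \bigcap_(i in `I_t.+1) noise i @^-1` F i.
    rewrite /F; apply/seteqP; split=> [w [wE wB] i /=|w wF].
      rewrite ltnS leq_eqVlt; case: eqP => [-> _//|_ /= it].
      exact: wE.
    split=> [i it|]; last by have := wF t (ltnSn t); rewrite /= eqxx.
    have := wF i (ltnW it); rewrite /=; case: eqP => // ti.
    by move: it; rewrite /= ti ltnn.
  rewrite indep// big_ord_recr/= muleC.
  have -> : F t = B by rewrite /F eqxx.
  rewrite law//; congr (_ * _).
  rewrite indep//; apply: eq_bigr => i _; rewrite /F.
  by rewrite (ltn_eqF (ltn_ord i)).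
- by move=> k; rewrite (le_lt_trans (probability_le1 _ _)) ?ltry//; exact: measurableI.
Qed.

(* An expectation factor depending on the past noise only does not see the next
   noise, which can thus be integrated out. *)
Lemma ge0_integral_noise t d1 (T1 : measurableType d1) (X : T -> T1)
    (f : T1 * 'rV[R]_n -> \bar R) :
  measurable_fun [set: g_sigma_algebraType (noise_past t)] X ->
  measurable_fun setT f -> (forall z, 0 <= f z) ->
  \int[Pr]_w f (X w, noise t w) =
  \int[Pr]_w \int[gaussian sigma 0]_y f (X w, y).
Proof.
move=> mX mf f0.
have pX A : measurable A -> <<s noise_past t >> (X @^-1` A).
  by move=> mA; have := mX measurableT A mA; rewrite setTI.
apply: ge0_integral_indep => //.
- by move=> _ A mA; rewrite setTI; exact: (noise_past_measurable (pX _ mA)).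
- by move=> A B mA mB; rewrite noise_indep//; exact: pX.
Qed.

End noise_independence.

Lemma measurable_lt_set d (T : measurableType d) (R : realType) (f g : T -> R) :
  measurable_fun setT f -> measurable_fun setT g -> measurable [set w | f w < g w].
Proof.
move=> mf mg; have := measurable_fun_ltr mf mg.
by move=> /(_ measurableT [set true] I); rewrite setTI.
Qed.

Section noise_concentration.
Context {R : realType} {d} {T : measurableType d} (Pr : probability T R).
Variables (n : nat) (sigma : R) (noise : nat -> {mfun T >-> 'rV[R]_n}).
Hypothesis iid : iid_gaussian_noise Pr sigma noise.
Hypothesis sigma_gt0 : 0 < sigma.

Lemma noise_past_measurable_fun t i : (i < t)%N ->
  measurable_fun [set: g_sigma_algebraType (noise_past noise t)] (noise i).
Proof.
move=> it _ A mA; rewrite setTI; apply: sub_gen_smallest.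
by exists i => //; exists A.
Qed.

Definition noise_sum (N : nat) (a : nat -> 'rV[R]_n) (w : T) : R :=
  \sum_(i < N) \sum_(l < n) a i ord0 l * noise i w ord0 l.

Definition coef_sqnorm (N : nat) (a : nat -> 'rV[R]_n) : R :=
  \sum_(i < N) \sum_(l < n) a i ord0 l ^+ 2.

Lemma measurable_noise_sum_past N a :
  measurable_fun [set: g_sigma_algebraType (noise_past noise N)] (noise_sum N a).
Proof.
apply: measurable_sum => i; apply: measurable_sum => l; apply: measurable_funM => //.
apply: (measurableT_comp (@measurable_coord R n l)).
exact: noise_past_measurable_fun.
Qed.

Lemma measurable_noise_sum N a : measurable_fun setT (noise_sum N a).
Proof.
apply: measurable_sum => i; apply: measurable_sum => l; apply: measurable_funM => //.
exact: (measurableT_comp (@measurable_coord R n l)).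
Qed.

(** The last noise is independent of the past; integrating it out leaves a deterministic factor. *)
Lemma noise_sum_mgf N a :
  (\int[Pr]_w (expR (noise_sum N a w))%:E =
   (expR (sigma ^+ 2 / 2 * \sum_(i < N) \sum_(l < n) a i ord0 l ^+ 2))%:E)%E.
Proof.
elim: N => [|N IH].
  rewrite /noise_sum; under eq_integral do rewrite big_ord0 expR0.
  by rewrite integral_prob_cst big_ord0 mulr0 expR0.
pose f (z : R * 'rV[R]_n) :=
  (expR (z.1 + \sum_(l < n) a N ord0 l * z.2 ord0 l))%:E.
have mf : measurable_fun setT f.
  apply/measurable_EFinP/measurableT_comp => //; apply: measurable_funD => //.
  apply: measurable_sum => l; apply: measurable_funM => //.
  exact: (measurableT_comp (@measurable_coord R n l)).
have f0 z : (0 <= f z)%E by rewrite lee_fin expR_ge0.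
transitivity (\int[Pr]_w f (noise_sum N a w, noise N w))%E.
  by apply: eq_integral => w _; rewrite /f /noise_sum big_ord_recr.
rewrite (ge0_integral_noise iid (@measurable_noise_sum_past N a) mf f0).
transitivity (\int[Pr]_w ((expR (noise_sum N a w))%:E *
   (expR (sigma ^+ 2 / 2 * \sum_(l < n) a N ord0 l ^+ 2))%:E))%E.
  apply: eq_integral => w _; rewrite -(gaussian_mgf sigma_gt0 0).
  rewrite -ge0_integralZl//; first last.
  - apply/measurable_EFinP/measurableT_comp => //; apply: measurable_sum => l.
    apply: measurable_funM => //; apply: measurable_funB => //.
    exact: measurable_coord.
  apply: eq_integral => y _; rewrite -EFinM -expRD /f/=; congr (expR (_ + _))%:E.
  by apply: eq_bigr => l _; rewrite mxE subr0.
rewrite ge0_integralZr//; first last.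
- apply/measurable_EFinP/measurableT_comp => //; exact: measurable_noise_sum.
by rewrite IH -EFinM -expRD -mulrDr big_ord_recr.
Qed.

(** Chernoff bound with the exponent lam = t / (sigma sqrt V), which minimizes sigma^2 lam^2 V / 2 -
    lam sigma sqrt V t. *)
Lemma noise_sum_upper_tail N (a : nat -> 'rV[R]_n) (t : R) : 0 <= t ->
  (Pr [set w | (sigma * Num.sqrt (coef_sqnorm N a) * t < noise_sum N a w)%R]
     <= (expR (- (t ^+ 2 / 2)))%:E)%E.
Proof.
move=> t0; set V := coef_sqnorm N a.
have V0 : 0 <= V by apply: sumr_ge0 => i _; apply: sumr_ge0 => l _; exact: sqr_ge0.
(* If V = 0, all the coefficients vanish and the strict inequality makes the event empty; the
   exponent used otherwise divides by sqrt V. *)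
have [VE|Vneq0] := eqVneq V 0.
  rewrite [X in Pr X](_ : _ = set0) ?measure0 ?lee_fin ?expR_ge0//.
  rewrite -subset0 => w /=; rewrite VE sqrtr0 mulr0 mul0r.
  rewrite /noise_sum big1 ?ltxx// => i _; rewrite big1// => l _.
  have /eqP := VE; rewrite /V /coef_sqnorm psumr_eq0; last first.
    by move=> j _; apply: sumr_ge0 => k _; exact: sqr_ge0.
  move=> /allP/(_ i (mem_index_enum _)) /=.
  rewrite psumr_eq0 => [|j _]; last exact: sqr_ge0.
  by move=> /allP/(_ l (mem_index_enum _)) /=; rewrite sqrf_eq0 => /eqP ->; rewrite mul0r.
have Vgt0 : 0 < V by rewrite lt_neqAle eq_sym Vneq0.
set b := Num.sqrt V; have b0 : 0 < b by rewrite sqrtr_gt0.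
have bV : b ^+ 2 = V by rewrite sqr_sqrtr.
set A := [set w | _].
have mA : measurable A.
  by apply: measurable_lt_set => //; exact: measurable_noise_sum.
pose lam := t / (sigma * b).
have lam0 : 0 <= lam by rewrite divr_ge0// ltW// mulr_gt0.
pose e := expR (- (lam * (sigma * b * t))).
have mS : measurable_fun setT (fun w => (expR (noise_sum N (fun i => lam *: a i) w))%:E).
  by apply/measurable_EFinP/measurableT_comp => //; exact: measurable_noise_sum.
have SE w : noise_sum N (fun i => lam *: a i) w = lam * noise_sum N a w.
  rewrite /noise_sum mulr_sumr; apply: eq_bigr => i _.
  by rewrite mulr_sumr; apply: eq_bigr => l _; rewrite mxE mulrA.
apply: (@le_trans _ _
  (\int[Pr]_w (e%:E * (expR (noise_sum N (fun i => lam *: a i) w))%:E))%E).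
  rewrite -[A]setIT -integral_indic//; apply: ge0_le_integral => //.
  - by apply/measurable_EFinP; exact: measurable_indic.
  - exact: emeasurable_funM.
  - move=> w _; rewrite -EFinM lee_fin /e -expRD SE indicE.
    have [wA|] := boolP (w \in A); last by rewrite expR_ge0.
    rewrite -[leLHS]expR0 ler_expR addrC subr_ge0 ler_wpM2l// ltW//.
    by move: wA; rewrite inE.
rewrite ge0_integralZl//; last by rewrite lee_fin expR_ge0.
rewrite noise_sum_mgf -EFinM lee_fin /e -expRD ler_expR.
under eq_bigr do under eq_bigr do rewrite mxE exprMn.
have -> : \sum_(i < N) \sum_(l < n) lam ^+ 2 * a i ord0 l ^+ 2 = lam ^+ 2 * V.
  by rewrite mulr_sumr; apply: eq_bigr => i _; rewrite mulr_sumr.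
have sn : sigma != 0 by rewrite gt_eqF.
have bn : b != 0 by rewrite gt_eqF.
by rewrite -bV le_eqVlt; apply/orP; left; apply/eqP; rewrite /lam; field; rewrite sn bn.
Qed.

(** The 2 inside the logarithm pays for the two tails, obtained from [a] and its opposite with
    probability delta / 2 each. *)
Lemma noise_concentration N (a : nat -> 'rV[R]_n) (delta : R) : 0 < delta < 1 ->
  (Pr [set w | (sigma * Num.sqrt (coef_sqnorm N a) * Num.sqrt (2 * ln (2 / delta)) <
               `|noise_sum N a w|)%R] <= delta%:E)%E.
Proof.
move=> /andP[d0 d1]; set V := coef_sqnorm N a; set t := Num.sqrt (2 * ln (2 / delta)).
have V0 : 0 <= V by apply: sumr_ge0 => i _; apply: sumr_ge0 => l _; exact: sqr_ge0.
have l0 : 0 <= ln (2 / delta) by rewrite ln_ge0// ler_pdivlMr// mul1r; lra.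
have tE : expR (- (t ^+ 2 / 2)) = delta / 2.
  rewrite sqr_sqrtr ?mulr_ge0// mulrAC divff// mul1r -lnV ?posrE ?divr_gt0//.
  by rewrite invf_div lnK// posrE divr_gt0.
have t0 : 0 <= t by exact: sqrtr_ge0.
have mS b : measurable [set w | sigma * Num.sqrt V * t < noise_sum N b w].
  by apply: measurable_lt_set => //; exact: measurable_noise_sum.
have NE w : noise_sum N (fun i => - a i) w = - noise_sum N a w.
  rewrite /noise_sum -sumrN; apply: eq_bigr => i _.
  by rewrite -sumrN; apply: eq_bigr => l _; rewrite mxE mulNr.
have VN : coef_sqnorm N (fun i => - a i) = V.
  by apply: eq_bigr => i _; apply: eq_bigr => l _; rewrite mxE sqrrN.
have U1 := noise_sum_upper_tail N a t0.
have U2 := noise_sum_upper_tail N (fun i => - a i) t0.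
rewrite tE -/V in U1; rewrite tE VN in U2.
apply: (@le_trans _ _ (Pr ([set w | sigma * Num.sqrt V * t < noise_sum N a w]%R `|`
  [set w | sigma * Num.sqrt V * t < noise_sum N (fun i => - a i) w]%R))).
  apply: le_measure; rewrite ?inE//.
  - apply: measurable_lt_set => //; apply: measurableT_comp => //.
    exact: measurable_noise_sum.
  - exact: measurableU.
  - move=> w /=; rewrite NE lter_normr => /orP[]; by [left|right].
apply: le_trans (measureU2 _ _ _) _ => //.
by rewrite [delta]splitr EFinD; exact: leeD.
Qed.

End noise_concentration.

(** * Realization of a transition kernel by a Gaussian vector *)

Section ternary.
Context {R : realType}.
Local Open Scope ereal_scope.

(* Only the digits 0 and 1 are used in base 3, so that they can be read off the
   sum without the ambiguity of dyadic expansions. *)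
Definition ternary_value (b : nat -> bool) : R :=
  fine (\sum_(k <oo) ((b k)%:R * 3^-1 ^+ k.+1)%:E).

(** On the value of a digit sequence, this drops the leading digit. *)
Definition ternary_shift (s : R) : R := (3 * s - (3^-1 <= s)%R%:R)%R.

Definition ternary_digit (k : nat) (s : R) : bool :=
  (3^-1 <= iter k ternary_shift s)%R.

Let term_ge0 (b : nat -> bool) k : 0 <= ((b k)%:R * 3^-1 ^+ k.+1 : R)%:E.
Proof. by rewrite lee_fin mulr_ge0// exprn_ge0// invr_ge0. Qed.

Lemma ternary_series_le (b : nat -> bool) :
  \sum_(k <oo) ((b k)%:R * 3^-1 ^+ k.+1 : R)%:E <= (2^-1)%:E.
Proof.
apply: lime_le; first by apply: is_cvg_nneseries => k _ _; exact: term_ge0.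
apply: nearW => n; rewrite big_mkord sumEFin lee_fin.
apply: (@le_trans _ _ ((1 - 3^-1 ^+ n) / 2)%R).
  elim: n => [|n IH]; first by rewrite big_ord0 expr0 subrr mul0r.
  rewrite big_ord_recr/= !exprS; have := IH.
  have : (0 <= 3^-1 ^+ n :> R)%R by rewrite exprn_ge0// invr_ge0.
  case: (b n) => /=; rewrite ?mul1r ?mul0r; lra.
have : (0 <= 3^-1 ^+ n :> R)%R by rewrite exprn_ge0// invr_ge0.
lra.
Qed.

Lemma ternary_series_ge0 (b : nat -> bool) :
  0 <= \sum_(k <oo) ((b k)%:R * 3^-1 ^+ k.+1 : R)%:E.
Proof. by apply: nneseries_ge0 => k _ _; exact: term_ge0. Qed.

Lemma ternary_seriesE (b : nat -> bool) :
  \sum_(k <oo) ((b k)%:R * 3^-1 ^+ k.+1)%:E = (ternary_value b)%:E.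
Proof.
rewrite fineK// fin_numElt (lt_le_trans _ (ternary_series_ge0 b)) ?ltNyr//.
by rewrite (le_lt_trans (ternary_series_le b))// ltry.
Qed.

Lemma ternary_value_itv (b : nat -> bool) : (0 <= ternary_value b <= 2^-1)%R.
Proof.
by rewrite -!lee_fin -ternary_seriesE ternary_series_ge0 ternary_series_le.
Qed.

Lemma ternary_valueS (b : nat -> bool) :
  ternary_value b = (3^-1 * ((b 0%N)%:R + ternary_value (b \o S)))%R.
Proof.
apply: EFin_inj; rewrite -ternary_seriesE nneseries_recl//.
rewrite mulrDr EFinD expr1 mulrC; congr (_ + _).
rewrite EFinM -ternary_seriesE -nneseriesZl//.
rewrite -(nneseries_addn 1) => [|k]; last exact: term_ge0.
by apply: eq_eseriesr => k _; rewrite -EFinM addn1 exprS mulrCA.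
Qed.

(** A leading digit 0 leaves a value of at most 1/6 and a leading digit 1 gives at least 1/3, so the
    comparison with 1/3 reads the digit. *)
Lemma ternary_digitK (b : nat -> bool) k : ternary_digit k (ternary_value b) = b k.
Proof.
have first c : (3^-1 <= ternary_value c)%R = c 0%N.
  rewrite ternary_valueS; have /andP[] := ternary_value_itv (c \o S).
  by case: (c 0%N) => /= h1 h2; [apply/idP|apply/negbTE; rewrite -ltNge]; lra.
rewrite /ternary_digit; suff -> : iter k ternary_shift (ternary_value b) =
    ternary_value (fun j => b (j + k)%N) by rewrite first.
elim: k => [|k IH] /=; first by congr ternary_value; apply/funext => j; rewrite addn0.
rewrite IH /ternary_shift first ternary_valueS mulrA divff// mul1r add0n addrAC subrr add0r.
by congr ternary_value; apply/funext => j /=; rewrite addnS.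
Qed.

Lemma measurable_ternary_digit k : measurable_fun setT (ternary_digit k).
Proof.
have m3 : measurable_fun setT (fun s : R => 3^-1 <= s)%R.
  exact: measurable_fun_ler.
apply: (measurableT_comp m3).
elim: k => [|k IH] /=; first exact: measurable_id.
apply: (@measurableT_comp _ _ _ _ _ _ ternary_shift) => //.
rewrite /ternary_shift; apply: measurable_funB; first exact: measurable_funM.
rewrite (_ : (fun _ => _) = \1_[set s : R | 3^-1 <= s]%R); last first.
  by apply/funext => s; rewrite indicE mem_setE.
apply: measurable_indic; have := m3 measurableT [set true] I.
by rewrite setTI.
Qed.

End ternary.

Section row_coding.
Context {R : realType} (n : nat).
Local Open Scope ereal_scope.

(* A vector is determined by the set of pairs (j, q), enumerated by unpickle, such
   that its coordinate j is less than the rational q. *)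
Definition row_bits (x : 'rV[R]_n) (k : nat) : bool :=
  if @unpickle ('I_n * rat)%type k is Some (j, q) then (x ord0 j < ratr q)%R
  else false.

(** An injection of R^n into R, measurable together with its left inverse [row_decode]: sampling a
    law on R^n is reduced to sampling a law on R. *)
Definition row_code (x : 'rV[R]_n) : R := ternary_value (row_bits x).

(** The coordinate j is the infimum of the rationals above it; the value [+oo] makes all the other
    indices harmless. An infimum over an enumeration is measurable. *)
Definition row_decode_term (j : 'I_n) (k : nat) (y : R) : \bar R :=
  if @unpickle ('I_n * rat)%type k is Some (j', q) then
    if (j' == j) && ternary_digit k y then (ratr q)%:E else +oo
  else +oo.

Definition row_decode (y : R) : 'rV[R]_n :=
  \row_j fine (einfs (row_decode_term j ^~ y) 0%N).

Lemma measurable_row_code : measurable_fun setT row_code.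
Proof.
apply: measurableT_comp => //; apply: ge0_emeasurable_sum => [k x _ _|k _].
  by rewrite lee_fin mulr_ge0// exprn_ge0// invr_ge0.
apply/measurable_EFinP/measurable_funM => //.
rewrite /row_bits; case: unpickle => [[j q]|]; last exact: measurable_cst.
rewrite (_ : (fun _ => _) = \1_[set x : 'rV[R]_n | x ord0 j < ratr q]%R); last first.
  by apply/funext => s; rewrite indicE mem_setE.
by apply: measurable_indic; apply: measurable_lt_set => //; exact: measurable_coord.
Qed.

Lemma measurable_row_decode : measurable_fun setT row_decode.
Proof.
apply: measurable_fun_rV => j; under eq_fun do rewrite mxE.
apply: measurableT_comp => //; apply: measurable_fun_einfs => k.
rewrite /row_decode_term; case: unpickle => [[j' q]|]; last exact: measurable_cst.
apply: measurable_fun_ifT => //; case: (j' == j) => //=.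
exact: measurable_ternary_digit.
Qed.

Lemma row_codeK : cancel row_code row_decode.
Proof.
move=> x; apply/rowP => j; rewrite mxE.
suff -> : einfs (row_decode_term j ^~ (row_code x)) 0%N = (x ord0 j)%:E by [].
have termE k : row_decode_term j k (row_code x) =
    if @unpickle ('I_n * rat)%type k is Some (j', q) then
      if (j' == j) && (x ord0 j < ratr q)%R then (ratr q)%:E else +oo
    else +oo.
  rewrite /row_decode_term /row_code ternary_digitK /row_bits.
  case: unpickle => [[j' q]|//].
  by case: eqP => [->|].
apply/eqP; rewrite eq_le; apply/andP; split; last first.
  apply: le_ereal_inf_tmp => _ [k _ <-]; rewrite termE.
  case: unpickle => [[j' q]|]; last by rewrite leey.
  by case: ifPn => [/andP[_ /ltW]|]; rewrite ?lee_fin ?leey.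
apply/lee_addgt0Pr => e e0.
have xe : (x ord0 j < x ord0 j + e)%R by rewrite ltrDl.
have [q] := rat_in_itvoo xe; rewrite in_itv/= => /andP[xq qe]; apply: (@le_trans _ _ (ratr q)%:E); last by rewrite -EFinD lee_fin ltW.
apply: ereal_inf_lbound; exists (pickle (j, q)) => //.
by rewrite termE pickleK eqxx xq.
Qed.

End row_coding.

Section normal_cdf.
Context {R : realType} (m s : R).
Hypothesis s_neq0 : s != 0.
Local Notation P := (normal_prob m s).

Definition normal_cdf (z : R) : R := fine (P `]-oo, z]).

Lemma normal_cdfE z : (P `]-oo, z] = (normal_cdf z)%:E)%E.
Proof. by rewrite fineK// fin_num_measure. Qed.

Lemma normal_cdf_ge0 z : 0 <= normal_cdf z.
Proof. exact: fine_ge0. Qed.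

Lemma normal_cdf_le1 z : normal_cdf z <= 1.
Proof. by rewrite -lee_fin -normal_cdfE probability_le1. Qed.

Lemma normal_cdf_nd : {homo normal_cdf : x y / x <= y}.
Proof.
move=> x y xy; rewrite -lee_fin -!normal_cdfE le_measure ?inE//.
exact: subitvPr.
Qed.

(** The density is bounded by its peak. This estimate stands for the continuity of the distribution
    function. *)
Lemma normal_cdf_lip z h : 0 <= h ->
  normal_cdf (z + h) <= normal_cdf z + normal_peak s * h.
Proof.
move=> h0; rewrite -lee_fin EFinD -!normal_cdfE.
have -> : [set` `]-oo, (z + h)]] = [set` `]-oo, z]] `|` [set` `]z, (z + h)]].
  by rewrite -itv_bndbnd_setU// bnd_simp// lerDl.
apply: le_trans (measureU2 _ _ _) _ => //; rewrite leeD2l//.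
rewrite /normal_prob; apply: (@le_trans _ _ (\int[lebesgue_measure]_(x in [set` `]z, z + h]%R]) (normal_peak s)%:E)%E).
  apply: ge0_le_integral => //.
  - by move=> x _; rewrite lee_fin normal_pdf_ge0.
  - by apply/measurable_EFinP/measurable_funTS; exact: measurable_normal_pdf.
  - by move=> x _; rewrite lee_fin; exact: normal_pdf_ub.
rewrite integral_cst//= lebesgue_measure_itv/= lte_fin.
case: ifPn => [_|]; first by rewrite -EFinB -EFinM lee_fin addrAC subrr add0r.
by rewrite mule0 lee_fin mulr_ge0// normal_peak_ge0.
Qed.

Lemma normal_cdf_gt c : c < 1 -> exists z, c < normal_cdf z.
Proof.
move=> c1; apply: contrapT => /forallNP H.
have : ((P \o (fun n : nat => [set` `]-oo, n%:R]%R])) @ \oo --> P (\bigcup_n [set` `]-oo, n%:R]%R]))%E.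
  apply: nondecreasing_cvg_mu => //.
  - exact: bigcupT_measurable.
  - by move=> i j ij; apply/subsetPset; apply: subitvPr; rewrite bnd_simp ler_nat.
rewrite (_ : \bigcup_n _ = setT); last first.
  apply/seteqP; split => // x _; exists (Num.truncn `|x|).+1 => //=.
  by rewrite in_itv/= (le_trans (ler_norm x))// ltW// truncnS_gt.
rewrite probability_setT => lim1.
suff : (1 <= c%:E)%E by rewrite lee_fin leNgt c1.
apply: (cvge_le _ lim1); apply: nearW => n /=.
by rewrite normal_cdfE lee_fin leNgt; apply/negP; exact: H.
Qed.

Lemma normal_cdf_lt c : 0 < c -> exists z, normal_cdf z < c.
Proof.
move=> c0; apply: contrapT => /forallNP H.
have : ((P \o (fun n : nat => [set` `](- n%:R), +oo[%R])) @ \oo -->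
    P (\bigcup_n [set` `](- n%:R), +oo[%R]))%E.
  apply: nondecreasing_cvg_mu => //.
  - exact: bigcupT_measurable.
  - by move=> i j ij; apply/subsetPset; apply: subitvPl; rewrite bnd_simp lerN2 ler_nat.
rewrite (_ : \bigcup_n _ = setT); last first.
  apply/seteqP; split => // x _; exists (Num.truncn `|x|).+1 => //=.
  by rewrite in_itv/= andbT ltrNl (le_lt_trans (ler_norm _))// normrN truncnS_gt.
rewrite probability_setT => lim1.
suff : (1 <= (1 - c)%:E)%E by rewrite lee_fin; lra.
apply: (cvge_le _ lim1); apply: nearW => n /=.
rewrite -setCitvl probability_setC//= normal_cdfE -EFinB lee_fin.
have /negP := H (- n%:R); rewrite -leNgt; lra.
Qed.

(** Probability integral transform: the distribution function of a normal variable is uniform on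
    [0, 1] when evaluated at that variable. For c < 1 a nonempty sublevel set is a half-line, and by
    continuity the distribution function equals c at its end point. *)
Lemma normal_prob_level (c : R) : 0 <= c <= 1 ->
  P [set z | normal_cdf z <= c] = c%:E.
Proof.
move=> /andP[c0]; rewrite le_eqVlt => /orP[/eqP ->|c1].
  rewrite (_ : [set z | _] = setT) ?probability_setT//.
  by apply/seteqP; split => // z _ /=; exact: normal_cdf_le1.
set A := [set z | _].
have [A0|/eqP/negP A0] := pselect (A = set0).
  rewrite A0 measure0; congr _%:E; apply/eqP; rewrite eq_le c0/= leNgt.
  apply/negP => /normal_cdf_lt[z zc].
  by have : A z by [rewrite /A/= ltW]; rewrite A0.
have [a Aa] : A !=set0 by apply/set0P/negP.
have [b cb] := normal_cdf_gt c1.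
have ubA : has_ubound A.
  exists b => z; rewrite /A/= => zc; rewrite leNgt; apply/negP => /ltW bz.
  by have := le_trans (normal_cdf_nd bz) zc; rewrite leNgt cb.
have hsA : has_sup A by split; [exists a|].
set t := sup A.
have peak0 : 0 < normal_peak s by exact: normal_peak_gt0.
have tc : normal_cdf t <= c.
  apply/ler_addgt0Pr => e e0.
  have ep : 0 < e / normal_peak s by rewrite divr_gt0.
  have [z Az zt] := sup_adherent ep hsA.
  have : normal_cdf t <= normal_cdf (z + e / normal_peak s).
    by apply: normal_cdf_nd; rewrite -lerBlDr ltW.
  move=> /le_trans; apply; apply: le_trans (normal_cdf_lip _ (ltW ep)) _.
  by rewrite mulrC divfK ?gt_eqF// lerD2r.
have ct : c <= normal_cdf t.
  apply/ler_addgt0Pr => e e0.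
  have ep : 0 < e / normal_peak s by rewrite divr_gt0.
  have : ~ A (t + e / normal_peak s).
    by move=> /(ub_le_sup ubA); rewrite -/t leNgt ltrDl ep.
  move=> /negP; rewrite -ltNge => /ltW/le_trans; apply.
  apply: le_trans (normal_cdf_lip _ (ltW ep)) _.
  by rewrite mulrC divfK ?gt_eqF.
have -> : A = `]-oo, t]%classic.
  apply/seteqP; split => z /=; rewrite in_itv/=; first exact: ub_le_sup.
  by move=> zt; apply: le_trans tc; exact: normal_cdf_nd.
by rewrite normal_cdfE; congr _%:E; apply/eqP; rewrite eq_le tc ct.
Qed.

Lemma normal_prob_level_lt (c : R) : 0 <= c <= 1 ->
  P [set z | normal_cdf z < c] = c%:E.
Proof.
move=> c01; have /andP[c0 c1] := c01.
have mcdf : measurable_fun setT normal_cdf.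
  by apply: nondecreasing_measurable => //; exact: normal_cdf_nd.
have mlt : measurable [set z | normal_cdf z < c] by exact: measurable_lt_set.
apply/eqP; rewrite eq_le; apply/andP; split.
  rewrite -(normal_prob_level c01); apply: le_measure; rewrite ?inE//.
    rewrite [X in measurable X](_ : _ = ~` [set z | c < normal_cdf z]); last first.
      by apply/seteqP; split => z /=; rewrite leNgt => /negP.
    by apply: measurableC; exact: measurable_lt_set.
  by move=> z /= /ltW.
apply/lee_addgt0Pr => e e0.
have [ce|ce] := leP c e.
  by apply: (@le_trans _ _ e%:E); rewrite ?lee_fin// leeDr.
rewrite -leeBlDr// -EFinB -(@normal_prob_level (c - e)); last by apply/andP; split; lra.
apply: le_measure; rewrite ?inE//.
  rewrite [X in measurable X](_ : _ = ~` [set z | c - e < normal_cdf z]); last first.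
    by apply/seteqP; split => z /=; rewrite leNgt => /negP.
  by apply: measurableC; exact: measurable_lt_set.
by move=> z /= h; apply: le_lt_trans h _; rewrite ltrBlDr ltrDl.
Qed.

End normal_cdf.

Section randomization.
Context {d} {X : measurableType d} {R : realType} (p : nat).
Variables (kappa : R.-pker X ~> 'rV[R]_p) (s : R).
Hypothesis s_neq0 : s != 0.

Definition code_cdf (x : X) (t : R) : R :=
  fine (kappa x [set y | row_code y <= t]).

Lemma measurable_code_le (t : R) :
  measurable [set y : 'rV[R]_p | row_code y <= t].
Proof.
rewrite [X in measurable X](_ : _ = ~` [set y | t < row_code y]); last first.
  by apply/seteqP; split => z /=; rewrite leNgt => /negP.
by apply: measurableC; apply: measurable_lt_set => //; exact: measurable_row_code.
Qed.

Lemma measurable_code_lt (t : R) :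
  measurable [set y : 'rV[R]_p | row_code y < t].
Proof. by apply: measurable_lt_set => //; exact: measurable_row_code. Qed.

Lemma code_cdfE x t : kappa x [set y | row_code y <= t] = (code_cdf x t)%:E.
Proof.
rewrite fineK// ge0_fin_numE//; apply: (@le_lt_trans _ _ 1%E); last exact: ltry.
rewrite -(@prob_kernel _ _ _ _ _ kappa x); apply: le_measure; rewrite ?inE//.
exact: measurable_code_le.
Qed.

(* The quantile is an infimum over an enumeration of the rationals, hence jointly
   measurable; rationals above 1 are always admitted to keep the infimum finite,
   which is harmless as codes are at most 1 / 2. *)
Definition quantile_term (k : nat) (xz : X * R) : \bar R :=
  if @unpickle rat k is Some q then
    if (0 <= ratr q :> R) &&
       ((1 <= ratr q :> R) || (normal_cdf 0 s xz.2 <= code_cdf xz.1 (ratr q)))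
    then (ratr q)%:E else +oo%E
  else +oo%E.

Definition quantile (xz : X * R) : R := fine (einfs (quantile_term ^~ xz) 0%N).

Lemma measurable_quantile : measurable_fun setT quantile.
Proof.
apply: measurableT_comp => //; apply: measurable_fun_einfs => k.
rewrite /quantile_term; case: unpickle => [q|]; last exact: measurable_cst.
apply: measurable_fun_ifT => //; case: (_ <= _) => //=; case: (_ <= _) => //=.
apply: measurable_fun_ler.
  apply: measurableT_comp => //.
  by apply: nondecreasing_measurable => //; exact: normal_cdf_nd.
apply: (@measurableT_comp _ _ _ _ _ _ (fun x => code_cdf x (ratr q))) => //.
apply: measurableT_comp => //.
exact: (measurable_kernel kappa _ (measurable_code_le _)).
Qed.

Lemma quantile_ltP xz (t : R) : reflect
  (exists q : rat, [/\ 0 <= ratr q :> R, (ratr q < t) &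
     (1 <= ratr q :> R) || (normal_cdf 0 s xz.2 <= code_cdf xz.1 (ratr q))])
  (quantile xz < t).
Proof.
have ge0 : (0 <= einfs (quantile_term ^~ xz) 0%N)%E.
  apply: le_ereal_inf_tmp => _ [k _ <-]; rewrite /quantile_term.
  case: unpickle => [q|//]; case: ifPn => [/andP[]//|_].
  by rewrite leey.
have le1 : (einfs (quantile_term ^~ xz) 0%N <= 1)%E.
  have [q1 q1E] : exists q : rat, ratr q = 1 :> R by exists 1%Q; rewrite rmorph1.
  apply: ereal_inf_lbound; exists (pickle q1) => //.
  by rewrite /quantile_term pickleK q1E ler01 lexx.
have qE : einfs (quantile_term ^~ xz) 0%N = (quantile xz)%:E.
  by rewrite fineK// ge0_fin_numE// (le_lt_trans le1)// ltry.
apply: (iffP idP) => [|[q [q0 qt qc]]].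
  rewrite -lte_fin -qE => /ereal_inf_lt[_ [k _ <-]]; rewrite /quantile_term.
  by case: unpickle => [q|//]; case: ifPn => [/andP[q0 qc]|//]; rewrite lte_fin; exists q.
rewrite -lte_fin -qE; apply: (@le_lt_trans _ _ (ratr q)%:E); last by rewrite lte_fin.
apply: ereal_inf_lbound; exists (pickle q) => //.
by rewrite /quantile_term pickleK q0 qc.
Qed.

(** With c the mass under [kappa x] of the codes less than t, the event is squeezed between
    [normal_cdf] < c and [normal_cdf] <= c, both of probability c. *)
Lemma quantile_law_lt x t :
  (normal_prob 0 s [set z | (quantile (x, z) < t)%R] =
   kappa x [set y | (row_code y < t)%R])%E.
Proof.
set c := fine (kappa x [set y | row_code y < t]).
have k1 A : measurable A -> (kappa x A <= 1)%E.
  by move=> mA; rewrite -(@prob_kernel _ _ _ _ _ kappa x); apply: le_measure; rewrite ?inE.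
have cE : kappa x [set y | row_code y < t] = c%:E.
  rewrite fineK// ge0_fin_numE//; apply: (@le_lt_trans _ _ 1%E); last exact: ltry.
  by apply: k1; exact: measurable_code_lt.
have c01 : 0 <= c <= 1.
  by rewrite -!lee_fin -cE measure_ge0 k1//; exact: measurable_code_lt.
have mq : measurable [set z | quantile (x, z) < t].
  apply: measurable_lt_set => //.
  exact: (measurableT_comp measurable_quantile (measurable_pair1 x)).
have mcdf : measurable_fun setT (normal_cdf 0 s).
  by apply: nondecreasing_measurable => //; exact: normal_cdf_nd.
rewrite cE; apply/eqP; rewrite eq_le; apply/andP; split.
  rewrite -(normal_prob_level 0 s_neq0 c01); apply: le_measure; rewrite ?inE//.
    rewrite [X in measurable X](_ : _ = ~` [set z | c < normal_cdf 0 s z]); last first.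
      by apply/seteqP; split => z /=; rewrite leNgt => /negP.
    by apply: measurableC; exact: measurable_lt_set.
  move=> z /= /quantile_ltP[q [q0 qt /orP[q1|qc]]].
    rewrite (le_trans (normal_cdf_le1 _ _ _))// -lee_fin -cE.
    rewrite (_ : [set y | _] = setT) ?prob_kernel//.
    apply/seteqP; split => // y _ /=.
    have /andP[_] := @ternary_value_itv R (row_bits y); rewrite -/(row_code y); lra.
  apply: le_trans qc _; rewrite -lee_fin -cE /= -code_cdfE; apply: le_measure; rewrite ?inE.
  - exact: measurable_code_le.
  - exact: measurable_code_lt.
  - by move=> y /= /le_lt_trans; exact.
rewrite -(normal_prob_level_lt 0 s_neq0 c01); apply: le_measure; rewrite ?inE//.
  exact: measurable_lt_set.
move=> z /= zc; apply/quantile_ltP.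
(* Continuity from below gives a level strictly less than t whose mass already exceeds [normal_cdf]
   at z; a rational between this level and t is the witness. *)
pose L (k : nat) : set 'rV[R]_p := [set y | row_code y <= t - k.+1%:R^-1].
have : (kappa x \o L @ \oo --> kappa x (\bigcup_k L k))%E.
  apply: nondecreasing_cvg_mu => //.
  - by move=> i; exact: measurable_code_le.
  - by apply: bigcupT_measurable => i; exact: measurable_code_le.
  - move=> i j ij; apply/subsetPset => y; rewrite /L/= => /le_trans; apply.
    by rewrite lerB// lef_pV2 ?posrE// ler_nat.
rewrite (_ : \bigcup_k _ = [set y | row_code y < t]); last first.
  apply/seteqP; split => [y [k _ /= h]|y /= yt].
    by apply: le_lt_trans h _; rewrite ltrBlDr ltrDl invr_gt0.
  have ty : 0 < t - row_code y by rewrite subr_gt0.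
  have [k kP] := ltr_add_invr yt.
  by exists k => //; rewrite /L/= lerBrDr ltW.
rewrite cE => cvgc.
have [k hk] : exists k, normal_cdf 0 s z < code_cdf x (t - k.+1%:R^-1).
  apply: contrapT => /forallNP H.
  suff : (c%:E <= (normal_cdf 0 s z)%:E)%E by rewrite lee_fin leNgt zc.
  apply: (cvge_le _ cvgc); apply: nearW => k /=.
  by rewrite code_cdfE lee_fin leNgt; apply/negP; exact: H.
have tk : t - k.+1%:R^-1 < t by rewrite ltrBlDr ltrDl invr_gt0.
have [q] := rat_in_itvoo tk; rewrite in_itv/= => /andP[q1 q2].
have mono : code_cdf x (t - k.+1%:R^-1) <= code_cdf x (ratr q).
  rewrite -lee_fin -!code_cdfE; apply: le_measure; rewrite ?inE.
  - exact: measurable_code_le.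
  - exact: measurable_code_le.
  - by move=> y /= /le_trans; apply; exact: ltW.
exists q; split => //; last by rewrite (le_trans _ mono) ?orbT// ltW.
(* Codes are nonnegative, so a negative q would have mass 0, which cannot exceed a value of
   [normal_cdf]. *)
rewrite leNgt; apply/negP => q0.
have := lt_le_trans hk mono.
rewrite ltNge => /negP; apply; rewrite /code_cdf.
rewrite (_ : [set y | _] = set0) ?measure0 ?normal_cdf_ge0//.
rewrite -subset0 => y /=; have /andP[+ _] := @ternary_value_itv R (row_bits y).
by rewrite -/(row_code y) => h1 /(le_trans h1); rewrite leNgt q0.
Qed.

(** Equality on open half-lines determines the law of the code; decoding transports it back to R^p
    by [row_codeK]. *)
Lemma quantile_law x (E : set 'rV[R]_p) : measurable E ->
  normal_prob 0 s [set z | E (row_decode p (quantile (x, z)))] = kappa x E.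
Proof.
move=> mE.
have mq : measurable_fun setT (fun z => quantile (x, z)).
  exact: (measurableT_comp measurable_quantile (measurable_pair1 x)).
have mq' : @measurable_fun _ _ (measurableTypeR R) (measurableTypeR R) setT
    (fun z => quantile (x, z)) by exact: mq.
pose qi := isMeasurableFun.Build _ _ _ _ _ mq'.
pose qm : {mfun (measurableTypeR R) >-> (measurableTypeR R)} := HB.pack (fun z => quantile (x, z)) qi.
have mc' : @measurable_fun _ _ 'rV[R]_p (measurableTypeR R) setT (@row_code R p).
  exact: measurable_row_code.
pose ci := isMeasurableFun.Build _ _ _ _ _ mc'.
pose cm : {mfun 'rV[R]_p >-> (measurableTypeR R)} := HB.pack (@row_code R p) ci.
have H A : measurable A ->
    distribution (normal_prob 0 s) qm A = distribution (kernel_at kappa x) cm A.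
  move=> mA; apply: (@measure_unique _ R (measurableTypeR R) (@RGenInftyO.G R) (fun k => [set` `]-oo, k%:R[%R])) => //.
  - exact: RGenInftyO.measurableE.
  - move=> _ _ [a ->] [b ->]; exists (Num.min a b).
    by apply/seteqP; split => y /=; rewrite !in_itv/= lt_min => /andP.
  - by move=> i; exists i%:R.
  - apply/seteqP; split => // y _; exists (Num.truncn `|y|).+1 => //=.
    by rewrite in_itv/= (le_lt_trans (ler_norm y))// truncnS_gt.
  - move=> _ [a ->].
    have e1 : qm @^-1` [set` `]-oo, a[%R] = [set z | quantile (x, z) < a].
      by apply/seteqP; split => y /=; rewrite in_itv.
    have e2 : cm @^-1` [set` `]-oo, a[%R] = [set y | row_code y < a].
      by apply/seteqP; split => y /=; rewrite in_itv.
    rewrite /= /distribution /pushforward e1 e2.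
    exact: quantile_law_lt.
  - move=> k; apply: (@le_lt_trans _ _ 1%E); last exact: ltry.
    exact: probability_le1.
have mdE : measurable ((@row_decode R p) @^-1` E).
  by rewrite -[X in measurable X]setTI; exact: measurable_row_decode.
have := H _ mdE; rewrite /distribution /pushforward/= => hE.
transitivity (normal_prob 0 s ((fun z => quantile (x, z)) @^-1` (@row_decode R p @^-1` E))) => //.
rewrite hE; congr (kappa x _).
by apply/seteqP; split => y /=; rewrite row_codeK.
Qed.

Lemma rV_cons_head n (z : measurableTypeR R * 'rV[R]_n) :
  rV_cons z ord0 ord0 = z.1.
Proof.
rewrite /rV_cons (_ : (ord0 : 'I_(1 + n)) = lshift n ord0) ?row_mxEl ?mxE//.
exact: val_inj.
Qed.

Lemma gaussian_head n (B : set R) : measurable B ->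
  gaussian s (0 : 'rV[R]_(1 + n)) [set y | B (y ord0 ord0)] = normal_prob 0 s B.
Proof.
move=> mB; rewrite /= /distribution /pushforward.
rewrite (_ : _ @^-1` _ = B `*` setT); last first.
  apply/seteqP; split => z; rewrite /preimage/= rV_cons_head//.
  by case.
by rewrite product_measure1E//= probability_setT mule1 mxE.
Qed.

(** Inverse transform sampling: one coordinate of the Gaussian vector provides the randomness for
    the code, which represents a whole vector of R^p. This takes a positive dimension. *)
Theorem kernel_randomization n : (0 < n)%N ->
  exists2 F : X * 'rV[R]_n -> 'rV[R]_p, measurable_fun setT F &
  forall x E, measurable E ->
    gaussian s (0 : 'rV[R]_n) [set y | E (F (x, y))] = kappa x E.
Proof.
case: n => // n _.
exists (fun xy : X * 'rV[R]_(1 + n) => row_decode p (quantile (xy.1, xy.2 ord0 ord0))).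
  apply: measurableT_comp; first exact: measurable_row_decode.
  apply: measurableT_comp; first exact: measurable_quantile.
  apply: measurable_fun_pair => //.
  exact: (measurableT_comp (@measurable_coord R (1 + n) ord0)).
move=> x E mE; rewrite -(quantile_law x mE).
apply: (@gaussian_head n [set z | E (row_decode p (quantile (x, z)))]).
rewrite -[X in measurable X]setTI.
have mq : measurable_fun setT (fun z => quantile (x, z)).
  exact: (measurableT_comp measurable_quantile (measurable_pair1 x)).
exact: (measurableT_comp (@measurable_row_decode R p) mq).
Qed.

End randomization.

(** * Trajectories and their expected return *)

Section realization.
Context {R : realType} {d} {T : measurableType d} (Pr : probability T R).
Variables (n m : nat) (sigma : R) (noise : nat -> {mfun T >-> 'rV[R]_n}).
Hypothesis iid : iid_gaussian_noise Pr sigma noise.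
Hypotheses (n_gt0 : (0 < n)%N) (sigma_gt0 : 0 < sigma).
Variables (S : set 'rV[R]_n) (A : set 'rV[R]_m).
Variables (proj : {mfun 'rV[R]_n >-> 'rV[R]_n}) (pi : {mfun 'rV[R]_n >-> 'rV[R]_m}).
Hypotheses (projS : forall s, S (proj s)) (piA : is_deterministic_policy S A pi).
Variables (P : R.-pker ('rV[R]_n * 'rV[R]_m) ~> 'rV[R]_n) (s0 : 'rV[R]_n).

Definition policy_point (s : 'rV[R]_n) : 'rV[R]_n * 'rV[R]_m :=
  (proj s, pi (proj s)).

Lemma measurable_policy_point : measurable_fun setT policy_point.
Proof. by apply: measurable_fun_pair => //; exact: measurableT_comp. Qed.

(** The step from u to u + 1 consumes [noise u], so that the state at time t depends on the noise
    before t only. *)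
Fixpoint simulated_state (F : ('rV[R]_n * 'rV[R]_m) * 'rV[R]_n -> 'rV[R]_n)
    (t : nat) (w : T) : 'rV[R]_n :=
  if t is u.+1 then F (policy_point (simulated_state F u w), noise u w) else s0.

Lemma simulated_state_past F t u : measurable_fun setT F -> (t <= u)%N ->
  measurable_fun [set: g_sigma_algebraType (noise_past noise u)]
    (simulated_state F t).
Proof.
move=> mF; elim: t => [|t IH] tu /=; first exact: measurable_cst.
apply: (measurableT_comp mF); apply: measurable_fun_pair.
  by apply: (measurableT_comp measurable_policy_point); exact: IH (ltnW tu).
exact: noise_past_measurable_fun.
Qed.

Lemma simulated_state_measurable F t : measurable_fun setT F ->
  measurable_fun setT (simulated_state F t).
Proof.
move=> mF; elim: t => [|t IH] /=; first exact: measurable_cst.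
apply: (measurableT_comp mF); apply: measurable_fun_pair => //.
exact: (measurableT_comp measurable_policy_point).
Qed.

(** The history up to time t lies in the sigma-algebra of the noise before t, of which [noise t] is
    independent. Integrating [noise t] out leaves the kernel [P], by the choice of F. *)
Lemma trajectory_exists :
  exists (st : nat -> {mfun T >-> 'rV[R]_n}) (ac : nat -> {mfun T >-> 'rV[R]_m}),
    is_trajectory A proj (deterministic pi) P s0 Pr st ac.
Proof.
have sn0 : sigma != 0 by rewrite gt_eqF.
have [F mF FE] := kernel_randomization P sn0 n_gt0.
pose x t w := simulated_state F t w.
pose st t : {mfun T >-> 'rV[R]_n} :=
  HB.pack (x t) (isMeasurableFun.Build _ _ _ _ (x t) (simulated_state_measurable t mF)).
have mac t : measurable_fun setT (fun w => pi (proj (x t w))).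
  apply: measurableT_comp => //; apply: measurableT_comp => //.
  exact: simulated_state_measurable.
pose ac t : {mfun T >-> 'rV[R]_m} :=
  HB.pack (fun w => pi (proj (x t w))) (isMeasurableFun.Build _ _ _ _ _ (mac t)).
have pastE t i E : (i <= t)%N -> measurable E -> <<s noise_past noise t >> (x i @^-1` E).
  move=> it mE; have := simulated_state_past mF it measurableT mE.
  by rewrite setTI.
(* The bound on u covers u = t, for the law of the action, and u = t + 1, for the law of the next
   state. *)
have hist t G u : (u <= t.+1)%N -> history st ac t.+1 u G -> <<s noise_past noise t >> G.
  move=> ut; move: G; apply: smallest_sub; first exact: smallest_sigma_algebra.
  move=> _ [[i it [E mE <-]]|[i it [E mE <-]]]; first exact: (pastE t i E it mE).
  have mE' : measurable ((fun s => pi (proj s)) @^-1` E).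
    have mpp : measurable_fun setT (fun s => pi (proj s)) by exact: measurableT_comp.
    by rewrite -[X in measurable X]setTI; exact: mpp.
  have it' : (i <= t)%N by rewrite -ltnS; exact: leq_trans it ut.
  exact: (pastE t i _ it' mE').
have measE X : <<s noise_past noise X >> `<=` measurable.
  by move=> G; exact: noise_past_measurable.
exists st, ac; split => //.
- by move=> t w; apply: piA; exact: projS.
- move=> t G E hG mE.
  have mG : measurable G by exact: (measE t _ (hist t G t (leqnSn t) hG)).
  rewrite setIC -(@integral_indic _ _ _ Pr G mG (ac t @^-1` E)); last exact: measurable_funPTI.
  by apply: eq_integral => w _; rewrite /deterministic /kdirac /= diracE.
- move=> t G E hG mE.
  have pG : <<s noise_past noise t >> G by exact: (hist t G t.+1 (leqnn _) hG).
  have mG : measurable G by exact: (measE t _ pG).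
  (* The real component will receive the indicator of G; the absolute value makes f nonnegative on
     its whole domain. *)
  pose f (z : (R * ('rV[R]_n * 'rV[R]_m)) * 'rV[R]_n) : \bar R :=
    (`|z.1.1| * \1_E (F (z.1.2, z.2)))%:E.
  have mf : measurable_fun setT f.
    apply/measurable_EFinP; apply: measurable_funM.
      apply: measurableT_comp => //.
      exact: (measurableT_comp measurable_fst measurable_fst).
    apply: measurableT_comp; first exact: measurable_indic.
    apply: measurableT_comp => //; apply: measurable_fun_pair => //.
    exact: (measurableT_comp measurable_snd measurable_fst).
  have f0 z : (0 <= f z)%E by rewrite lee_fin mulr_ge0.
  have mX : measurable_fun [set: g_sigma_algebraType (noise_past noise t)]
      (fun w => (\1_G w : R, policy_point (x t w))).
    apply: measurable_fun_pair; first exact: measurable_indic.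
    apply: (measurableT_comp measurable_policy_point).
    exact: simulated_state_past.
  have eqn := ge0_integral_noise iid mX mf f0.
  have mEs : measurable (st t.+1 @^-1` E) by exact: measurable_funPTI.
  transitivity (\int[Pr]_w (\1_(G `&` st t.+1 @^-1` E) w)%:E)%E.
    by rewrite integral_indic ?setIT//; exact: measurableI.
  transitivity (\int[Pr]_w f (\1_G w, policy_point (x t w), noise t w))%E.
    by apply: eq_integral => w _; rewrite /f/= ger0_norm// indicI.
  rewrite eqn [RHS]integral_mkcond; apply: eq_integral => w _.
  rewrite epatch_indic /= -FE//.
  have mEF : measurable [set y | E (F (policy_point (x t w), y))].
    rewrite -[X in measurable X]setTI.
    exact: (measurableT_comp mF (measurable_pair1 _)).
  rewrite muleC -[X in gaussian sigma 0 X]setIT -integral_indic//.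
  rewrite -ge0_integralZl//; last exact/measurable_EFinP/measurable_indic.
  by apply: eq_integral => y _; rewrite /f/= ger0_norm// -EFinM !indicE.
Qed.

End realization.

Section conditional_integrals.
Local Open Scope ereal_scope.

Lemma ge0_integral_eq_rectangles d1 d2 d (T : measurableType d)
    (T1 : measurableType d1) (T2 : measurableType d2) (R : realType)
    (Pr : probability T R) (X : T -> T1) (Y Z : T -> T2) (f : T1 * T2 -> \bar R) :
  measurable_fun setT X -> measurable_fun setT Y -> measurable_fun setT Z ->
  (forall A B, measurable A -> measurable B ->
     Pr (X @^-1` A `&` Y @^-1` B) = Pr (X @^-1` A `&` Z @^-1` B)) ->
  measurable_fun setT f -> (forall z, 0 <= f z) ->
  \int[Pr]_w f (X w, Y w) = \int[Pr]_w f (X w, Z w).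
Proof.
move=> mX mY mZ XYZ mf f0.
have mXY : measurable_fun setT (fun w => (X w, Y w)) by exact: measurable_fun_pair.
have mXZ : measurable_fun setT (fun w => (X w, Z w)) by exact: measurable_fun_pair.
pose XY : {mfun T >-> (T1 * T2)%type} :=
  HB.pack (fun w => (X w, Y w)) (isMeasurableFun.Build _ _ _ _ _ mXY).
pose XZ : {mfun T >-> (T1 * T2)%type} :=
  HB.pack (fun w => (X w, Z w)) (isMeasurableFun.Build _ _ _ _ _ mXZ).
have E C : measurable C -> distribution Pr XY C = distribution Pr XZ C.
  move=> mC; apply: (measure_unique [set A `*` B | A in measurable & B in measurable]
    (fun=> setT)) => //.
  - exact: measurable_prod_measurableType.
  - move=> _ _ [A mA [B mB <-]] [A' mA' [B' mB' <-]]; rewrite -setXI.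
    by exists (A `&` A'); [exact: measurableI|exists (B `&` B'); [exact: measurableI|]].
  - by move=> _; exists setT => //; exists setT => //; rewrite setXTT.
  - by rewrite bigcup_const//; exists 0%N.
  - by move=> _ [A mA [B mB <-]]; exact: XYZ.
  - by move=> _; apply: (@le_lt_trans _ _ 1); [exact: probability_le1|exact: ltry].
transitivity (\int[distribution Pr XY]_z f z).
  by rewrite ge0_integral_distribution.
transitivity (\int[distribution Pr XZ]_z f z).
  by apply: eq_measure_integral => C mC _; exact: E.
by rewrite ge0_integral_distribution.
Qed.

Section kernel_precomp.
Context d1 d2 d (Z : measurableType d) (X : measurableType d1)
  (Y : measurableType d2) (R : realType).
Variables (kappa : R.-pker X ~> Y) (phi : Z -> X).
Hypothesis mphi : measurable_fun setT phi.

(** The measurability proof is an argument so that the kernel structures, which rest on it, can be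
    attached to the term. *)
Definition kernel_precomp (_ : measurable_fun setT phi) (z : Z) :
  {measure set Y -> \bar R} := kappa (phi z).

Let measurable_kernel_precomp U : measurable U ->
  measurable_fun [set: Z] (kernel_precomp mphi ^~ U).
Proof. by move=> mU; apply: (measurableT_comp (measurable_kernel kappa U mU)). Qed.

HB.instance Definition _ := isKernel.Build _ _ _ _ _ (kernel_precomp mphi)
  measurable_kernel_precomp.

Let kernel_precomp_prob z : kernel_precomp mphi z [set: Y] = 1.
Proof. exact: prob_kernel. Qed.

HB.instance Definition _ := Kernel_isProbability.Build _ _ _ _ _
  (kernel_precomp mphi) kernel_precomp_prob.

End kernel_precomp.

(** With Pr seen as a kernel from the one-point space, the law of Y is a composition of kernels,
    whose integrals are iterated ones. *)
Lemma ge0_integral_kernel_law d1 d2 d (T : measurableType d)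
    (T1 : measurableType d1) (T2 : measurableType d2) (R : realType)
    (Pr : probability T R) (kappa : R.-pker T1 ~> T2) (X : T -> T1) (Y : T -> T2)
    (f : T2 -> \bar R) :
  measurable_fun setT X -> measurable_fun setT Y ->
  (forall B, measurable B -> Pr (Y @^-1` B) = \int[Pr]_w kappa (X w) B) ->
  measurable_fun setT f -> (forall y, 0 <= f y) ->
  \int[Pr]_w f (Y w) = \int[Pr]_w \int[kappa (X w)]_y f y.
Proof.
move=> mX mY XY mf f0.
pose Y' : {mfun T >-> T2} := HB.pack Y (isMeasurableFun.Build _ _ _ _ _ mY).
pose l : R.-pker unit ~> T :=
  kprobability (measurable_cst (Pr : pprobability T R) : measurable_fun [set: unit] _).
have mX2 : measurable_fun setT (fun z : unit * T => X z.2) by exact: measurableT_comp.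
pose k : R.-pker (unit * T)%type ~> T2 := kernel_precomp kappa mX2.
transitivity (\int[distribution Pr Y']_y f y).
  by rewrite ge0_integral_distribution.
transitivity (\int[kcomp l k tt]_y f y).
  by apply: eq_measure_integral => C mC _; exact: XY.
by rewrite integral_kcomp.
Qed.

End conditional_integrals.

Section trajectory_integrals.
Context {R : realType} (n m : nat).
Variables (S : set 'rV[R]_n) (A : set 'rV[R]_m).
Variables (proj : {mfun 'rV[R]_n >-> 'rV[R]_n}) (pi : {mfun 'rV[R]_n >-> 'rV[R]_m}).
Hypotheses (projS : forall s, S (proj s)) (piA : is_deterministic_policy S A pi).
Local Open Scope ereal_scope.

Local Notation point := (policy_point proj pi).

(** The transition operator of the Markov chain that follows [pi] under [P]. *)
Definition policy_step (P : R.-pker ('rV[R]_n * 'rV[R]_m) ~> 'rV[R]_n)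
    (h : 'rV[R]_n -> \bar R) (s : 'rV[R]_n) : \bar R :=
  \int[P (point s)]_y h y.

Lemma policy_step_ge0 P h : (forall y, 0 <= h y) -> forall s, 0 <= policy_step P h s.
Proof. by move=> h0 s; exact: integral_ge0. Qed.

Lemma measurable_policy_step P h : (forall y, 0 <= h y) ->
  measurable_fun setT h -> measurable_fun setT (policy_step P h).
Proof.
move=> h0 mh.
apply: (@measurableT_comp _ _ _ _ _ _ (fun x => \int[P x]_y h y)); last first.
  exact: measurable_policy_point.
by apply: measurable_fun_integral_kernel => // U mU; exact: measurable_kernel.
Qed.

Section trajectory.
Context (P : R.-pker ('rV[R]_n * 'rV[R]_m) ~> 'rV[R]_n) (s0 : 'rV[R]_n).
Context {d} {T : measurableType d} (Pr : probability T R).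
Variables (st : nat -> {mfun T >-> 'rV[R]_n}) (ac : nat -> {mfun T >-> 'rV[R]_m}).
Hypothesis traj : is_trajectory A proj (deterministic pi) P s0 Pr st ac.

(** The conditional law of the action is a Dirac mass, so the actual and the prescribed actions have
    the same joint law with the state. *)
Lemma integral_trajectory_action t (h : 'rV[R]_n * 'rV[R]_m -> \bar R) :
  measurable_fun setT h -> (forall x, 0 <= h x) ->
  \int[Pr]_w h (proj (st t w), ac t w) = \int[Pr]_w h (point (st t w)).
Proof.
move=> mh h0.
have mpp : measurable_fun setT (fun s => pi (proj s)) by exact: measurableT_comp.
apply: (@ge0_integral_eq_rectangles _ _ _ _ _ _ _ Pr (st t) (ac t)
  (fun w => pi (proj (st t w))) (fun z => h (proj z.1, z.2))) => //.
- exact: (measurableT_comp mpp).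
- move=> C B mC mB; rewrite (traj_action traj) //; last first.
    by apply: sub_gen_smallest; left; exists t => //=; exists C.
  have mB' : measurable ((fun w => pi (proj (st t w))) @^-1` B).
    by rewrite -[X in measurable X]setTI; apply: (measurableT_comp mpp).
  have mC' : measurable (st t @^-1` C) by exact: measurable_funPTI.
  rewrite setIC -(@integral_indic _ _ _ Pr _ mC' _ mB').
  by apply: eq_integral => w _; rewrite /deterministic /kdirac /= diracE.
- apply: measurableT_comp => //; apply: measurable_fun_pair => //.
  exact: measurableT_comp.
Qed.

Lemma integral_trajectory_next t (h : 'rV[R]_n -> \bar R) :
  measurable_fun setT h -> (forall y, 0 <= h y) ->
  \int[Pr]_w h (st t.+1 w) = \int[Pr]_w policy_step P h (st t w).
Proof.
move=> mh h0.
transitivity (\int[Pr]_w \int[P (proj (st t w), ac t w)]_y h y); last first.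
  apply: (integral_trajectory_action t (h := fun x => \int[P x]_y h y)).
    by apply: measurable_fun_integral_kernel => // U mU; exact: measurable_kernel.
  by move=> x; exact: integral_ge0.
apply: (@ge0_integral_kernel_law _ _ _ _ _ _ _ Pr P
  (fun w => (proj (st t w), ac t w)) (st t.+1)) => //.
- by apply: measurable_fun_pair => //; exact: measurableT_comp.
- move=> B mB; rewrite -[X in Pr X]setTI (traj_next_state traj)//.
  have hT : forall G : set (set T), <<s G >> setT.
    by move=> G; have [s0' sC _] := smallest_sigma_algebra setT G; have := sC _ s0'; rewrite setD0.
  exact: hT.
Qed.

Lemma integral_trajectory_state t (h : 'rV[R]_n -> \bar R) :
  measurable_fun setT h -> (forall y, 0 <= h y) ->
  \int[Pr]_w h (st t w) = iter t (policy_step P) h s0.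
Proof.
elim: t h => [|t IH] h mh h0.
  under eq_integral do rewrite (traj_init traj).
  by rewrite integral_cst//= probability_setT mule1.
rewrite integral_trajectory_next// IH ?iterSr//.
- exact: measurable_policy_step.
- exact: policy_step_ge0.
Qed.

(** The right-hand side does not mention the realization: probability spaces and processes disappear
    from the comparison of robust values, and only iterates of operators remain. *)
Lemma trajectory_return (r : 'rV[R]_n * 'rV[R]_m -> R) (gamma : R) :
  measurable (S `*` A) -> measurable_fun (S `*` A) r ->
  (forall x, (S `*` A) x -> 0 <= r x <= 1)%R -> (0 <= gamma)%R ->
  \int[Pr]_w (\sum_(0 <= t <oo) (gamma ^+ t * r (proj (st t w), ac t w))%:E) =
  \sum_(0 <= t <oo) (gamma ^+ t)%:E *
     iter t (policy_step P) (fun s => (r (point s))%:E) s0.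
Proof.
move=> mSA mr r01 gamma0.
(* The reward is measurable and bounded on S x A only; its extension by 0 agrees with it along the
   trajectory. *)
pose r' := r \_ (S `*` A).
have r'0 x : (0 <= r' x)%R.
  by rewrite /r' patchE; case: ifPn => // /[!inE] xSA; have /andP[] := r01 _ xSA.
have mr' : measurable_fun setT r' by apply/(measurable_restrictT _ mSA).
have pointSA s : (S `*` A) (point s) by split; [exact: projS|exact/piA/projS].
have r'E x : (S `*` A) x -> r' x = r x by move=> xSA; rewrite /r' patchE mem_set.
have xSA t w : (S `*` A) (proj (st t w), ac t w).
  by split; [exact: projS|exact: (traj_action_space traj)].
transitivity (\int[Pr]_w (\sum_(0 <= t <oo) (gamma ^+ t * r' (proj (st t w), ac t w))%:E)).
  by apply: eq_integral => w _; apply: eq_eseriesr => t _; rewrite r'E.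
have mx t : measurable_fun setT (fun w => (proj (st t w), ac t w)).
  by apply: measurable_fun_pair => //; exact: measurableT_comp.
have mrx t : measurable_fun setT (fun w => (r' (proj (st t w), ac t w))%:E).
  by apply/measurable_EFinP; exact: (measurableT_comp mr' (mx t)).
rewrite integral_nneseries//; last 2 first.
- move=> t; apply/measurable_EFinP; apply: measurable_funM => //.
  exact: (measurableT_comp mr' (mx t)).
- by move=> t w _; rewrite lee_fin mulr_ge0// exprn_ge0.
apply: eq_eseriesr => t _.
under eq_integral do rewrite EFinM.
rewrite ge0_integralZl//; last 2 first.
- by move=> w _; rewrite lee_fin.
- by rewrite lee_fin exprn_ge0.
congr (_ * _).
have mr'e : measurable_fun setT (fun x => (r' x)%:E) by exact/measurable_EFinP.
rewrite (integral_trajectory_action t mr'e)//.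
rewrite (integral_trajectory_state t (h := fun s => (r' (point s))%:E))//.
- by congr (iter t (policy_step P) _ s0); apply/funext => s; rewrite r'E.
- exact: (measurableT_comp mr'e (measurable_policy_point proj pi)).
- by move=> y; rewrite lee_fin.
Qed.

End trajectory.

End trajectory_integrals.

(** * Iterates of two nearby transition operators and discounted sums *)

Section kernel_comparison.
Context {R : realType} (n m : nat).
Variables (proj : {mfun 'rV[R]_n >-> 'rV[R]_n}) (pi : {mfun 'rV[R]_n >-> 'rV[R]_m}).
Local Open Scope ereal_scope.

Lemma iter_policy_step_bounds (P : R.-pker ('rV[R]_n * 'rV[R]_m) ~> 'rV[R]_n)
    (h : 'rV[R]_n -> \bar R) t :
  measurable_fun setT h -> (forall y, 0 <= h y <= 1) ->
  measurable_fun setT (iter t (policy_step proj pi P) h) /\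
  forall y, 0 <= iter t (policy_step proj pi P) h y <= 1.
Proof.
move=> mh h01; elim: t => [//|t [IHm IH01]] /=.
have IH0 y : 0 <= iter t (policy_step proj pi P) h y by have /andP[] := IH01 y.
split; first exact: measurable_policy_step.
move=> y; rewrite policy_step_ge0//=.
apply: (@le_trans _ _ (\int[P (policy_point proj pi y)]_z 1)).
  by apply: ge0_le_integral => // z _; have /andP[] := IH01 z.
by rewrite integral_cst//= mul1e prob_kernel.
Qed.

(** The error accumulated so far is a constant, hence unchanged by averaging, and each further step
    adds [kappa]. *)
Lemma iter_policy_step_close
    (P1 P2 : R.-pker ('rV[R]_n * 'rV[R]_m) ~> 'rV[R]_n) (kappa : R) :
  (0 <= kappa)%R ->
  (forall s (h : 'rV[R]_n -> \bar R), measurable_fun setT h ->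
    (forall y, 0 <= h y <= 1) ->
    policy_step proj pi P2 h s <= policy_step proj pi P1 h s + kappa%:E) ->
  forall (h : 'rV[R]_n -> \bar R), measurable_fun setT h ->
    (forall y, 0 <= h y <= 1) -> forall t s,
    iter t (policy_step proj pi P2) h s <=
    iter t (policy_step proj pi P1) h s + (t%:R * kappa)%:E.
Proof.
move=> k0 H h mh h01; elim=> [|t IH] s /=; first by rewrite mul0r adde0.
have [m1 b1] := iter_policy_step_bounds P1 t mh h01.
have [m2 b2] := iter_policy_step_bounds P2 t mh h01.
set a := iter t _ h in m1 b1 IH *; set b := iter t _ h in m2 b2 IH *.
have tk0 : (0 <= t%:R * kappa)%R by rewrite mulr_ge0.
apply: (@le_trans _ _ (policy_step proj pi P2 (fun y => a y + (t%:R * kappa)%:E) s)).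
  apply: ge0_le_integral => //.
  - by move=> y _; have /andP[] := b2 y.
  - exact: emeasurable_funD.
rewrite {1}/policy_step ge0_integralD//; last by move=> y _; have /andP[] := b1 y.
rewrite integral_cst//= prob_kernel mule1 -/(policy_step proj pi P2 a s).
apply: le_trans (leeD2r _ (H s a m1 b1)) _.
by rewrite -addeA -EFinD -[in leRHS]natr1 mulrDl mul1r (addrC kappa).
Qed.

Lemma discounted_ramp_le (gamma kappa : R) :
  (0 <= gamma < 1)%R -> (0 <= kappa)%R ->
  \sum_(0 <= t <oo) (gamma ^+ t * (t%:R * kappa))%:E <=
  (kappa * gamma / (1 - gamma) ^+ 2)%:E.
Proof.
move=> /andP[g0 g1] k0; apply: lime_le.
  apply: is_cvg_nneseries => t _ _.
  by rewrite lee_fin mulr_ge0 ?exprn_ge0// mulr_ge0.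
apply: nearW => N; rewrite big_mkord sumEFin lee_fin.
have g1n : (1 - gamma)%R != 0%R by rewrite subr_eq0 gt_eqF.
(* The partial sum is the infinite one minus an explicit nonnegative remainder. *)
have /(_ N) E k : (\sum_(t < k) gamma ^+ t * (t%:R * kappa) =
    kappa * gamma / (1 - gamma) ^+ 2 -
    kappa * gamma ^+ k * (k%:R / (1 - gamma) + gamma / (1 - gamma) ^+ 2))%R.
  elim: k => [|k IH].
    by rewrite big_ord0 expr0 mulr1 mul0r add0r mulrA subrr.
  rewrite big_ord_recr/= IH [(gamma ^+ k.+1)%R]exprS -[k.+1%:R]natr1.
  move: (gamma ^+ k)%R (k%:R : R) => x y; by field.
rewrite E gerBl; apply: mulr_ge0; first by rewrite mulr_ge0// exprn_ge0.
have g1' : (0 <= 1 - gamma)%R by rewrite subr_ge0 ltW.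
by apply: addr_ge0; apply: divr_ge0 => //; exact: exprn_ge0.
Qed.

Lemma discounted_sum_le (gamma : R) (a : nat -> \bar R) :
  (0 <= gamma < 1)%R -> (forall t, 0 <= a t <= 1) ->
  \sum_(0 <= t <oo) (gamma ^+ t)%:E * a t <= ((1 - gamma)^-1)%:E.
Proof.
move=> /andP[g0 g1] a01.
have ga0 t : 0 <= (gamma ^+ t)%:E * a t.
  by rewrite mule_ge0 ?lee_fin ?exprn_ge0//; have /andP[] := a01 t.
apply: lime_le; first by apply: is_cvg_nneseries => t _ _; exact: ga0.
apply: nearW => N; rewrite big_mkord.
apply: (@le_trans _ _ (\sum_(t < N) (gamma ^+ t)%:E)).
  apply: lee_sum => t _; rewrite -[leRHS]mule1 lee_wpmul2l ?lee_fin ?exprn_ge0//.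
  by have /andP[] := a01 t.
rewrite sumEFin lee_fin -(ler_pM2r (_ : 0 < 1 - gamma)%R) ?subr_gt0//.
rewrite mulVf ?subr_eq0 ?gt_eqF// -[(1 - gamma)%R]opprB mulrN mulrC -subrX1 opprB.
by rewrite gerBl exprn_ge0.
Qed.

End kernel_comparison.

(** * Perturbing a transition kernel *)

Section chi2_density.
Context {d} {T : measurableType d} {R : realType} (P Q : probability T R).
Local Open Scope ereal_scope.
Local Open Scope charge_scope.

Let P' : {finite_measure set T -> \bar R} := P.
Let Q' : {sigma_finite_measure set T -> \bar R} := Q.

Lemma measurable_sqr_sub1 (f : T -> \bar R) : measurable_fun setT f ->
  measurable_fun setT (fun x => (f x - 1) ^+ 2).
Proof.
move=> mf; under eq_fun do rewrite expe2.
by apply: emeasurable_funM; apply: emeasurable_funB.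
Qed.

Lemma chi2_divergence_density (g : T -> R) : measurable_fun setT g ->
  (forall x, 0 <= g x)%R ->
  (forall A, measurable A -> P A = \int[Q]_(x in A) (g x)%:E) ->
  chi2_divergence P Q = 2^-1%:E * \int[Q]_x ((g x - 1) ^+ 2)%:E.
Proof.
move=> mg g0 Pg.
have mge : measurable_fun setT (EFin \o g) by exact/measurable_EFinP.
have PQ : P `<< Q.
  apply/null_content_dominatesP => A mA QA0; rewrite Pg//.
  by apply: null_set_integral => //; exact: measurable_funTS.
rewrite /chi2_divergence; case: pselect => // PQ'.
congr (_ * _).
have ae : ae_eq Q setT ('d (charge_of_finite_measure P') '/d Q') (EFin \o g).
  apply: integral_ae_eq => //; first exact: Radon_Nikodym_integrable.
  by move=> A _ mA; rewrite -Pg// -Radon_Nikodym_integral.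
apply: ae_eq_integral => //.
- exact: measurable_sqr_sub1.
- by apply/measurable_EFinP; apply: measurable_funX; exact: measurable_funB.
case: ae => N [mN N0 sub]; exists N; split => // x /= hx; apply: sub => /= E.
by apply: hx => _; rewrite E//= -EFinB expe2 -EFinM expr2.
Qed.

(** A finite divergence forces absolute continuity, and the Radon-Nikodym derivative can be taken
    real and nonnegative everywhere. The factor 1/2 of the divergence becomes the 2 in front of
    [rho]. *)
Lemma chi2_divergence_le_density (rho : R) : chi2_divergence P Q <= rho%:E ->
  exists g : T -> R, [/\ measurable_fun setT g, (forall x, 0 <= g x)%R,
    (forall A, measurable A -> P A = \int[Q]_(x in A) (g x)%:E) &
    \int[Q]_x ((g x - 1) ^+ 2)%:E <= (2 * rho)%:E].
Proof.
have [PQ|nPQ] := pselect (P `<< Q); last first.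
  by rewrite /chi2_divergence; case: pselect => // _; rewrite leye_eq.
move=> chi.
pose f := Radon_Nikodym_SigmaFinite.f P' Q'.
have f0 x : 0 <= f x by exact: Radon_Nikodym_SigmaFinite.f_ge0.
have ffin x : f x \is a fin_num by exact: Radon_Nikodym_SigmaFinite.f_fin_num.
have mf : measurable_fun setT f.
  exact: measurable_int (Radon_Nikodym_SigmaFinite.f_integrable PQ).
have fE x : (fine (f x))%:E = f x by rewrite fineK.
have mg : measurable_fun setT (fine \o f) by exact: measurableT_comp.
have g0 x : (0 <= (fine \o f) x)%R by rewrite /= fine_ge0.
have Pg A : measurable A -> P A = \int[Q]_(x in A) ((fine \o f) x)%:E.
  move=> mA; rewrite (@Radon_Nikodym_SigmaFinite.f_integral _ _ _ P' Q' PQ A mA).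
  by apply: eq_integral => x _; rewrite /= fE.
exists (fine \o f); split => //.
by move: chi; rewrite (chi2_divergence_density mg g0 Pg) lee_pdivrMl// -EFinM.
Qed.

End chi2_density.

Section kernel_perturbation.
Context {d} {Z : measurableType d} {R : realType} {n : nat}.
Variable s : R.
Hypothesis s_gt0 : 0 < s.
Local Open Scope ereal_scope.

(** Seen from the fixed law N(0, s^2 I), the dependence on z is carried by a jointly measurable
    likelihood ratio, to which Tonelli applies. *)
Lemma measurable_gaussian (g : Z -> 'rV[R]_n) (U : set 'rV[R]_n) :
  measurable_fun setT g -> measurable U ->
  measurable_fun setT (fun z => gaussian s (g z) U).
Proof.
move=> mg mU.
have E z : gaussian s (g z) U =
    \int[gaussian s 0]_y ((\1_U y)%:E * (gaussian_lr s (g z) 0 y)%:E).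
  rewrite -(ge0_integral_gaussian_shift s_gt0 (g z) 0 (h := EFin \o \1_U))//.
  - by rewrite /= integral_indic// setIT.
  - by move=> y; rewrite /= lee_fin.
  - by apply/measurable_EFinP; exact: measurable_indic.
apply: (eq_measurable_fun (fun z => \int[gaussian s 0]_y
    ((\1_U y)%:E * (gaussian_lr s (g z) 0 y)%:E))); first by move=> z _; rewrite E.
apply: (measurable_fun_fubini_tonelli_F (m2 := gaussian s 0)
  (fun zy : Z * 'rV[R]_n => (\1_U zy.2)%:E * (gaussian_lr s (g zy.1) 0 zy.2)%:E)).
  apply: emeasurable_funM; apply/measurable_EFinP.
    by apply: (@measurableT_comp _ _ _ _ _ _ (\1_U : _ -> R)); first exact: measurable_indic.
  by apply: measurable_gaussian_lr => //; exact: measurableT_comp.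
by move=> zy; rewrite mule_ge0 ?lee_fin// ltW// gaussian_lr_gt0.
Qed.

Section gaussian_kernel.
Variable g : Z -> 'rV[R]_n.
Hypothesis mg : measurable_fun setT g.

Definition gaussian_kernel (_ : (0 < s)%R) (_ : measurable_fun setT g) (z : Z) :
  {measure set 'rV[R]_n -> \bar R} := gaussian s (g z).

Let measurable_gaussian_kernel U : measurable U ->
  measurable_fun [set: Z] (gaussian_kernel s_gt0 mg ^~ U).
Proof. by move=> mU; exact: measurable_gaussian. Qed.

HB.instance Definition _ := isKernel.Build _ _ _ _ _ (gaussian_kernel s_gt0 mg)
  measurable_gaussian_kernel.

Let gaussian_kernel_prob z : gaussian_kernel s_gt0 mg z setT = 1.
Proof. exact: probability_setT. Qed.

HB.instance Definition _ := Kernel_isProbability.Build _ _ _ _ _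
  (gaussian_kernel s_gt0 mg) gaussian_kernel_prob.

End gaussian_kernel.

Section resample.
Variables (g : Z -> 'rV[R]_n) (a : Z * 'rV[R]_n -> R).
Hypotheses (mg : measurable_fun setT g) (ma : measurable_fun setT a).
Hypothesis a01 : forall zy, (0 <= a zy <= 1)%R.

Let a_ge0 zy : (0 <= a zy)%R. Proof. by have /andP[] := a01 zy. Qed.
Let a_le1 zy : (0 <= 1 - a zy)%R. Proof. by rewrite subr_ge0; have /andP[] := a01 zy. Qed.

(* Keep y with probability a (z, y), otherwise draw afresh from N(g z, s ^ 2 I). *)
Definition resample_kernel (_ : (0 < s)%R) (_ : measurable_fun setT g) (_ : measurable_fun setT a)
    (zy : Z * 'rV[R]_n) : {measure set 'rV[R]_n -> \bar R} :=
  measure_add (mscale (NngNum (a_ge0 zy)) \d_(zy.2))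
              (mscale (NngNum (a_le1 zy)) (gaussian s (g zy.1))).

Lemma resample_kernelE zy U : resample_kernel s_gt0 mg ma zy U =
  (a zy)%:E * (\1_U zy.2)%:E + (1 - a zy)%:E * gaussian s (g zy.1) U.
Proof. exact: (etrans (measure_addE _ _ _)). Qed.

Let measurable_resample_kernel U : measurable U ->
  measurable_fun [set: Z * 'rV[R]_n] (resample_kernel s_gt0 mg ma ^~ U).
Proof.
move=> mU; apply: (eq_measurable_fun (fun zy => (a zy)%:E * (\1_U zy.2)%:E +
  (1 - a zy)%:E * gaussian s (g zy.1) U)).
  by move=> zy _; rewrite resample_kernelE.
apply: emeasurable_funD; apply: emeasurable_funM.
- exact/measurable_EFinP.
- apply/measurable_EFinP.
  by apply: (@measurableT_comp _ _ _ _ _ _ (\1_U : _ -> R)); first exact: measurable_indic.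
- by apply/measurable_EFinP; exact: measurable_funB.
- exact: (measurableT_comp (measurable_gaussian mg mU)).
Qed.

HB.instance Definition _ := isKernel.Build _ _ _ _ _ (resample_kernel s_gt0 mg ma)
  measurable_resample_kernel.

Let resample_kernel_prob z : resample_kernel s_gt0 mg ma z setT = 1.
Proof.
by rewrite resample_kernelE probability_setT !mule1 indicT mule1 -EFinD addrC subrK.
Qed.

HB.instance Definition _ := Kernel_isProbability.Build _ _ _ _ _
  (resample_kernel s_gt0 mg ma) resample_kernel_prob.

Lemma ge0_integral_resample zy (h : 'rV[R]_n -> \bar R) :
  measurable_fun setT h -> (forall y, 0 <= h y) ->
  \int[resample_kernel s_gt0 mg ma zy]_y h y =
  (a zy)%:E * h zy.2 + (1 - a zy)%:E * \int[gaussian s (g zy.1)]_y h y.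
Proof.
move=> mh h0; rewrite /resample_kernel ge0_integral_measure_add//.
by rewrite !ge0_integral_mscale//= integral_dirac//= diracT mul1e.
Qed.

End resample.

End kernel_perturbation.

Section kcomp_probability.
Context d1 d2 d3 (X : measurableType d1) (Y : measurableType d2)
  (Z : measurableType d3) (R : realType).
Variables (l : R.-pker X ~> Y) (k : R.-pker (X * Y) ~> Z).
Local Open Scope ereal_scope.

Definition prob_kcomp (x : X) : {measure set Z -> \bar R} := kcomp l k x.

Let measurable_prob_kcomp U : measurable U ->
  measurable_fun [set: X] (prob_kcomp ^~ U).
Proof.
move=> mU; apply: (measurable_fun_integral_finite_kernel (k ^~ U)) => //=.
exact/measurable_kernel.
Qed.

HB.instance Definition _ := isKernel.Build _ _ _ _ _ prob_kcomp
  measurable_prob_kcomp.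

Let prob_kcomp_prob x : prob_kcomp x setT = 1.
Proof.
rewrite /prob_kcomp/= /kcomp; under eq_integral do rewrite prob_kernel.
by rewrite integral_cst//= prob_kernel mul1e.
Qed.

HB.instance Definition _ := Kernel_isProbability.Build _ _ _ _ _
  prob_kcomp prob_kcomp_prob.

End kcomp_probability.

Lemma gaussian_lrK (R : realType) (s : R) n (m m' x : 'rV[R]_n) : 0 < s ->
  gaussian_lr s m m' x * gaussian_lr s m' m x = 1.
Proof.
move=> s0; rewrite /gaussian_lr -expRD -big_split/= big1 ?expR0// => i _.
by field; rewrite gt_eqF.
Qed.

Section perturbed_law.
Context {R : realType} {n : nat}.
Variables (s rho u : R) (m1 m2 : 'rV[R]_n) (P1 P2 : probability 'rV[R]_n R).
Hypotheses (s_gt0 : 0 < s) (rho_gt0 : 0 < rho) (u_gt0 : 0 < u).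
Hypothesis m12 : \sum_(i < n) (m1 ord0 i - m2 ord0 i) ^+ 2 <= (s * u) ^+ 2.
Hypothesis chi1 : (chi2_divergence P1 (gaussian s m1) <= rho%:E)%E.

(** Cauchy-Schwarz bound on the P1-mass removed by the truncation: the first factor bounds the L2
    norm of the density of P1, the second comes from [gaussian_overlap]. *)
Let tau := Num.sqrt (1 + 2 * rho) * Num.sqrt (2 * u).
(* Truncating the likelihood ratio at 1 raises the bound on the divergence from
   rho to rho + tau; the weight theta of the reference law brings it back to rho. *)
Let theta := tau / (rho + tau).
Let w y := Num.min 1 (gaussian_lr s m2 m1 y).
Let a y := (1 - theta) * w y.

Local Open Scope ereal_scope.

Hypothesis P2E : forall U, measurable U ->
  P2 U = \int[P1]_y (a y * \1_U y)%:E +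
         \int[P1]_y (1 - a y)%:E * gaussian s m2 U.

Let tau_gt0 : (0 < tau)%R.
Proof. by rewrite mulr_gt0// sqrtr_gt0 ?mulr_gt0// addr_gt0// mulr_gt0. Qed.

Let theta01 : (0 < theta < 1)%R.
Proof.
have rt : (0 < rho + tau)%R by rewrite addr_gt0.
by rewrite divr_gt0//= ltr_pdivrMr// mul1r ltrDr.
Qed.

Let w01 y : (0 <= w y <= 1)%R.
Proof. by rewrite /w le_min ler01 ltW ?gaussian_lr_gt0//= ge_min lexx. Qed.

Let mw : measurable_fun setT w.
Proof. by apply: measurable_minr => //; exact: measurable_gaussian_lr. Qed.

Let a01 y : (0 <= a y <= 1)%R.
Proof. by have /andP[t0 t1] := theta01; have /andP[w0 w1] := w01 y; rewrite /a; nra. Qed.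

Let ma : measurable_fun setT a. Proof. exact: measurable_funM. Qed.

Let M := fine (\int[P1]_y (w y)%:E).

Let ME : \int[P1]_y (w y)%:E = M%:E.
Proof.
rewrite fineK// ge0_fin_numE; last by apply: integral_ge0 => y _; rewrite lee_fin; have /andP[] := w01 y.
apply: (@le_lt_trans _ _ (\int[P1]_y 1%:E)); last by rewrite integral_prob_cst ltry.
apply: ge0_le_integral => //.
- by move=> y _; rewrite lee_fin; have /andP[] := w01 y.
- exact/measurable_EFinP.
- by move=> y _; rewrite lee_fin; have /andP[] := w01 y.
Qed.

Let int_compl (v : 'rV[R]_n -> R) (c : R) : measurable_fun setT v ->
  (forall y, 0 <= v y <= 1)%R -> \int[P1]_y (v y)%:E = c%:E ->
  \int[P1]_y (1 - v y)%:E = (1 - c)%:E.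
Proof.
move=> mv v01 vE.
have mv' : measurable_fun setT (fun y => (1 - v y)%:E).
  by apply/measurable_EFinP; exact: measurable_funB.
have v0 y : (0 <= v y)%R by have /andP[] := v01 y.
have v1 y : (0 <= 1 - v y)%R by rewrite subr_ge0; have /andP[] := v01 y.
have : \int[P1]_y (1 - v y)%:E + \int[P1]_y (v y)%:E = 1.
  rewrite -ge0_integralD//; first last.
  - exact/measurable_EFinP.
  - by move=> y _; rewrite lee_fin.
  - by move=> y _; rewrite lee_fin.
  under eq_integral do rewrite -EFinD subrK.
  exact: integral_prob_cst.
rewrite vE; case: (\int[P1]_y _) => [x| |]//.
by rewrite -EFinD => -[<-]; rewrite addrK.
Qed.

Let compl_w : \int[P1]_y (1 - w y)%:E = (1 - M)%:E.
Proof. exact: int_compl. Qed.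

Let M0 : (0 <= M)%R.
Proof. by apply: fine_ge0; apply: integral_ge0 => y _; rewrite lee_fin; have /andP[] := w01 y. Qed.

Let M1 : (M <= 1)%R.
Proof.
rewrite -subr_ge0 -lee_fin -compl_w; apply: integral_ge0 => y _.
by rewrite lee_fin subr_ge0; have /andP[] := w01 y.
Qed.

Let int_a : \int[P1]_y (a y)%:E = ((1 - theta) * M)%:E.
Proof.
under eq_integral do rewrite EFinM.
rewrite ge0_integralZl ?ME//.
- exact/measurable_EFinP.
- by move=> y _; rewrite lee_fin; have /andP[] := w01 y.
- by rewrite lee_fin subr_ge0; have /andP[_ /ltW] := theta01.
Qed.

Let c := (1 - (1 - theta) * M)%R.

Let compl_a : \int[P1]_y (1 - a y)%:E = c%:E.
Proof. exact: int_compl. Qed.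

Section with_density.
Variable h1 : 'rV[R]_n -> R.
Hypotheses (mh1 : measurable_fun setT h1) (h1_ge0 : forall y, (0 <= h1 y)%R).
Hypothesis h1E : forall A, measurable A ->
  P1 A = \int[gaussian s m1]_(x in A) (h1 x)%:E.
Hypothesis h1_chi : \int[gaussian s m1]_y ((h1 y - 1) ^+ 2)%:E <= (2 * rho)%:E.

Let L y := gaussian_lr s m1 m2 y.

Let L0 y : (0 < L y)%R. Proof. exact: gaussian_lr_gt0. Qed.

Let mL : measurable_fun setT L. Proof. exact: measurable_gaussian_lr. Qed.

Let toQ1 (f : 'rV[R]_n -> R) : measurable_fun setT f -> (forall y, 0 <= f y)%R ->
  \int[P1]_y (f y)%:E = \int[gaussian s m1]_y (f y * h1 y)%:E.
Proof.
move=> mf f0.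
rewrite (@ge0_integral_density _ _ R P1 (gaussian s m1) h1 h1_ge0 mh1 h1E (EFin \o f))//.
exact/measurable_EFinP.
Qed.

Let toQ2 (f : 'rV[R]_n -> R) : measurable_fun setT f -> (forall y, 0 <= f y)%R ->
  \int[gaussian s m1]_y (f y)%:E = \int[gaussian s m2]_y (f y * L y)%:E.
Proof.
move=> mf f0.
rewrite (ge0_integral_gaussian_shift s_gt0 m1 m2 (h := EFin \o f))//.
exact/measurable_EFinP.
Qed.

Let int_h1 : \int[gaussian s m1]_y (h1 y)%:E = 1.
Proof. by rewrite -h1E// probability_setT. Qed.

Let h1_sq : \int[gaussian s m1]_y (h1 y ^+ 2)%:E <= (1 + 2 * rho)%:E.
Proof.
have : \int[gaussian s m1]_y (h1 y ^+ 2)%:E + 1 =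
       \int[gaussian s m1]_y ((h1 y - 1) ^+ 2)%:E + 2.
  have <- : \int[gaussian s m1]_y (2 * h1 y)%:E = 2.
    under eq_integral do rewrite EFinM.
    rewrite ge0_integralZl ?int_h1 ?mule1//; first exact/measurable_EFinP.
    by move=> y _; rewrite lee_fin.
  rewrite -[in LHS](integral_prob_cst (gaussian s m1) 1).
  rewrite -ge0_integralD//; first last.
  - by apply/measurable_EFinP; exact: measurable_funX.
  - by move=> y _; rewrite lee_fin sqr_ge0.
  rewrite -ge0_integralD//; first last.
  - by apply/measurable_EFinP; exact: measurable_funM.
  - by move=> y _; rewrite lee_fin mulr_ge0.
  - by apply/measurable_EFinP; apply: measurable_funX; exact: measurable_funB.
  - by move=> y _; rewrite lee_fin sqr_ge0.
  by apply: eq_integral => y _; rewrite -!EFinD; congr _%:E; ring.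
move=> E; rewrite -(@leeD2rE _ 1)// E -EFinD.
rewrite (_ : (1 + 2 * rho + 1 = 2 * rho + 2)%R); last by ring.
rewrite [(2 * rho + 2)%:E]EFinD. exact: leeD2r.
Qed.

Let M_close : (1 - M <= tau)%R.
Proof.
rewrite -lee_fin -compl_w toQ1; last 2 first.
- exact: measurable_funB.
- by move=> y; rewrite subr_ge0; have /andP[] := w01 y.
pose q := Num.sqrt (1 + 2 * rho); pose v := Num.sqrt (2 * u).
have q0 : (0 < q)%R by rewrite sqrtr_gt0 addr_gt0// mulr_gt0.
have v0 : (0 < v)%R by rewrite sqrtr_gt0 mulr_gt0.
have qq : (q ^+ 2 = 1 + 2 * rho)%R by rewrite sqr_sqrtr// ltW// addr_gt0// mulr_gt0.
have vv : (v ^+ 2 = 2 * u)%R by rewrite sqr_sqrtr// mulr_ge0// ltW.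
(* Cauchy-Schwarz is obtained from Young's inequality: with this weight both terms equal q v / 2,
   and their sum is [tau]. *)
pose al := (v / q)%R.
have al0 : (0 < al)%R by rewrite divr_gt0.
have mh : measurable_fun setT (fun y => (al / 2 * h1 y ^+ 2)%:E).
  by apply/measurable_EFinP; apply: measurable_funM => //; exact: measurable_funX.
have mv : measurable_fun setT (fun y => ((1 - w y) ^+ 2 / (2 * al))%:E).
  apply/measurable_EFinP; apply: measurable_funM => //; apply: measurable_funX.
  exact: measurable_funB.
apply: (@le_trans _ _ (\int[gaussian s m1]_y
   ((al / 2 * h1 y ^+ 2)%:E + ((1 - w y) ^+ 2 / (2 * al))%:E))).
  apply: ge0_le_integral => //.
  - by move=> y _; rewrite lee_fin mulr_ge0// subr_ge0; have /andP[] := w01 y.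
  - by apply/measurable_EFinP; apply: measurable_funM => //; exact: measurable_funB.
  - exact: emeasurable_funD.
  - move=> y _; rewrite -EFinD lee_fin.
    have -> : (al / 2 * h1 y ^+ 2 + (1 - w y) ^+ 2 / (2 * al) =
      (1 - w y) * h1 y + (al * h1 y - (1 - w y)) ^+ 2 / (2 * al))%R.
      by field; rewrite gt_eqF.
    by rewrite lerDl divr_ge0 ?sqr_ge0// mulr_ge0// ltW.
rewrite ge0_integralD//; first last.
- by move=> y _; rewrite lee_fin divr_ge0 ?sqr_ge0// mulr_ge0// ltW.
- by move=> y _; rewrite lee_fin mulr_ge0 ?sqr_ge0// divr_ge0// ltW.
have -> : tau%:E = (al / 2 * (1 + 2 * rho))%:E + (2 * u / (2 * al))%:E.
  rewrite -EFinD; congr _%:E; rewrite -qq -vv /al /tau -/q -/v.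
  by field; rewrite !gt_eqF.
apply: leeD.
  under eq_integral do rewrite EFinM.
  rewrite ge0_integralZl//; first last.
  - by rewrite lee_fin divr_ge0// ltW.
  - by move=> y _; rewrite lee_fin sqr_ge0.
  - by apply/measurable_EFinP; exact: measurable_funX.
  rewrite [leRHS]EFinM; apply: lee_wpmul2l; last exact: h1_sq.
  by rewrite lee_fin divr_ge0// ltW.
under eq_integral do rewrite EFinM.
rewrite ge0_integralZr//; first last.
- by rewrite lee_fin invr_ge0 mulr_ge0// ltW.
- by move=> y _; rewrite lee_fin sqr_ge0.
- apply/measurable_EFinP; apply: measurable_funX; exact: measurable_funB.
rewrite [leRHS]EFinM; apply: lee_wpmul2r.
  by rewrite lee_fin invr_ge0 mulr_ge0// ltW.
apply: gaussian_overlap => //; first exact: ltW.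
by under eq_bigr do rewrite -sqrrN opprB.
Qed.

(** The density with respect to N(m2, s^2 I) of the measure P1 weighted by [w]. *)
Let b y := (w y * h1 y * L y)%R.

Let b0 y : (0 <= b y)%R.
Proof. by have /andP[w0 _] := w01 y; rewrite /b !mulr_ge0// ltW. Qed.

Let mb : measurable_fun setT b.
Proof. by apply: measurable_funM => //; exact: measurable_funM. Qed.

Let int_b : \int[gaussian s m2]_y (b y)%:E = M%:E.
Proof.
rewrite -toQ2; last 2 first.
- exact: measurable_funM.
- by move=> y; rewrite mulr_ge0//; have /andP[] := w01 y.
rewrite -toQ1//.
by move=> y; have /andP[] := w01 y.
Qed.

(** The factor [w] is at most 1 / L by its definition, so b^2 <= h1^2 L, and L moves the integral
    back to N(m1, s^2 I): the truncation is what keeps the second moment from growing. *)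
Let b_sq : \int[gaussian s m2]_y (b y ^+ 2)%:E <= (1 + 2 * rho)%:E.
Proof.
apply: (le_trans _ h1_sq); rewrite toQ2; last 2 first.
- exact: measurable_funX.
- by move=> y; exact: sqr_ge0.
apply: ge0_le_integral => //.
- by move=> y _; rewrite lee_fin sqr_ge0.
- by apply/measurable_EFinP; exact: measurable_funX.
- by apply/measurable_EFinP; apply: measurable_funM => //; exact: measurable_funX.
- move=> y _; rewrite lee_fin /b.
  have -> : ((w y * h1 y * L y) ^+ 2 = h1 y ^+ 2 * L y * ((w y * L y) * w y))%R by ring.
  rewrite -[leRHS]mulr1 ler_wpM2l//; first by rewrite mulr_ge0 ?sqr_ge0// ltW.
  have /andP[w0 w1] := w01 y.
  have wl : (w y * L y <= 1)%R.
    rewrite -[leRHS](gaussian_lrK m2 m1 y s_gt0); apply: ler_wpM2r; first exact: ltW.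
    by rewrite /w ge_min lexx orbT.
  by rewrite -[leRHS]mulr1 ler_pM// mulr_ge0// ltW.
Qed.

(** M is the mean of b; the term 2 M^2 is added on both sides to avoid a subtraction of
    integrals. *)
Let b_var : \int[gaussian s m2]_y ((b y - M) ^+ 2)%:E <= (1 + 2 * rho - M ^+ 2)%:E.
Proof.
have : \int[gaussian s m2]_y ((b y - M) ^+ 2)%:E + (2 * M ^+ 2)%:E =
       \int[gaussian s m2]_y (b y ^+ 2)%:E + (M ^+ 2)%:E.
  have <- : \int[gaussian s m2]_y (2 * M * b y)%:E = (2 * M ^+ 2)%:E.
    under eq_integral do rewrite EFinM.
    rewrite ge0_integralZl ?int_b//; first last.
    - by rewrite lee_fin mulr_ge0.
    - by move=> y _; rewrite lee_fin.
    - exact/measurable_EFinP.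
    by rewrite -EFinM; congr _%:E; ring.
  rewrite -(integral_prob_cst (gaussian s m2) (M ^+ 2)).
  rewrite -ge0_integralD//; first last.
  - by apply/measurable_EFinP; exact: measurable_funM.
  - by move=> y _; rewrite lee_fin mulr_ge0// mulr_ge0.
  - by apply/measurable_EFinP; apply: measurable_funX; exact: measurable_funB.
  - by move=> y _; rewrite lee_fin sqr_ge0.
  rewrite -ge0_integralD//; first last.
  - by move=> y _; rewrite lee_fin sqr_ge0.
  - by apply/measurable_EFinP; exact: measurable_funX.
  - by move=> y _; rewrite lee_fin sqr_ge0.
  by apply: eq_integral => y _; rewrite -!EFinD; congr _%:E; ring.
move=> E; rewrite -(@leeD2rE _ (2 * M ^+ 2)%:E)// E -EFinD.
rewrite (_ : (1 + 2 * rho - M ^+ 2 + 2 * M ^+ 2 = (1 + 2 * rho) + M ^+ 2)%R); last by ring.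
by rewrite [leRHS]EFinD; exact: leeD2r.
Qed.

(** The density of P2: the kept part, plus the constant due to resampling. *)
Let g y := ((1 - theta) * b y + c)%R.

Let c0 : (0 <= c)%R.
Proof.
have /andP[t0 t1] := theta01; rewrite subr_ge0 mulr_ile1// ?subr_ge0 ?(ltW t1)//.
by rewrite gerBl ltW.
Qed.

Let g0 y : (0 <= g y)%R.
Proof.
have /andP[t0 t1] := theta01.
by rewrite addr_ge0// mulr_ge0// subr_ge0 ltW.
Qed.

Let mg : measurable_fun setT g.
Proof. by apply: measurable_funD => //; exact: measurable_funM. Qed.

Let gE U : measurable U -> P2 U = \int[gaussian s m2]_(y in U) (g y)%:E.
Proof.
move=> mU; rewrite P2E//.
have mi : measurable_fun setT (\1_U : _ -> R) by exact: measurable_indic.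
have /andP[t0 t1] := theta01.
have th0 : (0 <= 1 - theta)%R by rewrite subr_ge0 ltW.
have w0 y : (0 <= w y)%R by have /andP[] := w01 y.
rewrite toQ1; last 2 first.
- exact: measurable_funM.
- by move=> y; rewrite mulr_ge0// mulr_ge0.
rewrite toQ2; last 2 first.
- by apply: measurable_funM => //; exact: measurable_funM.
- by move=> y; rewrite !mulr_ge0.
rewrite compl_a -[X in gaussian s m2 X]setIT -integral_indic// -ge0_integralZl//; first last.
- exact/measurable_EFinP.
rewrite -ge0_integralD//; first last.
- by apply/measurable_EFinP; exact: measurable_funM.
- by move=> y _; rewrite lee_fin mulr_ge0.
- by apply/measurable_EFinP; do 2 (apply: measurable_funM => //); exact: measurable_funM.
- by move=> y _; rewrite lee_fin !mulr_ge0// ltW.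
rewrite [RHS]integral_mkcond; apply: eq_integral => y _.
rewrite epatch_indic /= -!EFinM -EFinD /g /b /a; congr _%:E; ring.
Qed.

(** As g - 1 = (1 - theta) (b - M), the bound is (1 - theta)^2 times the variance of b, which is at
    most 2 rho + 1 - M^2 <= 2 (rho + tau) since 1 - M <= tau. Finally 1 - theta = rho / (rho +
    tau). *)
Let chi2 : chi2_divergence P2 (gaussian s m2) <= rho%:E.
Proof.
rewrite (chi2_divergence_density mg g0 gE).
have /andP[t0 t1] := theta01.
have -> : \int[gaussian s m2]_y ((g y - 1) ^+ 2)%:E =
    ((1 - theta) ^+ 2)%:E * \int[gaussian s m2]_y ((b y - M) ^+ 2)%:E.
  rewrite -ge0_integralZl//; first last.
  - by rewrite lee_fin sqr_ge0.
  - by move=> y _; rewrite lee_fin sqr_ge0.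
  - by apply/measurable_EFinP; apply: measurable_funX; exact: measurable_funB.
  by apply: eq_integral => y _; rewrite -EFinM /g /c; congr _%:E; ring.
rewrite lee_pdivrMl//.
apply: (@le_trans _ _ (((1 - theta) ^+ 2)%:E * (1 + 2 * rho - M ^+ 2)%:E)).
  by apply: lee_wpmul2l; rewrite ?lee_fin ?sqr_ge0.
rewrite -!EFinM lee_fin.
have rt : (0 < rho + tau)%R by rewrite addr_gt0.
have -> : (1 - theta = rho / (rho + tau))%R by rewrite /theta; field; rewrite gt_eqF.
have h : (1 + 2 * rho - M ^+ 2 <= 2 * (rho + tau))%R by have := M_close; nra.
apply: (@le_trans _ _ ((rho / (rho + tau)) ^+ 2 * (2 * (rho + tau))))%R.
  by rewrite ler_wpM2l// sqr_ge0.
have -> : ((rho / (rho + tau)) ^+ 2 * (2 * (rho + tau)) = 2 * rho * (rho / (rho + tau)))%R.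
  by field; rewrite gt_eqF.
by rewrite -[leRHS]mulr1 ler_wpM2l// ?mulr_ge0 ?(ltW rho_gt0)// ler_pdivrMr// mul1r lerDl ltW.
Qed.

(** Here c = (1 - M) + theta M, with 1 - M <= tau and theta <= tau / rho. *)
Let c_le : (c <= tau * (1 + rho^-1))%R.
Proof.
have /andP[t0 t1] := theta01.
have rt : (0 < rho + tau)%R by rewrite addr_gt0.
have ht : (theta <= tau / rho)%R.
  by rewrite /theta ler_pM2l// lef_pV2 ?posrE// lerDl ltW.
have -> : (tau * (1 + rho^-1) = tau + tau / rho)%R by ring.
by have := M_close; have := tau_gt0; rewrite /c; nra.
Qed.

Lemma perturbed_law_with_density :
  chi2_divergence P2 (gaussian s m2) <= rho%:E /\
  \int[P1]_y (1 - a y)%:E <= (tau * (1 + rho^-1))%:E.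
Proof. by split => //; rewrite compl_a lee_fin. Qed.

End with_density.

Lemma perturbed_law :
  chi2_divergence P2 (gaussian s m2) <= rho%:E /\
  \int[P1]_y (1 - a y)%:E <= (tau * (1 + rho^-1))%:E.
Proof.
have [h1 [mh1 h10 h1E h1chi]] := chi2_divergence_le_density chi1.
exact: (perturbed_law_with_density mh1 h10 h1E h1chi).
Qed.

End perturbed_law.

Section perturbed_kernel.
Context {d} {Z : measurableType d} {R : realType} {n : nat}.
Variables (s rho u : R) (g1 g2 : Z -> 'rV[R]_n) (P1 : R.-pker Z ~> 'rV[R]_n).
Hypotheses (s_gt0 : 0 < s) (rho_gt0 : 0 < rho) (u_gt0 : 0 < u).
Hypotheses (mg1 : measurable_fun setT g1) (mg2 : measurable_fun setT g2).

Let tau := Num.sqrt (1 + 2 * rho) * Num.sqrt (2 * u).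
Let theta := tau / (rho + tau).
Let a (zy : Z * 'rV[R]_n) :=
  (1 - theta) * Num.min 1 (gaussian_lr s (g2 zy.1) (g1 zy.1) zy.2).

Let a01 zy : 0 <= a zy <= 1.
Proof.
have tau0 : 0 < tau.
  by rewrite mulr_gt0// sqrtr_gt0 ?mulr_gt0// addr_gt0// mulr_gt0.
have rt : 0 < rho + tau by rewrite addr_gt0.
have t1 : theta <= 1 by rewrite ler_pdivrMr// mul1r lerDr ltW.
have t0 : 0 <= theta by rewrite divr_ge0// ltW.
have : 0 <= Num.min 1 (gaussian_lr s (g2 zy.1) (g1 zy.1) zy.2) <= 1.
  by rewrite le_min ler01 ltW ?gaussian_lr_gt0//= ge_min lexx.
by rewrite /a => /andP[w0 w1]; nra.
Qed.

Let ma : measurable_fun setT a.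
Proof.
apply: measurable_funM => //; apply: measurable_minr => //.
by apply: measurable_gaussian_lr => //; exact: measurableT_comp.
Qed.

Local Open Scope ereal_scope.

(** A single measurable kernel has to serve all z at once, but the closeness of the means and the
    bound on the divergence are available on S x A only; they are therefore asked at z, after the
    kernel has been chosen. *)
Lemma perturbed_kernel : exists P2 : R.-pker Z ~> 'rV[R]_n, forall z,
  (\sum_(i < n) (g1 z ord0 i - g2 z ord0 i) ^+ 2 <= (s * u) ^+ 2)%R ->
  chi2_divergence (kernel_at P1 z) (gaussian s (g1 z)) <= rho%:E ->
  chi2_divergence (kernel_at P2 z) (gaussian s (g2 z)) <= rho%:E /\
  forall h : 'rV[R]_n -> \bar R, measurable_fun setT h ->
    (forall y, 0 <= h y <= 1) ->
    \int[P2 z]_y h y <= \int[P1 z]_y h y + (tau * (1 + rho^-1))%:E.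
Proof.
pose k : R.-pker (Z * 'rV[R]_n)%type ~> 'rV[R]_n := resample_kernel a01 s_gt0 mg2 ma.
pose P2 : R.-pker Z ~> 'rV[R]_n := prob_kcomp P1 k.
exists P2 => z dist chi1.
have ma' : measurable_fun setT (fun y => a (z, y)).
  exact: (measurableT_comp ma (measurable_pair1 z)).
have mac : measurable_fun setT (fun y => (1 - a (z, y))%:E).
  by apply/measurable_EFinP; exact: measurable_funB.
have ac0 y : 0 <= (1 - a (z, y))%:E.
  by rewrite lee_fin subr_ge0; have /andP[] := a01 (z, y).
have P2E U : measurable U -> kernel_at P2 z U =
    \int[kernel_at P1 z]_y (a (z, y) * \1_U y)%:E +
    \int[kernel_at P1 z]_y (1 - a (z, y))%:E * gaussian s (g2 z) U.
  move=> mU; transitivity (\int[P1 z]_y k (z, y) U) => //.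
  under eq_integral do rewrite resample_kernelE/=.
  rewrite ge0_integralD//; first last.
  - exact: emeasurable_funM.
  - by move=> y _; rewrite mule_ge0.
  - by apply: emeasurable_funM; apply/measurable_EFinP => //; exact: measurable_indic.
  - move=> y _; rewrite mule_ge0 ?lee_fin//.
    by have /andP[] := a01 (z, y).
  congr (_ + _).
  by rewrite ge0_integralZr.
have [chi2 cl] := perturbed_law s_gt0 rho_gt0 u_gt0 dist chi1 P2E.
split => // h mh h01.
have h0 y : 0 <= h y by have /andP[] := h01 y.
have Q1 : \int[gaussian s (g2 z)]_y h y <= 1.
  rewrite -(integral_prob_cst (gaussian s (g2 z)) 1).
  by apply: ge0_le_integral => // y _; have /andP[] := h01 y.
rewrite /P2 /prob_kcomp /= integral_kcomp//.
(* A kept state contributes at most h y, a resampled one at most 1. *)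
apply: (@le_trans _ _ (\int[P1 z]_y (h y + (1 - a (z, y))%:E))).
  apply: ge0_le_integral => //.
  - by move=> y _; exact: integral_ge0.
  - have mi : measurable_fun setT (fun zy => \int[k zy]_y h y).
      by apply: measurable_fun_integral_kernel => // U mU; exact: measurable_kernel.
    exact: (measurableT_comp mi (measurable_pair1 z)).
  - exact: emeasurable_funD.
  - move=> y _; rewrite ge0_integral_resample//=; apply: leeD.
      rewrite -[leRHS]mul1e lee_wpmul2r// lee_fin.
      by have /andP[] := a01 (z, y).
    by rewrite -[leRHS]mule1; apply: lee_wpmul2l.
rewrite ge0_integralD//; exact: leeD2l.
Qed.

End perturbed_kernel.

(** With q = sqrt (1 + 2 rho) and rho = (q - 1) (q + 1) / 2, the claim reduces to q^2 + 1 <= q (q +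
    1), that is q >= 1. *)
Lemma chi2_constant_le (R : realType) (rho : R) : 0 < rho ->
  Num.sqrt (1 + 2 * rho) * (1 + rho^-1) <=
  (1 + 2 * rho) / (Num.sqrt (1 + 2 * rho) - 1).
Proof.
move=> rho0; set q := Num.sqrt _.
have qq : q ^+ 2 = 1 + 2 * rho by rewrite sqr_sqrtr// addr_ge0// mulr_ge0// ltW.
have q1 : 1 < q.
  by rewrite -[ltLHS]sqrtr1 ltr_sqrt ?addr_gt0 ?mulr_gt0// ltrDl mulr_gt0.
have rhoE : rho = (q - 1) * (q + 1) / 2.
  have : (q - 1) * (q + 1) = q ^+ 2 - 1 by ring.
  by rewrite qq => ->; field.
rewrite ler_pdivlMr ?subr_gt0// -qq rhoE.
have -> : q * (1 + ((q - 1) * (q + 1) / 2)^-1) * (q - 1) = q * (q ^+ 2 + 1) / (q + 1).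
  by field; rewrite !gt_eqF ?subr_gt0 ?addr_gt0//; lra.
rewrite ler_pdivrMr; last by lra.
have q0 : 0 < q by lra.
rewrite expr2 -mulrA ler_pM2l//; nra.
Qed.

(** * Robust values of nearby dynamics *)

Section compact_measurable.
Context {R : realType} (n m : nat).
Local Notation E := ('rV[R]_n * 'rV[R]_m)%type.

Lemma measurable_row_ball p (x : 'rV[R]_p) (e : R) : measurable (ball x e).
Proof.
have [e0|e0] := ltP 0 e; last first.
  rewrite (_ : ball x e = set0)//; apply/seteqP; split => // y [].
  by rewrite ltNge e0.
rewrite (_ : ball x e = \bigcap_(i in [set: 'I_p]) [set y : 'rV[R]_p | `|x ord0 i - y ord0 i| < e]).
  apply: fin_bigcap_measurable => // i _; apply: measurable_lt_set => //.
  apply: measurableT_comp => //; apply: measurable_funB => //.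
  exact: measurable_coord.
apply/seteqP; split => [y [_ xy] i _|y xy]; first exact: xy.
split => // i j; rewrite (ord1 i); exact: (xy j I).
Qed.

(** The sigma-algebra is generated by coordinates, not by open sets. A compact set is a countable
    intersection of finite unions of balls, and the balls of the sup norm are boxes. *)
Lemma compact_measurable (K : set E) : compact K -> measurable K.
Proof.
move=> cK.
have clK : closed K by apply: compact_closed => //; exact: norm_hausdorff.
have cov k : exists D : set E, [/\ finite_set D, D `<=` K &
    K `<=` \bigcup_(x in D) ball x k.+1%:R^-1].
  pose ET : ptopologicalType := HB.pack E.
  have : @cover_compact ET K by rewrite -compact_cover.
  have op x : K x -> open (interior (ball x (k.+1%:R^-1 : R))).
    by move=> _; exact: open_interior.
  have KK : K `<=` \bigcup_(x in K) interior (ball x (k.+1%:R^-1 : R)).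
    by move=> x Kx; exists x => //; apply: nbhsx_ballx; rewrite invr_gt0.
  move=> /(_ _ _ _ op KK)[D DK KD]; eexists; split; last first.
  - by move=> x /KD[y yD hy]; exists y; [exact: yD|exact: interior_subset].
  - by move=> x /DK/set_mem.
  - exact: finite_fset.
have [D DP] := choice cov.
have -> : K = \bigcap_k \bigcup_(x in D k) ball x k.+1%:R^-1.
  apply/seteqP; split => [x Kx k _|x xcov]; first by have [_ _] := DP k; apply.
  apply: clK => B /nbhs_ballP[e /= e0 eB].
  have [k ke] := ltr_add_invr (e0 : 0 < e).
  have [y yD hy] := xcov k I; exists y; split; first by have [_ + _] := DP k; apply.
  apply: eB; apply: ball_sym; apply: (le_ball _ hy).
  by rewrite add0r in ke; exact: ltW.
apply: bigcapT_measurable => k; apply: fin_bigcup_measurable => [|x _].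
  by have [] := DP k.
rewrite (_ : ball x _ = ball x.1 k.+1%:R^-1 `*` ball x.2 k.+1%:R^-1).
  by apply: measurableX; exact: measurable_row_ball.
by apply/seteqP; split => y [].
Qed.

(** The dynamics live on the subtype K while kernels are total. For the extension by 0, the part in
    K of the preimage of a closed half-line is compact; off K the extension is constant. *)
Lemma measurable_valL (K : set E) p (g : K -> 'rV[R]_p) : compact K -> continuous g ->
  measurable_fun setT (valL_ 0 g).
Proof.
move=> cK cg; have mK := compact_measurable cK.
have clK : closed K by apply: compact_closed => //; exact: norm_hausdorff.
have cw : {within K, continuous (valL_ 0 g)} by apply/subspace_valL_continuousP'.
apply: measurable_fun_rV => l.
rewrite -(setUv K); apply/measurable_funU => //; first exact: measurableC.
split.
  move=> _; apply: (measurability _ (RGenCInfty.measurableE R)) => // _ [_ [c ->] <-].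
  apply: compact_measurable.
  have cl : closed ((fun x => valL_ 0 g x ord0 l) @^-1` [set` `[c, +oo[] : set (subspace K)).
    apply: (closed_comp (f := fun x : subspace K => valL_ 0 g x ord0 l)); last exact: rray_closed.
    move=> x _ /=; apply: (@continuous_comp _ _ _ (valL_ 0 g : subspace K -> _) (fun v : 'rV[R]_p => v ord0 l)).
      exact: cw.
    exact: coord_continuous.
  have /closed_subspaceP[V clV VE] := cl.
  rewrite setIC -VE setIC; exact: compact_closedI.
apply: (@eq_measurable_fun _ _ _ _ (~` K) (fun _ : E => (0 : R))) => [x /set_mem Kx|].
  rewrite /valL_ /= oinv_set_val insubN ?mxE//.
  by apply/negP => /set_mem.
exact: measurable_cst.
Qed.

End compact_measurable.

Section robust_value_comparison.
Context {R : realType} (n m : nat).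
Variables (S : set 'rV[R]_n) (A : set 'rV[R]_m).
Variables (r : 'rV[R]_n * 'rV[R]_m -> R) (gamma rho sigma : R).
Variable proj : {mfun 'rV[R]_n >-> 'rV[R]_n}.
Variable pi : {mfun 'rV[R]_n >-> 'rV[R]_m}.
Context {d} {T : measurableType d} (Pr : probability T R).
Variable noise : nat -> {mfun T >-> 'rV[R]_n}.
Hypotheses (n_gt0 : (0 < n)%N) (sigma_gt0 : 0 < sigma) (rho_gt0 : 0 < rho).
Hypothesis gamma01 : 0 < gamma < 1.
Hypothesis compact_SA : compact (S `*` A).
Hypothesis mr : measurable_fun (S `*` A) r.
Hypothesis r01 : forall x, (S `*` A) x -> 0 <= r x <= 1.
Hypothesis projS : forall s, S (proj s).
Hypothesis piA : is_deterministic_policy S A pi.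
Hypothesis iid : iid_gaussian_noise Pr sigma noise.

Local Notation value g s :=
  (robust_value r gamma rho sigma proj (deterministic pi) (g : state_action S A -> _) s).

Let mSA : measurable (S `*` A) := compact_measurable compact_SA.

Let pointSA s : (S `*` A) (policy_point proj pi s).
Proof. by split; [exact: projS|exact/piA/projS]. Qed.

Let gamma0 : 0 <= gamma. Proof. by have /andP[/ltW] := gamma01. Qed.

Let gamma_lt : 0 <= gamma < 1. Proof. by rewrite gamma0; have /andP[] := gamma01. Qed.

Local Open Scope ereal_scope.

Let reward s := (r (policy_point proj pi s))%:E.

Let reward01 s : 0 <= reward s <= 1.
Proof. by rewrite !lee_fin; exact: r01. Qed.

Let mreward : measurable_fun setT reward.
Proof.
apply/measurable_EFinP; pose r' := r \_ (S `*` A).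
have mr' : measurable_fun setT r' by apply/(measurable_restrictT _ mSA).
rewrite (_ : (fun s => _) = r' \o policy_point proj pi).
  exact: (measurableT_comp mr' (measurable_policy_point proj pi)).
by apply/funext => s /=; rewrite /r' patchE mem_set.
Qed.

Let valLE (g : state_action S A -> 'rV[R]_n) (x : state_action S A) :
  valL_ 0%R g (set_val x) = g x.
Proof. exact: (congr1 (@^~ x) (valLK 0%R g)). Qed.

(** An arbitrary P1 for [g1], with an arbitrary realization, is turned into a P2 for [g2] realized
    on the noise space; both returns are then iterates of operators. Exchanging [g1] and [g2] gives
    the converse bound. *)
Lemma robust_value_close (g1 g2 : state_action S A -> 'rV[R]_n) (u : R) s :
  continuous g1 -> continuous g2 -> (0 < u)%R ->
  (forall x, \sum_(i < n) (g1 x ord0 i - g2 x ord0 i) ^+ 2 <= (sigma * u) ^+ 2)%R ->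
  value g2 s <= value g1 s + ((1 + 2 * rho) / (Num.sqrt (1 + 2 * rho) - 1) *
    Num.sqrt (2 * u) * gamma / (1 - gamma) ^+ 2)%:E.
Proof.
move=> cg1 cg2 u0 dist; rewrite -leeBlDr//.
apply: le_ereal_inf_tmp => v1 [P1 [d' [T' [Pr' [st [ac [unc traj ->]]]]]]].
rewrite leeBlDr//.
have mg1 := measurable_valL compact_SA cg1.
have mg2 := measurable_valL compact_SA cg2.
have [P2 P2P] := perturbed_kernel P1 sigma_gt0 rho_gt0 u0 mg1 mg2.
have near (x : state_action S A) := P2P (set_val x).
have [st2 [ac2 traj2]] :=
  trajectory_exists iid n_gt0 sigma_gt0 projS piA P2 s.
apply: (@le_trans _ _ (\int[Pr]_w (\sum_(0 <= t <oo)
             (gamma ^+ t * r (proj (st2 t w), ac2 t w))%:E))).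
  apply: ereal_inf_lbound; exists P2, d, T, Pr, st2, ac2; split => //.
  move=> x; have [] := near x.
  - by rewrite !valLE.
  - by rewrite valLE; exact: unc.
  - by rewrite valLE.
rewrite (trajectory_return projS piA traj2)// (trajectory_return projS piA traj)//.
set kappa := (Num.sqrt (1 + 2 * rho) * Num.sqrt (2 * u) * (1 + rho^-1))%R.
have kappa0 : (0 <= kappa)%R by rewrite !mulr_ge0 ?sqrtr_ge0// addr_ge0// invr_ge0 ltW.
have close s' (h : 'rV[R]_n -> \bar R) : measurable_fun setT h -> (forall y, 0 <= h y <= 1) ->
    policy_step proj pi P2 h s' <= policy_step proj pi P1 h s' + kappa%:E.
  move=> mh h01.
  have := P2P (policy_point proj pi s').
  (* Closeness is known on S x A, where all visited points lie since [proj] maps into S. *)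
  pose x : state_action S A := SigSub (mem_set (pointSA s')).
  rewrite -[policy_point proj pi s']/(set_val x) !valLE => /(_ (dist x) (unc x))[_].
  exact.
have itclose := iter_policy_step_close kappa0 close mreward reward01.
have [mb1 b1] := (fun t => (iter_policy_step_bounds proj pi P1 t mreward reward01).1,
  fun t => (iter_policy_step_bounds proj pi P1 t mreward reward01).2).
have [mb2 b2] := (fun t => (iter_policy_step_bounds proj pi P2 t mreward reward01).1,
  fun t => (iter_policy_step_bounds proj pi P2 t mreward reward01).2).
have gt0 t : (0 <= gamma ^+ t)%R by rewrite exprn_ge0.
have a0 t : 0 <= (gamma ^+ t)%:E * iter t (policy_step proj pi P1) reward s.
  by rewrite mule_ge0 ?lee_fin//; have /andP[] := b1 t s.
have c0 t : 0 <= (gamma ^+ t * (t%:R * kappa))%:E.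
  by rewrite lee_fin mulr_ge0// mulr_ge0.
apply: (@le_trans _ _ (\sum_(0 <= t <oo)
    ((gamma ^+ t)%:E * iter t (policy_step proj pi P1) reward s +
     (gamma ^+ t * (t%:R * kappa))%:E))).
  apply: lee_nneseries => t _; first by rewrite mule_ge0 ?lee_fin//; have /andP[] := b2 t s.
  have b10 : 0 <= iter t (policy_step proj pi P1) reward s by have /andP[] := b1 t s.
  have tk0 : 0 <= (t%:R * kappa)%:E by rewrite lee_fin mulr_ge0.
  rewrite EFinM -ge0_muleDr//.
  by apply: lee_wpmul2l; rewrite ?lee_fin.
rewrite nneseriesD//; apply: leeD2l.
apply: le_trans (discounted_ramp_le gamma_lt kappa0) _.
rewrite lee_fin; apply: ler_wpM2r; first by rewrite invr_ge0 sqr_ge0.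
apply: ler_wpM2r => //; rewrite /kappa mulrAC; apply: ler_wpM2r; first exact: sqrtr_ge0.
exact: chi2_constant_le.
Qed.

(** The nominal kernel has divergence 0 from itself and is realizable, so that the infimum is not
    over the empty set, where it would be [+oo]. *)
Lemma robust_value_fin_num (g : state_action S A -> 'rV[R]_n) s :
  continuous g -> value g s \is a fin_num.
Proof.
move=> cg; have mg := measurable_valL compact_SA cg.
rewrite ge0_fin_numE; last first.
  apply: le_ereal_inf_tmp => v1 [P1 [d' [T' [Pr' [st [ac [unc traj ->]]]]]]].
  apply: integral_ge0 => w _; apply: nneseries_ge0 => t _ _.
  rewrite lee_fin mulr_ge0 ?exprn_ge0//.
  have xSA : (S `*` A) (proj (st t w), ac t w).
    by split; [exact: projS|exact: (traj_action_space traj)].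
  by have /andP[] := r01 xSA.
pose P : R.-pker ('rV[R]_n * 'rV[R]_m)%type ~> 'rV[R]_n := gaussian_kernel sigma_gt0 mg.
have [st [ac traj]] := trajectory_exists iid n_gt0 sigma_gt0 projS piA P s.
apply: (@le_lt_trans _ _ (\int[Pr]_w (\sum_(0 <= t <oo)
             (gamma ^+ t * r (proj (st t w), ac t w))%:E))).
  apply: ereal_inf_lbound; exists P, d, T, Pr, st, ac; split => //.
  move=> x.
  rewrite (@chi2_divergence_density _ _ _ _ _ (cst 1%R)) //=.
  - under eq_integral do rewrite subrr expr0n/=.
    by rewrite integral0 mule0 lee_fin ltW.
  - move=> B mB; rewrite integral_cst//= mul1e.
    exact: (congr1 (fun v => gaussian sigma v B) (valLE g x)).
rewrite (trajectory_return projS piA traj)//.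
apply: (@le_lt_trans _ _ ((1 - gamma)^-1)%:E); last exact: ltry.
apply: discounted_sum_le => // t.
by have [_] := iter_policy_step_bounds proj pi P t mreward reward01; apply.
Qed.

End robust_value_comparison.

(** * Gaussian process regression in a reproducing kernel Hilbert space *)

Section rkhs.
Variables (R : realType) (Z : Type) (k : Z -> Z -> R).
Variables (H : set (Z -> R)) (ip : (Z -> R) -> (Z -> R) -> R).
Hypothesis rkhs : is_rkhs k H ip.

Definition kernel_comb (s : seq (R * Z)) (v : Z) : R :=
  \sum_(p <- s) p.1 * k p.2 v.

Lemma kernel_comb_nil : kernel_comb [::] = fun=> 0.
Proof. by apply/funext => v; rewrite /kernel_comb big_nil. Qed.

Lemma kernel_comb_cons p s :
  kernel_comb (p :: s) = fun v => p.1 * k p.2 v + kernel_comb s v.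
Proof. by apply/funext => v; rewrite /kernel_comb big_cons. Qed.

Lemma kernel_comb_rkhs s : H (kernel_comb s).
Proof.
elim: s => [|p s IH]; first by rewrite kernel_comb_nil; exact: rkhs_zero rkhs.
by rewrite kernel_comb_cons; apply: (rkhs_linear rkhs) => //; exact: (rkhs_kernel rkhs).
Qed.

Lemma ip0l g : H g -> ip (fun=> 0) g = 0.
Proof.
move=> Hg; have H0 := rkhs_zero rkhs.
have := rkhs_ip_linear rkhs 1 H0 H0 Hg.
rewrite (_ : (fun z => 1 * 0 + 0) = fun=> 0); last by apply/funext => z; rewrite mulr0 addr0.
by lra.
Qed.

Lemma ip_kernel_comb s g : H g -> ip (kernel_comb s) g = \sum_(p <- s) p.1 * g p.2.
Proof.
move=> Hg; elim: s => [|p s IH]; first by rewrite kernel_comb_nil big_nil ip0l.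
rewrite kernel_comb_cons big_cons (rkhs_ip_linear rkhs)//; last 2 first.
- exact: (rkhs_kernel rkhs).
- exact: kernel_comb_rkhs.
rewrite IH (rkhs_ip_sym rkhs)//; last exact: (rkhs_kernel rkhs).
by rewrite (rkhs_reproducing rkhs).
Qed.

Lemma rkhs_cauchy_schwarz g h : H g -> H h ->
  `|ip g h| <= ip_norm ip g * ip_norm ip h.
Proof.
move=> Hg Hh; rewrite /ip_norm -sqrtrM; last exact: rkhs_ip_ge0 rkhs _ Hg.
have gg := rkhs_ip_ge0 rkhs Hg; have hh := rkhs_ip_ge0 rkhs Hh.
have quad t : 0 <= t ^+ 2 * ip g g + 2 * t * ip g h + ip h h.
  have Hth := rkhs_linear rkhs t Hg Hh.
  have := rkhs_ip_ge0 rkhs Hth.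
  rewrite (rkhs_ip_linear rkhs)// (rkhs_ip_sym rkhs Hg Hth) (rkhs_ip_sym rkhs Hh Hth).
  rewrite !(rkhs_ip_linear rkhs)// (rkhs_ip_sym rkhs Hh Hg) => h0.
  by apply: le_trans h0 _; rewrite le_eqVlt; apply/orP; left; apply/eqP; ring.
rewrite -sqrtr_sqr ler_sqrt ?mulr_ge0//.
have [g0|g0] := eqVneq (ip g g) 0.
  have gE := rkhs_ip_definite rkhs Hg g0.
  by rewrite gE ip0l// expr0n mulr_ge0// -gE.
have gp : 0 < ip g g by rewrite lt_neqAle eq_sym g0.
have := quad (- ip g h / ip g g).
have -> : (- ip g h / ip g g) ^+ 2 * ip g g + 2 * (- ip g h / ip g g) * ip g h + ip h h =
  (ip g g * ip h h - ip g h ^+ 2) / ip g g by field.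
by rewrite pmulr_lge0 ?invr_gt0// subr_ge0.
Qed.

End rkhs.

Section gp.
Variables (R : realType) (Z : Type) (k : Z -> Z -> R) (lambda : R).
Hypotheses (k_pd : positive_definite_kernel k) (lambda_gt0 : 0 < lambda).

Let k_sym z z' : k z z' = k z' z. Proof. by case: k_pd => + _; exact. Qed.

Section family.
Variables (n : nat) (z : 'I_n -> Z).

Let G := gram k z + lambda%:M.

Lemma gram_quad (c : 'rV[R]_n) :
  (c *m G *m c^T) ord0 ord0 =
  \sum_i \sum_j c ord0 i * c ord0 j * k (z i) (z j) + lambda * \sum_i c ord0 i ^+ 2.
Proof.
rewrite /G mulmxDr mulmxDl mxE; congr (_ + _).
  rewrite mxE exchange_big/=; apply: eq_bigr => j _; rewrite !mxE mulr_suml.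
  by apply: eq_bigr => i _; rewrite !mxE mulrAC.
rewrite mul_mx_scalar -scalemxAl mxE; congr (_ * _).
by rewrite mxE; apply: eq_bigr => i _; rewrite mxE expr2.
Qed.

Lemma kernel_quad_ge0 (c : 'rV[R]_n) :
  0 <= \sum_i \sum_j c ord0 i * c ord0 j * k (z i) (z j).
Proof. by case: k_pd => _ /(_ n z (fun i => c ord0 i)). Qed.

Lemma gram_reg_ge0 (c : 'rV[R]_n) : 0 <= (c *m G *m c^T) ord0 ord0.
Proof.
rewrite gram_quad addr_ge0 ?kernel_quad_ge0// mulr_ge0 ?(ltW lambda_gt0)//.
by apply: sumr_ge0 => i _; exact: sqr_ge0.
Qed.

Lemma gram_reg_unit : G \in unitmx.
Proof.
rewrite -row_free_unit; apply: inj_row_free => v vG.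
have := gram_quad v; rewrite vG mul0mx mxE => q0.
have := kernel_quad_ge0 v => q1.
have s0 : 0 <= \sum_i v ord0 i ^+ 2 by apply: sumr_ge0 => i _; exact: sqr_ge0.
have ls : lambda * \sum_i v ord0 i ^+ 2 <= 0 by lra.
have : \sum_i v ord0 i ^+ 2 == 0 by rewrite eq_le s0 andbT -(pmulr_rle0 _ lambda_gt0).
rewrite psumr_eq0 => [/allP v0|i _]; last exact: sqr_ge0.
apply/rowP => i; rewrite mxE; apply/eqP; rewrite -sqrf_eq0.
exact: (v0 i (mem_index_enum _)).
Qed.

Lemma gram_reg_sym : G^T = G.
Proof. by apply/matrixP => i j; rewrite !mxE k_sym eq_sym. Qed.

Definition gp_weights (w : Z) : 'rV[R]_n := kernel_row k z w *m invmx G.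

Lemma gp_weightsK w : gp_weights w *m G = kernel_row k z w.
Proof. by rewrite mulmxKV// gram_reg_unit. Qed.

Lemma gp_weightsKT w : G *m (gp_weights w)^T = (kernel_row k z w)^T.
Proof. by apply: trmx_inj; rewrite trmx_mul !trmxK gram_reg_sym gp_weightsK. Qed.

Lemma gp_meanE (y : 'cV[R]_n) w :
  gp_mean k lambda z y w = \sum_j gp_weights w ord0 j * y j ord0.
Proof. by rewrite /gp_mean mxE. Qed.

(** The squared RKHS norm of k_w minus the combination of the k_{z_j} with coefficients c, written
    with the kernel alone. *)
Definition gp_energy (w : Z) (c : 'rV[R]_n) : R :=
  k w w - 2 * \sum_j c ord0 j * k w (z j) +
  \sum_i \sum_j c ord0 i * c ord0 j * k (z i) (z j).

(** Positivity of the kernel on the family w, z with coefficients 1, - c. *)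
Lemma gp_energy_ge0 w c : 0 <= gp_energy w c.
Proof.
case: k_pd => _ /(_ n.+1 (fun i => if unlift ord0 i is Some j then z j else w)
  (fun i => if unlift ord0 i is Some j then - c ord0 j else 1)).
rewrite big_ord_recl unlift_none big_ord_recl unlift_none !mul1r.
under eq_bigr do rewrite liftK mul1r.
under [X in _ + X]eq_bigr => i _.
  rewrite big_ord_recl liftK unlift_none mulr1.
  under eq_bigr do rewrite liftK mulrNN.
  over.
rewrite big_split/= => h; apply: le_trans h _; rewrite le_eqVlt; apply/orP; left; apply/eqP.
rewrite /gp_energy addrA; congr (_ + _); rewrite -addrA; congr (_ + _).
rewrite -big_split/= mulr_sumr -sumrN; apply: eq_bigr => i _.
by rewrite (k_sym (z i) w); ring.
Qed.

Lemma gp_weights_formr w (v : 'rV[R]_n) :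
  (v *m G *m (gp_weights w)^T) ord0 ord0 = \sum_j v ord0 j * k w (z j).
Proof.
by rewrite -mulmxA gp_weightsKT mxE; apply: eq_bigr => j _; rewrite !mxE.
Qed.

Lemma gp_weights_forml w (v : 'rV[R]_n) :
  (gp_weights w *m G *m v^T) ord0 ord0 = \sum_j v ord0 j * k w (z j).
Proof.
by rewrite gp_weightsK mxE; apply: eq_bigr => j _; rewrite !mxE mulrC.
Qed.

Lemma gp_varianceE w : gp_variance k lambda z w =
  gp_energy w (gp_weights w) + lambda * \sum_j gp_weights w ord0 j ^+ 2.
Proof.
rewrite /gp_energy -addrA -gram_quad gp_weights_formr /gp_variance.
have -> : (kernel_row k z w *m invmx (gram k z + lambda%:M) *m (kernel_row k z w)^T)
    ord0 ord0 = \sum_j gp_weights w ord0 j * k w (z j).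
  by rewrite mxE; apply: eq_bigr => j _; congr (_ * _); rewrite !mxE.
by ring.
Qed.

(** Variational form of the posterior variance: the regularized energy is quadratic in c and minimal
    at [gp_weights], the excess being the form of G at c minus the weights. Comparing variances
    amounts to choosing a suitable c. *)
Lemma gp_variance_min w (c : 'rV[R]_n) :
  gp_variance k lambda z w <= gp_energy w c + lambda * \sum_j c ord0 j ^+ 2.
Proof.
rewrite gp_varianceE /gp_energy -!addrA lerD2l -!gram_quad.
set a := gp_weights w; pose e := c - a.
have ge0 := gram_reg_ge0 e.
have : (e *m G *m e^T) ord0 ord0 = (c *m G *m c^T) ord0 ord0 -
    2 * \sum_j c ord0 j * k w (z j) + \sum_j a ord0 j * k w (z j).
  rewrite /e linearB/= !mulmxBr !mulmxBl !mxE.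
  have mE (X : 'M[R]_1) : X ord0 ord0 = X ord0 ord0 by [].
  have := gp_weights_formr w c; have := gp_weights_forml w c.
  have := gp_weights_formr w a; rewrite -/a !mxE => -> -> ->.
  by ring.
rewrite gp_weights_formr => eE; rewrite eE in ge0; lra.
Qed.

Lemma gp_variance_ge0 w : 0 <= gp_variance k lambda z w.
Proof.
rewrite gp_varianceE addr_ge0 ?gp_energy_ge0// mulr_ge0 ?(ltW lambda_gt0)//.
by apply: sumr_ge0 => j _; exact: sqr_ge0.
Qed.

Lemma gp_variance_le w : gp_variance k lambda z w <= k w w.
Proof.
apply: le_trans (gp_variance_min w 0) _; rewrite /gp_energy.
rewrite !big1 ?mulr0 ?subr0 ?addr0// => i _; rewrite ?mxE ?mul0r ?expr0n//.
by rewrite big1// => j _; rewrite !mxE !mul0r.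
Qed.

Lemma gp_weights_sqnorm w :
  lambda * \sum_j gp_weights w ord0 j ^+ 2 <= gp_variance k lambda z w.
Proof. by rewrite gp_varianceE lerDr gp_energy_ge0. Qed.

Lemma gp_energy_weights w : gp_energy w (gp_weights w) <= gp_variance k lambda z w.
Proof.
rewrite [leRHS]gp_varianceE lerDl mulr_ge0 ?(ltW lambda_gt0)//.
by apply: sumr_ge0 => j _; exact: sqr_ge0.
Qed.

Section in_rkhs.
Variables (H : set (Z -> R)) (ip : (Z -> R) -> (Z -> R) -> R).
Hypothesis rkhs : is_rkhs k H ip.

(** By the reproducing property, the bias is the inner product of f with k_w minus the weighted
    k_{z_j}, whose squared norm is the energy. *)
Lemma gp_bias f w : H f ->
  `|f w - \sum_j gp_weights w ord0 j * f (z j)| <=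
  ip_norm ip f * Num.sqrt (gp_variance k lambda z w).
Proof.
move=> Hf; pose a := gp_weights w.
pose s := (1, w) :: [seq (- a ord0 j, z j) | j <- index_enum 'I_n].
have sf g : \sum_(p <- s) p.1 * g p.2 = g w - \sum_j a ord0 j * g (z j).
  rewrite big_cons mul1r big_map -sumrN; congr (_ + _).
  by apply: eq_bigr => j _; rewrite mulNr.
have Hs := kernel_comb_rkhs rkhs s.
rewrite -sf -(ip_kernel_comb rkhs)//.
apply: le_trans (rkhs_cauchy_schwarz rkhs Hs Hf) _.
rewrite mulrC; apply: ler_wpM2l; first exact: sqrtr_ge0.
rewrite /ip_norm (ip_kernel_comb rkhs)//.
have -> : \sum_(p <- s) p.1 * kernel_comb k s p.2 = gp_energy w a.
  have cE v : kernel_comb k s v = k w v - \sum_j a ord0 j * k (z j) v.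
    exact: (sf (k^~ v)).
  rewrite (sf (kernel_comb k s)) cE; under [X in _ - X]eq_bigr do rewrite cE mulrBr.
  rewrite sumrB /gp_energy.
  have -> : \sum_j a ord0 j * k (z j) w = \sum_j a ord0 j * k w (z j).
    by apply: eq_bigr => j _; rewrite k_sym.
  have -> : \sum_i a ord0 i * (\sum_j a ord0 j * k (z j) (z i)) =
     \sum_i \sum_j a ord0 i * a ord0 j * k (z i) (z j).
    apply: eq_bigr => i _; rewrite mulr_sumr; apply: eq_bigr => j _.
    by rewrite k_sym mulrA.
  by ring.
by rewrite ler_wsqrtr// gp_energy_weights.
Qed.

(** The mean is the combination of the k_{z_j} with coefficients c = G^-1 y. Its squared norm Q
    satisfies Q + lambda |c|^2 = c . y <= lambda |c|^2 + |y|^2 / (4 lambda). *)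
Lemma gp_mean_rkhs (y : 'cV[R]_n) : H (gp_mean k lambda z y) /\
  ip_norm ip (gp_mean k lambda z y) <=
  Num.sqrt (\sum_j y j ord0 ^+ 2) / (2 * Num.sqrt lambda).
Proof.
have [c cdef] : exists c : 'cV[R]_n, c = invmx G *m y by exists (invmx G *m y).
pose s := [seq (c j ord0, z j) | j <- index_enum 'I_n].
have sf g : \sum_(p <- s) p.1 * g p.2 = \sum_j c j ord0 * g (z j) by rewrite big_map.
have mE : gp_mean k lambda z y = kernel_comb k s.
  apply/funext => v; rewrite /kernel_comb (sf (k^~ v)) /gp_mean -mulmxA -cdef mxE.
  by apply: eq_bigr => j _; rewrite !mxE mulrC k_sym.
have Hs := kernel_comb_rkhs rkhs s.
rewrite mE; split => //; rewrite /ip_norm (ip_kernel_comb rkhs)// sf.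
set Q := \sum_j _.
have QE : Q = \sum_i \sum_j c^T ord0 i * c^T ord0 j * k (z i) (z j).
  apply: eq_bigr => i _; rewrite /kernel_comb (sf (k^~ (z i))) mulr_sumr.
  by apply: eq_bigr => j _; rewrite !mxE k_sym mulrA.
have QB : Q + lambda * \sum_j c^T ord0 j ^+ 2 = \sum_j c j ord0 * y j ord0.
  rewrite QE -gram_quad trmxK -mulmxA cdef mulKVmx ?gram_reg_unit// -cdef mxE.
  by apply: eq_bigr => j _; rewrite !mxE.
have cy : \sum_j c j ord0 * y j ord0 <=
    lambda * \sum_j c^T ord0 j ^+ 2 + (\sum_j y j ord0 ^+ 2) / (4 * lambda).
  rewrite mulr_sumr mulr_suml -big_split/=; apply: ler_sum => j _; rewrite !mxE.
  have -> : lambda * c j ord0 ^+ 2 + y j ord0 ^+ 2 / (4 * lambda) =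
    c j ord0 * y j ord0 + (2 * lambda * c j ord0 - y j ord0) ^+ 2 / (4 * lambda).
    by field; rewrite gt_eqF.
  by rewrite lerDl divr_ge0 ?sqr_ge0// mulr_ge0// ltW.
have Y0 : 0 <= \sum_j y j ord0 ^+ 2 by apply: sumr_ge0 => j _; exact: sqr_ge0.
have -> : Num.sqrt (\sum_j y j ord0 ^+ 2) / (2 * Num.sqrt lambda) =
    Num.sqrt ((\sum_j y j ord0 ^+ 2) / (4 * lambda)).
  rewrite sqrtrM// sqrtrV ?mulr_ge0 ?ltW// sqrtrM//; congr (_ / (_ * _)).
  by rewrite (_ : 4 = 2 ^+ 2 :> R) ?sqrtr_sqr ?ger0_norm//; ring.
rewrite ler_wsqrtr//; lra.
Qed.

End in_rkhs.

End family.

(** More observations reduce the variance. An arbitrary injection is allowed because the flattening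
    of outputs and the reversed prefixes order the points differently. *)
Lemma gp_variance_sub n n' (z : 'I_n -> Z) (z' : 'I_n' -> Z) (f : 'I_n -> 'I_n') w :
  injective f -> (forall i, z i = z' (f i)) ->
  gp_variance k lambda z' w <= gp_variance k lambda z w.
Proof.
move=> finj zf; rewrite [leRHS]gp_varianceE.
move: (gp_weights z w) => a.
(* The weights of the smaller family, extended by 0 outside the image of f. *)
pose c : 'rV[R]_n' := \row_j \sum_(i | f i == j) a ord0 i.
have sumc (F : 'I_n' -> R) : \sum_j c ord0 j * F j = \sum_i a ord0 i * F (f i).
  rewrite (partition_big f xpredT)//=; apply: eq_bigr => j _.
  by rewrite mxE mulr_suml; apply: eq_bigr => i /eqP <-.
apply: le_trans (gp_variance_min z' w c) _.
rewrite le_eqVlt; apply/orP; left; apply/eqP.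
rewrite /gp_energy; congr (_ - 2 * _ + _ + lambda * _).
- by rewrite sumc; apply: eq_bigr => i _; rewrite zf.
- under eq_bigr => i _.
    under eq_bigr do rewrite -mulrA.
    rewrite -mulr_sumr (sumc (fun j => k (z' i) (z' j))); over.
  rewrite (sumc (fun i => \sum_j a ord0 j * k (z' i) (z' (f j)))).
  apply: eq_bigr => i _; rewrite mulr_sumr; apply: eq_bigr => j _.
  by rewrite mulrA !zf.
- under eq_bigr do rewrite expr2.
  rewrite (sumc (fun j => c ord0 j)); apply: eq_bigr => i _.
  rewrite /c mxE (bigD1 i)//= big1 ?addr0 ?expr2// => j /andP[/eqP/finj ->].
  by rewrite eqxx.
Qed.

End gp.

(** * Information gain and maximum variance reduction *)

Section information_gain.
Variables (R : realType) (Z : Type) (k : Z -> Z -> R) (lambda : R).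
Hypotheses (k_pd : positive_definite_kernel k) (lambda_gt0 : 0 < lambda).
Hypothesis k_le1 : forall z z', k z z' <= 1.

Let k_sym z z' : k z z' = k z' z. Proof. by case: k_pd => + _; exact. Qed.

Definition information n (z : 'I_n -> Z) : R :=
  \det (1%:M + lambda^-1 *: gram k z).

Definition cons_family n (w : Z) (z : 'I_n -> Z) (i : 'I_(1 + n)) : Z :=
  if fintype.split i is inr j then z j else w.

Lemma cons_familyl n w (z : 'I_n -> Z) i : cons_family w z (lshift n i) = w.
Proof. by rewrite /cons_family; case: splitP => // j /= ij; have := ltn_ord i; rewrite ij. Qed.

Lemma cons_familyr n w (z : 'I_n -> Z) j : cons_family w z (rshift 1 j) = z j.
Proof.
rewrite /cons_family; case: splitP => [i /= ij|j' /= /addnI jj]; last by congr z; exact: val_inj.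
by have := ltn_ord i; rewrite -ij.
Qed.

Lemma information0 (z : 'I_0 -> Z) : information z = 1.
Proof. exact: det_mx00. Qed.

(** Schur complement: the new diagonal entry, once the other points are eliminated, is the posterior
    variance plus lambda. *)
Lemma information_cons n w (z : 'I_n -> Z) :
  information (cons_family w z) =
  information z * (1 + gp_variance k lambda z w / lambda).
Proof.
have ln0 : lambda != 0 by rewrite gt_eqF.
have scale p (y : 'I_p -> Z) :
    information y = lambda^-1 ^+ p * \det (gram k y + lambda%:M).
  rewrite /information -detZ; congr (\det _); rewrite scalerDr addrC; congr (_ + _).
  by rewrite scale_scalar_mx mulVf.
rewrite !scale exprD expr1.
pose G := gram k z + lambda%:M; pose b := kernel_row k z w.
have -> : gram k (cons_family w z) + lambda%:M =
    block_mx (k w w + lambda)%:M b b^T G.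
  apply/matrixP => i j; rewrite mxE mxE mxE.
  case: (split_ordP i) => i' ->; case: (split_ordP j) => j' ->;
    rewrite ?cons_familyl ?cons_familyr.
  - by rewrite block_mxEul mxE !ord1 !eqxx !mulr1n.
  - by rewrite block_mxEur mxE eq_lrshift mulr0n addr0.
  - by rewrite block_mxEdl mxE mxE eq_rlshift mulr0n addr0 k_sym.
  - by rewrite block_mxEdr !mxE eq_rshift.
have Gu : G \in unitmx by exact: gram_reg_unit.
pose X := - (invmx G *m b^T).
have dX : \det (block_mx (1%:M : 'M[R]_1) 0 X 1%:M) = 1 by rewrite det_lblock !det1 mulr1.
have -> : \det (block_mx (k w w + lambda)%:M b b^T G) =
    (gp_variance k lambda z w + lambda) * \det G.
  rewrite -[LHS]mulr1 -dX -det_mulmx mulmx_block !mulmx1 !mulmx0 !add0r.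
  have -> : b^T + G *m X = 0 by rewrite /X mulmxN mulKVmx// subrr.
  rewrite det_ublock; congr (_ * _); rewrite det_mx11 /X mulmxN mulmxA !mxE /= mulr1n.
  rewrite /gp_variance addrAC; congr (_ + _); congr (_ - _).
  by rewrite !mxE.
by rewrite -/G; field.
Qed.

Lemma information_ind n (z : 'I_n.+1 -> Z) :
  information z = information (fun j => z (rshift 1 j)) *
    (1 + gp_variance k lambda (fun j => z (rshift 1 j)) (z (lshift n (ord0 : 'I_1))) / lambda).
Proof.
rewrite -information_cons; congr (\det (_ + _ *: gram k _)).
apply/funext => i.
have [i' ->|j ->] := split_ordP (i : 'I_(1 + n)); last by rewrite cons_familyr.
by rewrite cons_familyl ord1.
Qed.

(** The upper bound makes the set under the supremum of [max_information_gain] bounded, without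
    which the supremum would carry no information. *)
Lemma information_bounds n (z : 'I_n -> Z) :
  0 < information z <= (1 + lambda^-1) ^+ n.
Proof.
elim: n z => [|n IH] z; first by rewrite information0 ltr01 expr0 lexx.
rewrite information_ind; set z' := fun j => z (rshift 1 j); set w := z _.
have /andP[i0 i1] := IH z'.
have v0 := gp_variance_ge0 k_pd lambda_gt0 z' w.
have v1 : gp_variance k lambda z' w <= 1.
  exact: le_trans (gp_variance_le k_pd lambda_gt0 z' w) (k_le1 w w).
have d0 : 0 <= gp_variance k lambda z' w / lambda by rewrite divr_ge0// ltW.
have d1 : gp_variance k lambda z' w / lambda <= lambda^-1.
  by rewrite ler_pdivrMr// mulVf// gt_eqF.
apply/andP; split; first by rewrite mulr_gt0// ltr_pwDl.
by rewrite exprSr; apply: ler_pM => //; [exact: ltW|rewrite addr_ge0|rewrite lerD2l].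
Qed.

Lemma ln_information_le_max n (z : 'I_n -> Z) :
  2^-1 * ln (information z) <= max_information_gain k lambda n.
Proof.
apply: ub_le_sup; last by exists z.
exists (2^-1 * ln ((1 + lambda^-1) ^+ n)) => _ [y _ <-].
have /andP[y0 y1] := information_bounds y.
by rewrite ler_pM2l ?invr_gt0// ler_ln ?posrE//; exact: lt_le_trans y0 y1.
Qed.

Fixpoint prefix_family (y : nat -> Z) (n : nat) : 'I_n -> Z :=
  match n with
  | 0 => fun=> y 0%N
  | n'.+1 => cons_family (y n') (@prefix_family y n')
  end.

Arguments prefix_family : clear implicits.

Lemma prefix_familyE y n (i : 'I_n) : prefix_family y n i = y (n - i.+1)%N.
Proof.
elim: n i => [[]//|n IH] i /=.
have [i' ->|j ->] := split_ordP (i : 'I_(1 + n)).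
  by rewrite cons_familyl ord1 /= subSS subn0.
by rewrite cons_familyr IH /= subSS.
Qed.

(** Chain rule: each of the first N points adds at least ln (1 + v / lambda), each later one at
    least 0. *)
Lemma ln_information_prefix y (N n : nat) (v : R) : (N <= n)%N -> 0 <= v ->
  (forall j, (j < N)%N -> v <= gp_variance k lambda (prefix_family y j) (y j)) ->
  N%:R * ln (1 + v / lambda) <= ln (information (prefix_family y n)).
Proof.
move=> + v0; elim: n N => [|n IH] N Nn hN.
  by move: Nn; rewrite leqn0 => /eqP ->; rewrite mul0r information0 ln1.
have inf0 := (andP (information_bounds (prefix_family y n))).1.
have var0 := gp_variance_ge0 k_pd lambda_gt0 (prefix_family y n) (y n).
have d0 : 0 <= gp_variance k lambda (prefix_family y n) (y n) / lambda.
  by rewrite divr_ge0// ltW.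
have vl0 : 0 <= v / lambda by rewrite divr_ge0// ltW.
rewrite /= information_cons lnM ?posrE//; last by rewrite ltr_pwDl.
move: Nn; rewrite leq_eqVlt => /orP[/eqP NE|Nn].
  rewrite NE -natr1 mulrDl mul1r; apply: lerD.
    by apply: IH => // j jn; apply: hN; rewrite NE ltnS ltnW.
  rewrite ler_ln ?posrE ?ltr_pwDl// lerD2l ler_pM2r ?invr_gt0//.
  by apply: hN; rewrite NE.
rewrite -[leLHS]addr0; apply: lerD; first exact: IH.
by rewrite ln_ge0// lerDl.
Qed.

End information_gain.

Arguments prefix_family {Z} y n.

Section multi_output_queries.
Variables (R : realType) (X : Type) (d : nat).
Variables (k : X * 'I_d -> X * 'I_d -> R) (lambda : R).
Hypotheses (k_pd : positive_definite_kernel k) (lambda_gt0 : 0 < lambda).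
Hypothesis k_le1 : forall z z', k z z' <= 1.

Lemma query_output_index (x : nat -> X) N (i : 'I_N) (l : 'I_d) :
  query_output x (mxvec_index i l) = (x i, l).
Proof. by rewrite /query_output /mxvec_index cast_ordK enum_rankK. Qed.

Lemma l2norm_posterior_sd_sqr x N w : (0 < N)%N ->
  l2norm (posterior_sd k lambda x N w) ^+ 2 =
  \sum_(l < d) gp_variance k lambda (query_output x (n := N)) (w, l).
Proof.
move=> N0; rewrite /l2norm sqr_sqrtr; last by apply: sumr_ge0 => l _; exact: sqr_ge0.
apply: eq_bigr => l _; rewrite mxE gtn_eqF// sqr_sqrtr//.
exact: gp_variance_ge0.
Qed.

Lemma gp_variance_queries_le x M N z : (M <= N)%N ->
  gp_variance k lambda (query_output x (n := N)) z <=
  gp_variance k lambda (query_output x (n := M)) z.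
Proof.
move=> MN.
pose e (u : 'I_(M * d)) := enum_val (cast_ord (esym (mxvec_cast M d)) u).
pose f u := mxvec_index (widen_ord MN (e u).1) (e u).2.
apply: (@gp_variance_sub _ _ _ _ k_pd lambda_gt0 _ _ _ _ f).
  move=> u u' /cast_ord_inj/enum_rank_inj [/= E1 E2].
  have : e u = e u' by rewrite [e u]surjective_pairing [e u']surjective_pairing E2; congr pair; exact: val_inj.
  by move=> /enum_val_inj/cast_ord_inj.
by move=> u; rewrite query_output_index.
Qed.

Lemma ln_ge_ratio (v : R) : 0 <= v -> v / (1 + v) <= ln (1 + v).
Proof.
move=> v0; have v1 : 0 < 1 + v by rewrite ltr_pwDl.
have : ln (1 + - (v / (1 + v))) <= - (v / (1 + v)).
  apply: le_ln1Dx; rewrite ltrN2 ltr_pdivrMr// mul1r ltrDr ltr01//.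
rewrite (_ : 1 + - _ = (1 + v)^-1); last by field; rewrite gt_eqF.
by rewrite lnV ?posrE// lerN2.
Qed.

(** By monotonicity and the MVR rule, the total variance at a query given the preceding ones is at
    least the final one, a. One of its d outputs thus has variance at least a / d, and N such
    outputs bound the information gain from below. *)
Lemma mvr_variance_le x N w : (0 < d)%N -> (0 < N)%N -> mvr_queries k lambda x N ->
  l2norm (posterior_sd k lambda x N w) ^+ 2 <=
  2 * d%:R * (lambda + 1) * max_information_gain k lambda (N * d) / N%:R.
Proof.
move=> d0 N0 mvr; set a := l2norm _ ^+ 2.
have d0R : 0 < d%:R :> R by rewrite ltr0n.
have a0 : 0 <= a by exact: sqr_ge0.
(* y_j is an output of the query j + 1 (of the point w for j = N - 1) with variance
   at least a / d given the preceding queries. The query 0 is not used: it is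
   arbitrary as all the prior standard deviations are 1 by convention. *)
pose p j := if (j.+1 < N)%N then x j.+1 else w.
have step j : (j < N)%N ->
    a <= \sum_(l < d) gp_variance k lambda (query_output x (n := j.+1)) (p j, l).
  move=> jN; rewrite /a l2norm_posterior_sd_sqr// /p.
  have mon : \sum_(l < d) gp_variance k lambda (query_output x (n := N)) (w, l) <=
      \sum_(l < d) gp_variance k lambda (query_output x (n := j.+1)) (w, l).
    by apply: ler_sum => l _; exact: gp_variance_queries_le.
  case: ifPn => // jN1; apply: le_trans mon _.
  rewrite -!l2norm_posterior_sd_sqr//; apply: lerXn2r; rewrite ?nnegrE ?sqrtr_ge0//.
  exact: mvr.
have ex_l j : exists l : 'I_d, (j < N)%N ->
    a / d%:R <= gp_variance k lambda (query_output x (n := j.+1)) (p j, l).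
  have [jN|] := boolP (j < N)%N; last by move=> _; exists (Ordinal d0).
  apply: contrapT => /forallNP h.
  suff : \sum_(l < d) gp_variance k lambda (query_output x (n := j.+1)) (p j, l) < a.
    by rewrite ltNge step.
  have -> : a = \sum_(l < d) (a / d%:R).
    by rewrite sumr_const card_ord -[RHS]mulr_natr mulfVK// gt_eqF.
  apply: ltr_sum; first by apply/hasP; exists (Ordinal d0) => //; rewrite mem_index_enum.
  by move=> l _; rewrite ltNge; apply/negP => hl; exact: (h l).
have [l lP] := choice ex_l.
pose y j := (p j, l j).
have v0 : 0 <= a / d%:R by rewrite divr_ge0// ler0n.
have hy j : (j < N)%N -> a / d%:R <= gp_variance k lambda (prefix_family y j) (y j).
  move=> jN; apply: le_trans (lP j jN) _.
  have lt1 (i : 'I_j) : ((j - i.+1).+1 < j.+1)%N.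
    by rewrite ltnS -subSn// subSS leq_subr.
  (* Prefixes list the latest point first, and y_j is an output of the query j + 1: this accounts
     for the reversal and the shift. *)
  pose f (i : 'I_j) := mxvec_index (Ordinal (lt1 i)) (l (j - i.+1)%N).
  apply: (@gp_variance_sub _ _ _ _ k_pd lambda_gt0 _ _ _ _ f).
    move=> i i' /cast_ord_inj/enum_rank_inj [/= E _].
    apply: val_inj; apply/eqP; rewrite -eqSS; apply/eqP.
    by rewrite -(subKn (ltn_ord i)) E subKn.
  move=> i; rewrite prefix_familyE query_output_index /y /p /=.
  by rewrite (leq_trans (lt1 i)).
have NNd : (N <= N * d)%N by rewrite leq_pmulr.
have := ln_information_prefix k_pd lambda_gt0 k_le1 NNd v0 hy.
have := ln_information_le_max k_pd lambda_gt0 k_le1 (prefix_family y (N * d)).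
set L := ln (information _ _ _); set Ga := max_information_gain _ _ _ => LG NL.
(* This allows v / (lambda + v) to be replaced by v / (lambda + 1). *)
have aD : a / d%:R <= 1.
  rewrite ler_pdivrMr// mul1r /a l2norm_posterior_sd_sqr//.
  have -> : d%:R = \sum_(l < d) (1 : R) by rewrite sumr_const card_ord.
  apply: ler_sum => i _.
  exact: le_trans (gp_variance_le k_pd lambda_gt0 _ _) (k_le1 _ _).
set v := a / d%:R in NL v0 aD.
have aE : a = v * d%:R by rewrite mulfVK// gt_eqF.
have lnv : v / (lambda + 1) <= ln (1 + v / lambda).
  apply: le_trans (ln_ge_ratio _); last by rewrite divr_ge0// ltW.
  have -> : v / lambda / (1 + v / lambda) = v / (lambda + v).
    by field; rewrite !gt_eqF// ltr_pwDl.
  by rewrite ler_wpM2l// lef_pV2 ?posrE ?ltr_pwDl// lerD2l.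
have NR0 : 0 < N%:R :> R by rewrite ltr0n.
have l1 : 0 < lambda + 1 by rewrite addr_gt0.
rewrite ler_pdivlMr// aE.
have : N%:R * (v / (lambda + 1)) <= 2 * Ga.
  apply: le_trans (_ : L <= _); last by lra.
  by apply: le_trans NL; rewrite ler_wpM2l// ltW.
rewrite mulrA ler_pdivrMr// => h.
have := ler_wpM2l (ltW d0R) h; lra.
Qed.

(** The family repeating z gains at least this much from its first point. The bound serves to absorb
    the discretization error. *)
Lemma max_information_gain_ge z M : (0 < M)%N -> 0 <= k z z ->
  2^-1 * (k z z / (lambda + 1)) <= max_information_gain k lambda M.
Proof.
move=> M0 kz.
have v0 : k z z <= gp_variance k lambda (prefix_family (fun=> z) 0) z.
  rewrite /gp_variance lerBrDr gerDl /=.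
  by rewrite mxE big_ord0.
have hy j : (j < 1)%N -> k z z <= gp_variance k lambda (prefix_family (fun=> z) j) z.
  by case: j.
have := ln_information_prefix k_pd lambda_gt0 k_le1 M0 kz hy.
have := ln_information_le_max k_pd lambda_gt0 k_le1 (prefix_family (fun=> z) M).
rewrite mul1r => LG NL; apply: le_trans LG; rewrite ler_pM2l ?invr_gt0//.
apply: le_trans NL; apply: le_trans (ln_ge_ratio _); last by rewrite divr_ge0// ltW.
have -> : k z z / lambda / (1 + k z z / lambda) = k z z / (lambda + k z z).
  by field; rewrite !gt_eqF// ltr_pwDl.
by rewrite ler_wpM2l// lef_pV2 ?posrE ?ltr_pwDl// lerD2l.
Qed.

End multi_output_queries.

(** * Concentration of the posterior mean *)

(** Union bound with one confidence level per functional. *)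
Lemma noise_concentration_all {R : realType} {dT : measure_display} {T : measurableType dT}
    (Pr : probability T R) (n : nat) (sigma : R) (noise : nat -> {mfun T >-> 'rV[R]_n})
    (N : nat) (I : eqType) (s : seq I) (a : I -> nat -> 'rV[R]_n) (delta : I -> R) :
  iid_gaussian_noise Pr sigma noise -> 0 < sigma ->
  (forall i, i \in s -> 0 < delta i < 1) ->
  exists E, [/\ measurable E, ((1 - \sum_(i <- s) delta i)%:E <= Pr E)%E &
    forall w, E w -> forall i, i \in s ->
      `|noise_sum noise N (a i) w| <=
      sigma * Num.sqrt (coef_sqnorm N (a i)) * Num.sqrt (2 * ln (2 / delta i))].
Proof.
move=> iid sigma_gt0; elim: s => [|i s IH] h.
  by exists setT; split => //; rewrite big_nil subr0 probability_setT.
have [|E [mE PE hE]] := IH; first by move=> j js; apply: h; rewrite inE js orbT.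
have di := h i (mem_head _ _).
pose t := sigma * Num.sqrt (coef_sqnorm N (a i)) * Num.sqrt (2 * ln (2 / delta i)).
pose F := [set w | t < `|noise_sum noise N (a i) w|].
have mF : measurable F.
  apply: measurable_lt_set => //; apply: measurableT_comp => //.
  exact: measurable_noise_sum.
have PF : (Pr F <= (delta i)%:E)%E by exact: noise_concentration.
exists (E `\` F); split.
- exact: measurableD.
- rewrite big_cons (_ : 1 - _ = 1 - \sum_(j <- s) delta j - delta i); last by ring.
  rewrite EFinB leeBlDr//; apply: le_trans PE _.
  have : (Pr E <= Pr (E `\` F) + Pr F)%E.
    apply: le_trans (measureU2 _ _ _) => //; last exact: measurableD.
    apply: le_measure; rewrite ?inE//; first by apply: measurableU => //; exact: measurableD.
    by move=> w Ew; have [Fw|nF] := pselect (F w); [right|left].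
  by move=> h'; apply: le_trans h' _; exact: leeD.
- move=> w [Ew /negP]; rewrite -leNgt => nF j.
  by rewrite inE => /orP[/eqP ->//|js]; exact: hE.
Qed.

Section posterior_error.
Variables (R : realType) (X : Type) (d N : nat).
Variables (k : X * 'I_d -> X * 'I_d -> R) (lambda : R).
Hypotheses (k_pd : positive_definite_kernel k) (lambda_gt0 : 0 < lambda).
Variables (H : set (X * 'I_d -> R)) (ip : (X * 'I_d -> R) -> (X * 'I_d -> R) -> R).
Hypothesis rkhs : is_rkhs k H ip.
Variable x : nat -> X.

Lemma sum_mxvec_index (F : 'I_(N * d) -> R) :
  \sum_u F u = \sum_(i < N) \sum_(l < d) F (mxvec_index i l).
Proof.
rewrite (reindex _ (curry_mxvec_bij N d))/= pair_big. by apply: eq_bigr => -[].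
Qed.

Lemma sum_responses (y : nat -> 'rV[R]_d) (c : 'rV[R]_(N * d)) :
  \sum_u c ord0 u * responses y N u ord0 =
  \sum_(i < N) \sum_(l < d) c ord0 (mxvec_index i l) * y i ord0 l.
Proof.
rewrite sum_mxvec_index; apply: eq_bigr => i _; apply: eq_bigr => l _.
by rewrite mxE mxvecE mxE.
Qed.

(** [noise_sum] takes coefficients indexed by nat; they are 0 beyond the N queries. *)
Definition query_weights (z : X * 'I_d) (i : nat) : 'rV[R]_d :=
  \row_l oapp (fun i' : 'I_N =>
    gp_weights k lambda (query_output x (n := N)) z ord0 (mxvec_index i' l)) 0 (insub i).

Lemma query_weightsE z (i : 'I_N) l : query_weights z i ord0 l =
  gp_weights k lambda (query_output x (n := N)) z ord0 (mxvec_index i l).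
Proof. by rewrite mxE valK. Qed.

Lemma gp_mean_responses (y : nat -> 'rV[R]_d) z :
  gp_mean k lambda (query_output x (n := N)) (responses y N) z =
  \sum_(i < N) \sum_(l < d) query_weights z i ord0 l * y i ord0 l.
Proof.
rewrite gp_meanE sum_responses; apply: eq_bigr => i _; apply: eq_bigr => l _.
by rewrite query_weightsE.
Qed.

Lemma coef_sqnorm_query_weights z :
  lambda * coef_sqnorm N (query_weights z) <=
  gp_variance k lambda (query_output x (n := N)) z.
Proof.
apply: le_trans (gp_weights_sqnorm k_pd lambda_gt0 _ z).
rewrite ler_pM2l// sum_mxvec_index; apply: ler_sum => i _; apply: ler_sum => l _.
by rewrite query_weightsE.
Qed.

Lemma posterior_mean_error_le (f : X -> 'rV[R]_d) (y : nat -> 'rV[R]_d) v l :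
  H (fun z => f z.1 ord0 z.2) ->
  `|posterior_mean k lambda x (fun i => f (x i) + y i) N v ord0 l - f v ord0 l| <=
  ip_norm ip (fun z => f z.1 ord0 z.2) *
    Num.sqrt (gp_variance k lambda (query_output x (n := N)) (v, l)) +
  `|gp_mean k lambda (query_output x (n := N)) (responses y N) (v, l)|.
Proof.
move=> Hf; rewrite mxE !gp_mean_responses.
under eq_bigr do under eq_bigr do rewrite [X in _ * X]mxE mulrDr.
under eq_bigr do rewrite big_split.
rewrite big_split/= addrAC; apply: le_trans (ler_normD _ _) _; rewrite lerD2r.
have := gp_bias k_pd lambda_gt0 (query_output x (n := N)) rkhs (v, l) Hf.
rewrite distrC sum_mxvec_index; congr (`|_ - _| <= _).
apply: eq_bigr => i _; apply: eq_bigr => l' _.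
by rewrite query_weightsE query_output_index.
Qed.

Lemma ip_normZ g a : H g -> ip_norm ip (fun z => a * g z) = `|a| * ip_norm ip g.
Proof.
move=> Hg; have H0 := rkhs_zero rkhs.
have E (c : R) : (fun z => c * g z) = (fun z => c * g z + 0).
  by apply/funext => z; rewrite addr0.
have Ha : H (fun z => a * g z) by rewrite E; exact: (rkhs_linear rkhs).
have L h : H h -> ip (fun z => a * g z) h = a * ip g h.
  by move=> Hh; rewrite E (rkhs_ip_linear rkhs)// (ip0l rkhs)// addr0.
rewrite /ip_norm L// (rkhs_ip_sym rkhs)// L// mulrA -expr2 sqrtrM ?sqr_ge0//.
by rewrite sqrtr_sqr.
Qed.

(** The one-sided control on the ball of radius [rad] is applied to g / c and to - g / c. *)
Lemma near_le_scaled (rad e : R) (near : X -> X) : 0 <= rad ->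
  (forall g, H g -> ip_norm ip g <= rad -> forall v l, g (v, l) - g (near v, l) <= e) ->
  forall c g, 0 < c -> H g -> ip_norm ip g <= c * rad ->
    forall v l, `|g (v, l)| <= `|g (near v, l)| + c * e.
Proof.
move=> rad0 h c g c0 Hg gc v l.
have c1 : 0 < c^-1 by rewrite invr_gt0.
have HZ (a : R) : H (fun z => a * g z).
  rewrite (_ : (fun z => a * g z) = (fun z => a * g z + 0)).
    by apply: (rkhs_linear rkhs) => //; exact: rkhs_zero rkhs.
  by apply/funext => z; rewrite addr0.
have main (a : R) : `|a| = c^-1 -> a * g (v, l) - a * g (near v, l) <= e.
  move=> aE; apply: (h _ (HZ a)).
  by rewrite ip_normZ// aE mulrC ler_pdivrMr// mulrC.
have h1 := main c^-1 (gtr0_norm c1).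
have h2 : - c^-1 * g (v, l) - - c^-1 * g (near v, l) <= e.
  by apply: main; rewrite normrN gtr0_norm.
rewrite -lerBlDl; apply: le_trans (lerB_dist _ _) _.
rewrite ler_norml; apply/andP; split.
  rewrite lerNl -ler_pdivrMl//; lra.
rewrite -ler_pdivrMl//; lra.
Qed.

End posterior_error.

(** The union bound over N d noise coordinates produces ln (3 N d / delta), whereas the radius in
    [beta_] contains ln (3 N / delta): the dimension is taken out of the logarithm as a factor. *)
Lemma ln_natmul_le (R : realType) (a : R) n : 2 <= a -> (0 < n)%N ->
  ln (a * n%:R) <= n%:R * ln a.
Proof.
move=> a2; case: n => // n _; have a0 : 0 < a by lra.
have an : a * n.+1%:R <= a ^+ n.+1.
  elim: n => [|n IH]; first by rewrite mulr1 expr1.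
  rewrite exprS; apply: le_trans (_ : a * (a * n.+1%:R) <= _); last by rewrite ler_pM2l.
  rewrite ler_pM2l// -[n.+2%:R]natr1.
  have n1 : 1 <= n.+1%:R :> R by rewrite ler1n.
  have := ler_wpM2r (ltW (lt_le_trans ltr01 n1)) a2; lra.
by rewrite mulr_natl -lnXn// ler_ln ?posrE ?exprn_gt0// mulr_gt0// ltr0n.
Qed.

Section noise_coordinates.
Variables (R : realType) (dT : measure_display) (T : measurableType dT) (n : nat).
Variables (noise : nat -> {mfun T >-> 'rV[R]_n}) (N : nat) (j : 'I_N) (l : 'I_n).

(** A single noise coordinate as a [noise_sum], so that coordinates and values at the centers share
    one union bound. *)
Definition coord_coef (i : nat) : 'rV[R]_n := if i == j then delta_mx ord0 l else 0.

Lemma noise_sum_coord w : noise_sum noise N coord_coef w = noise j w ord0 l.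
Proof.
rewrite /noise_sum (bigD1 j)//= [X in _ + X]big1 => [|i ij]; last first.
  apply: big1 => l' _; rewrite /coord_coef ifF ?mxE ?mul0r//.
  by apply: contra_neqF ij => /eqP ij; exact: val_inj.
rewrite addr0 (bigD1 l)//= [X in _ + X]big1 => [|l' ll]; last first.
  by rewrite /coord_coef eqxx mxE (negbTE ll) andbF mul0r.
by rewrite /coord_coef eqxx mxE !eqxx mul1r addr0.
Qed.

Lemma coef_sqnorm_coord : coef_sqnorm N coord_coef = 1.
Proof.
rewrite /coef_sqnorm (bigD1 j)//= [X in _ + X]big1 => [|i ij]; last first.
  apply: big1 => l' _; rewrite /coord_coef ifF ?mxE ?expr0n//.
  by apply: contra_neqF ij => /eqP ij; exact: val_inj.
rewrite addr0 (bigD1 l)//= [X in _ + X]big1 => [|l' ll]; last first.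
  by rewrite /coord_coef eqxx mxE (negbTE ll) andbF expr0n.
by rewrite /coord_coef eqxx mxE !eqxx expr1n addr0.
Qed.

End noise_coordinates.

(** The noise coordinates bound the RKHS norm of the noise part, which makes the discretization
    applicable; its values at the centers are controlled directly, with the sharper [s]. *)
Lemma posterior_mean_concentration (R : realType) (X : Type) (d N : nat)
    (k : X * 'I_d -> X * 'I_d -> R) (lambda sigma : R)
    (H : set (X * 'I_d -> R)) (ip : (X * 'I_d -> R) -> (X * 'I_d -> R) -> R)
    (x : nat -> X) (dT : measure_display) (T : measurableType dT)
    (Pr : probability T R) (noise : nat -> {mfun T >-> 'rV[R]_d})
    (M : nat) (center : 'I_M -> X) (idx : X -> 'I_M) (f : X -> 'rV[R]_d)
    (rad e delta delta1 s : R) :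
  positive_definite_kernel k -> 0 < lambda -> is_rkhs k H ip ->
  iid_gaussian_noise Pr sigma noise -> 0 < sigma ->
  (0 < N)%N -> (0 < d)%N ->
  H (fun z => f z.1 ord0 z.2) ->
  0 < delta < 1 -> 0 < delta1 < 1 ->
  Num.sqrt N%:R * (sigma / lambda * Num.sqrt (2 * ln (3 * N%:R / delta))) <= rad ->
  (forall z, Num.sqrt (gp_variance k lambda (query_output x (n := N)) z) <= s) ->
  (forall g, H g -> ip_norm ip g <= rad ->
     forall v l, g (v, l) - g (center (idx v), l) <= e) ->
  exists E, [/\ measurable E,
    ((1 - (2 * delta / 3 + (M * d)%:R * delta1))%:E <= Pr E)%E &
    forall w, E w -> forall v l,
    `|posterior_mean k lambda x (fun i => f (x i) + noise i w) N v ord0 l - f v ord0 l| <=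
    (ip_norm ip (fun z => f z.1 ord0 z.2) +
       sigma / Num.sqrt lambda * Num.sqrt (2 * ln (2 / delta1))) * s +
    d%:R * Num.sqrt lambda / 2 * e].
Proof.
move=> k_pd lambda_gt0 rkhs iid sigma_gt0 N0 d0 Hf delta01 delta101 hrad hs happrox.
have /andP[delta_gt0 delta_lt1] := delta01.
have NR : 1 <= N%:R :> R by rewrite ler1n.
have dR : 1 <= d%:R :> R by rewrite ler1n.
have dNR : 1 <= N%:R * d%:R :> R by rewrite -natrM ler1n muln_gt0 N0.
have sl0 : 0 < Num.sqrt lambda by rewrite sqrtr_gt0.
have slE : Num.sqrt lambda ^+ 2 = lambda by rewrite sqr_sqrtr// ltW.
pose delta0 := 2 * delta / (3 * (N%:R * d%:R)).
pose I := (('I_N * 'I_d) + ('I_M * 'I_d))%type.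
pose a (i : I) : nat -> 'rV[R]_d := match i with
  | inl jl => coord_coef R jl.1 jl.2
  | inr ml => query_weights N k lambda x (center ml.1, ml.2) end.
pose dl (i : I) := match i with inl _ => delta0 | inr _ => delta1 end.
have delta001 : 0 < delta0 < 1.
  rewrite /delta0 divr_gt0 ?mulr_gt0//=; [|lra|lra].
  by rewrite ltr_pdivrMr ?mul1r; lra.
have dl01 i : i \in index_enum I -> 0 < dl i < 1 by case: i.
have [E [mE PE hE]] := noise_concentration_all N a iid sigma_gt0 dl01.
exists E; split => //.
  apply: le_trans PE; rewrite lee_fin lerD2l lerN2 big_sumType/=.
  rewrite !sumr_const !card_prod !card_ord -[delta0 *+ _]mulr_natl -[delta1 *+ _]mulr_natl lerD2r natrM /delta0.
  by rewrite le_eqVlt; apply/orP; left; apply/eqP; field; apply/andP; split; rewrite gt_eqF; lra.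
move=> w Ew v l.
set g := gp_mean k lambda (query_output x (n := N)) (responses (fun i => noise i w) N).
pose t3 := Num.sqrt (2 * ln (3 * N%:R / delta)).
have a3 : 2 <= 3 * N%:R / delta by rewrite ler_pdivlMr//; lra.
have ln3 : 0 <= ln (3 * N%:R / delta) by rewrite ln_ge0//; lra.
have noise_le (j : 'I_N) l' : noise j w ord0 l' ^+ 2 <= sigma ^+ 2 * (d%:R * t3 ^+ 2).
  have := hE w Ew (inl (j, l')) (mem_index_enum _).
  rewrite /= noise_sum_coord coef_sqnorm_coord sqrtr1 mulr1 => h.
  rewrite -real_normK ?num_real//.
  apply: le_trans (_ : (sigma * Num.sqrt (2 * ln (2 / delta0))) ^+ 2 <= _).
    by apply: lerXn2r => //; rewrite nnegrE; exact: le_trans h.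
  rewrite exprMn ler_pM2l ?exprn_gt0// /t3.
  have -> : 2 / delta0 = 3 * N%:R / delta * d%:R.
    by rewrite /delta0; field; apply/and3P; split; rewrite gt_eqF; lra.
  have := ln_natmul_le a3 d0.
  rewrite !sqr_sqrtr ?mulr_ge0//; first lra.
  by rewrite ln_ge0//; nra.
have [Hg gle] := gp_mean_rkhs k_pd lambda_gt0 (query_output x (n := N)) rkhs
  (responses (fun i => noise i w) N).
rewrite -/g in Hg gle.
(* The responses have norm at most d sqrt N sigma t3; divided by 2 sqrt lambda, this is c times the
   lower bound sqrt N (sigma / lambda) t3 of [rad]. *)
pose c := d%:R * Num.sqrt lambda / 2.
have c0 : 0 < c by rewrite /c; nra.
have gc : ip_norm ip g <= c * rad.
  apply: le_trans gle _.
  have : \sum_j responses (fun i => noise i w) N j ord0 ^+ 2 <=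
      (d%:R * (Num.sqrt N%:R * sigma * t3)) ^+ 2.
    rewrite sum_mxvec_index.
    under eq_bigr do under eq_bigr do rewrite mxE mxvecE mxE.
    apply: le_trans (_ : \sum_(i < N) \sum_(l' < d) sigma ^+ 2 * (d%:R * t3 ^+ 2) <= _).
      by apply: ler_sum => i _; apply: ler_sum => l' _; exact: noise_le.
    rewrite !sumr_const !card_ord -[leLHS]mulr_natl -[X in _ * X <= _]mulr_natl.
    by rewrite !exprMn [Num.sqrt N%:R ^+ 2]sqr_sqrtr ?ler0n// le_eqVlt; apply/orP; left; apply/eqP; ring.
  move=> /ler_wsqrtr; rewrite sqrtr_sqr ger0_norm; last first.
    by rewrite !mulr_ge0 ?sqrtr_ge0 ?ler0n// ltW.
  move=> h; rewrite ler_pdivrMr ?mulr_gt0//; apply: le_trans h _.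
  have := ler_wpM2l (ltW c0) hrad.
  have s2 : 0 <= 2 * Num.sqrt lambda by rewrite mulr_ge0// ltW.
  rewrite -/t3 => /(ler_wpM2r s2).
  apply: le_trans; rewrite le_eqVlt; apply/orP; left; apply/eqP.
  have -> : sigma / lambda = sigma / Num.sqrt lambda ^+ 2 by rewrite slE.
  by rewrite /c; field; rewrite gt_eqF.
have rad0 : 0 <= rad.
  by apply: le_trans hrad; rewrite !mulr_ge0 ?sqrtr_ge0 ?invr_ge0// ltW.
have gcenter (m : 'I_M) : `|g (center m, l)| <=
    sigma / Num.sqrt lambda * Num.sqrt (2 * ln (2 / delta1)) * s.
  have := hE w Ew (inr (m, l)) (mem_index_enum _).
  rewrite /= /g gp_mean_responses => /le_trans; apply.
  have /ler_wsqrtr := coef_sqnorm_query_weights N k_pd lambda_gt0 x (center m, l).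
  rewrite sqrtrM ?(ltW lambda_gt0)// => /le_trans/(_ (hs _)).
  rewrite mulrC -ler_pdivlMr// => h.
  have -> : sigma / Num.sqrt lambda * Num.sqrt (2 * ln (2 / delta1)) * s =
    sigma * (s / Num.sqrt lambda) * Num.sqrt (2 * ln (2 / delta1)) by ring.
  by apply: ler_wpM2r; [exact: sqrtr_ge0|rewrite ler_pM2l].
apply: le_trans (posterior_mean_error_le N k_pd lambda_gt0 rkhs x (fun i => noise i w) v l Hf) _.
rewrite mulrDl -[leRHS]addrA; apply: lerD.
  by apply: ler_wpM2l => //; exact: sqrtr_ge0.
apply: le_trans (near_le_scaled rkhs rad0 happrox c0 Hg gc v l) _.
by rewrite lerD2r.
Qed.

(** As 2 / e >= 6, it suffices that ln 6 >= 5/6 >= 1/2. It gives sigma / lambda <= beta_N in the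
    error bound. *)
Lemma sqrt_ln_ge1 (R : realType) (e : R) : 0 < e -> 3 * e <= 1 ->
  1 <= Num.sqrt (2 * ln (2 / e)).
Proof.
move=> e0 e3; rewrite -[leLHS]sqrtr1; apply: ler_wsqrtr.
have p6 : 0 < 1 + 5 :> R by rewrite addr_gt0// ltr0n.
have h1 : 2^-1 <= ln (1 + 5) :> R.
  by apply: le_trans (ln_ge_ratio _) => //; rewrite ler_pdivlMr//; lra.
have h2 : 1 + 5 <= 2 / e by rewrite ler_pdivlMr//; lra.
have : ln (1 + 5) <= ln (2 / e) by rewrite ler_ln// posrE// (lt_le_trans p6).
lra.
Qed.

Section mvr_learning.
Variables (R : realType) (d q : nat) (S : set 'rV[R]_d) (A : set 'rV[R]_q).
Variables (k : state_action S A * 'I_d -> state_action S A * 'I_d -> R) (sigma lambda : R).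
Hypotheses (d_gt0 : (0 < d)%N) (k_pd : positive_definite_kernel k).
Hypotheses (k_le1 : forall z z', k z z' <= 1) (sigma_gt0 : 0 < sigma) (lambda_gt0 : 0 < lambda).

Lemma kernel_diag_ge0 z : 0 <= k z z.
Proof.
have [_ /(_ 1%N (fun=> z) (fun=> 1))] := k_pd.
by rewrite !big_ord1 !mul1r.
Qed.

Lemma rkhs_eq0 H ip g z : is_rkhs k H ip -> H g -> k z z = 0 -> g z = 0.
Proof.
move=> rkhs Hg kz; have Hk := rkhs_kernel rkhs z.
have := rkhs_cauchy_schwarz rkhs Hg Hk.
rewrite (rkhs_reproducing rkhs)// {2}/ip_norm (rkhs_reproducing rkhs)// kz sqrtr0 mulr0.
by rewrite normr_le0 => /eqP.
Qed.

Lemma mvr_information_gain_ge0 (x : nat -> state_action S A) N : (0 < N)%N ->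
  0 <= max_information_gain k lambda (N * d).
Proof.
move=> N0; pose z := (x 0%N, Ordinal d_gt0).
have Nd : (0 < N * d)%N by rewrite muln_gt0 N0.
apply: le_trans (max_information_gain_ge k_pd lambda_gt0 k_le1 Nd (kernel_diag_ge0 z)).
by rewrite mulr_ge0// divr_ge0 ?kernel_diag_ge0// addr_ge0// ltW.
Qed.

Lemma mvr_learning : exists2 C1 : R, 0 < C1 &
  forall (H : set (state_action S A * 'I_d -> R))
    (ip : (state_action S A * 'I_d -> R) -> (state_action S A * 'I_d -> R) -> R)
    (B C : R) (f : state_action S A -> 'rV[R]_d)
    (disp : measure_display) (T : measurableType disp)
    (Pr : probability T R) (noise : nat -> {mfun T >-> 'rV[R]_d})
    (delta : R) (N : nat) (x : nat -> state_action S A),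
  is_rkhs k H ip -> H (fun z => f z.1 ord0 z.2) ->
  ip_norm ip (fun z => f z.1 ord0 z.2) <= B -> discretization H ip B C ->
  iid_gaussian_noise Pr sigma noise -> 0 < delta < 1 -> (0 < N)%N ->
  mvr_queries k lambda x N ->
  exists E : set T, [/\ measurable E, (Pr E >= (1 - delta)%:E)%E &
    forall w, E w -> forall v : state_action S A,
    N%:R * \sum_(l < d)
      (f v ord0 l - posterior_mean k lambda x (fun i => f (x i) + noise i w) N v ord0 l) ^+ 2 <=
    C1 * (beta_ (d + q) d B C sigma lambda N delta ^+ 2 * d%:R ^+ 2 *
          max_information_gain k lambda (N * d))].
Proof.
have dR : 1 <= d%:R :> R by rewrite ler1n.
have sl0 : 0 < Num.sqrt lambda by rewrite sqrtr_gt0.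
have slE : Num.sqrt lambda ^+ 2 = lambda by rewrite sqr_sqrtr// ltW.
have [[z0 kz0]|nk] := pselect (exists z0, 0 < k z0 z0); last first.
  (* Then H = 0 and the estimate is exact. *)
  have kz z : k z z = 0.
    apply/eqP; rewrite eq_le kernel_diag_ge0 andbT leNgt; apply/negP => h.
    by apply: nk; exists z.
  exists 1 => // H ip B C f disp T Pr noise delta N x rkhs Hf _ _ _ /andP[delta0 _] N0 _.
  exists setT; split => //; first by rewrite probability_setT lee_fin; lra.
  move=> w _ v; rewrite big1 ?mulr0 => [|l _]; last first.
    have [Hg _] := gp_mean_rkhs k_pd lambda_gt0 (query_output x (n := N)) rkhs
      (responses (fun i => f (x i) + noise i w) N).
    by rewrite mxE (rkhs_eq0 rkhs Hg (kz _)) (rkhs_eq0 (z := (v, l)) rkhs Hf (kz _)) subrr expr0n.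
  by rewrite mul1r -exprMn mulr_ge0 ?sqr_ge0//; exact: mvr_information_gain_ge0.
pose k0 := k z0 z0.
pose c := d%:R * Num.sqrt lambda / 2.
have sk0 : 0 < Num.sqrt k0 by rewrite sqrtr_gt0.
have c0 : 0 < c by rewrite /c; nra.
(* 1 + sqrt lambda accounts for the bias and the noise at the centers, the last term for the
   discretization error c / sqrt N. *)
pose c3 := 1 + Num.sqrt lambda + c * lambda / (sigma * Num.sqrt k0).
have c30 : 0 < c3.
  rewrite /c3 addr_gt0//.
  by apply: divr_gt0; apply: mulr_gt0.
exists (2 * c3 ^+ 2 * (lambda + 1)); first by rewrite !mulr_gt0 ?exprn_gt0// addr_gt0.
move=> H ip B C f disp T Pr noise delta N x rkhs Hf fB disc iid delta01 N0 mvr.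
have /andP[delta0 delta1] := delta01.
have NR : 1 <= N%:R :> R by rewrite ler1n.
have sN0 : 0 < Num.sqrt N%:R :> R by rewrite sqrtr_gt0; lra.
have B0 : 0 <= B by apply: le_trans fB; exact: sqrtr_ge0.
pose rad := B + Num.sqrt N%:R * beta B sigma lambda (2 * delta / (3 * N%:R)).
have Brad : B + Num.sqrt N%:R * (sigma / lambda * Num.sqrt (2 * ln (3 * N%:R / delta))) <= rad.
  rewrite /rad /beta lerD2l ler_pM2l//.
  have -> : 2 / (2 * delta / (3 * N%:R)) = 3 * N%:R / delta.
    by field; apply/andP; split; rewrite gt_eqF; lra.
  by rewrite lerDr.
have nn0 : 0 <= Num.sqrt N%:R * (sigma / lambda * Num.sqrt (2 * ln (3 * N%:R / delta))).
  by rewrite !mulr_ge0 ?sqrtr_ge0 ?invr_ge0// ltW.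
have [Brad1 Brad2] : B <= rad /\ Num.sqrt N%:R * (sigma / lambda * Num.sqrt (2 * ln (3 * N%:R / delta))) <= rad.
  by split; lra.
have [D [near [sD nearP approx]]] := disc N rad N0 Brad1.
have center_lt v : (index (near v) D < size D)%N by rewrite index_mem; case: (nearP v).
pose center (m : 'I_(size D)) := nth (x 0%N) D m.
pose idx v := Ordinal (center_lt v).
have centerE v : center (idx v) = near v by rewrite /center nth_index//; case: (nearP v).
pose Q := C * rad ^+ (d + q) * N%:R `^ ((d + q)%:R / 2).
(* D contains [near (x 0)], hence is nonempty. This also makes the denominators below, which involve
   C, positive. *)
have Q1 : 1 <= Q.
  by apply: le_trans sD; rewrite ler1n; exact: leq_ltn_trans (center_lt (x 0%N)).
(* The confidence level at which [beta_] evaluates [beta]; over the d outputs at the centers, at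
   most Q in number, it sums to at most delta / 3. *)
pose delta' := delta / (3 * C * d%:R * rad ^+ (d + q) * N%:R `^ ((d + q)%:R / 2)).
have delta'E : delta' = delta / (3 * d%:R * Q).
  by congr (_ / _); rewrite /Q; ring.
have dQ1 : 1 <= d%:R * Q by nra.
have delta'01 : 0 < delta' <= delta / 3.
  rewrite delta'E divr_gt0//=; last by rewrite -mulrA; lra.
  rewrite ler_pM2l// lef_pV2 ?posrE; [|lra|lra]; rewrite -mulrA; lra.
have /andP[delta'0 delta'3] := delta'01.
pose s := Num.sqrt (2 * d%:R * (lambda + 1) * max_information_gain k lambda (N * d) / N%:R).
have hs z : Num.sqrt (gp_variance k lambda (query_output x (n := N)) z) <= s.
  apply: ler_wsqrtr.
  apply: le_trans (mvr_variance_le k_pd lambda_gt0 k_le1 z.1 d_gt0 N0 mvr).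
  rewrite l2norm_posterior_sd_sqr// (bigD1 z.2)//= -surjective_pairing lerDl.
  by apply: sumr_ge0 => l _; exact: gp_variance_ge0.
have happrox g : H g -> ip_norm ip g <= rad ->
    forall v l, g (v, l) - g (center (idx v), l) <= (Num.sqrt N%:R)^-1.
  by move=> Hg gr v l; rewrite centerE; exact: approx.
have d'01 : 0 < delta' < 1 by rewrite delta'0; lra.
have [E [mE PE hE]] := posterior_mean_concentration k_pd lambda_gt0 rkhs iid sigma_gt0
  N0 d_gt0 Hf delta01 d'01 Brad2 hs happrox.
exists E; split => //.
  apply: le_trans PE; rewrite lee_fin.
  have : (size D * d)%:R * delta' <= delta / 3.
    rewrite natrM delta'E.
    apply: le_trans (_ : Q * d%:R * (delta / (3 * d%:R * Q)) <= _).
      rewrite ler_wpM2r//; last by rewrite ler_wpM2r// ler0n.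
      by rewrite divr_ge0 ?ltW// -mulrA; lra.
    by rewrite le_eqVlt; apply/orP; left; apply/eqP; field; apply/andP; split; rewrite gt_eqF; lra.
  lra.
move=> w Ew v.
set b := beta_ _ _ _ _ _ _ _ _.
pose t2 := Num.sqrt (2 * ln (2 / delta')).
have bE : b = 2 * B + (B + sigma / lambda * t2) by [].
have t21 : 1 <= t2.
  by apply: sqrt_ln_ge1 => //; lra.
have sl : 0 < sigma / lambda by rewrite divr_gt0.
have s0 : 0 <= s by exact: sqrtr_ge0.
have b1 : ip_norm ip (fun z => f z.1 ord0 z.2) + sigma / Num.sqrt lambda * t2 <=
    (1 + Num.sqrt lambda) * b.
  have -> : sigma / Num.sqrt lambda = Num.sqrt lambda * (sigma / lambda).
    by rewrite -{3}slE; field; rewrite gt_eqF.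
  rewrite bE; have : 0 <= Num.sqrt lambda * B by rewrite mulr_ge0// ltW.
  have : 0 <= sigma / lambda * t2 by rewrite mulr_ge0// ltW// (lt_le_trans ltr01).
  lra.
have b2 : sigma / lambda <= b.
  rewrite bE; have := ler_wpM2l (ltW sl) t21; lra.
(* The lower bound on the information gain makes s at least of order 1 / sqrt N, so that it
   dominates the discretization error. *)
have s1 : Num.sqrt k0 / Num.sqrt N%:R <= s.
  rewrite -sqrtrV ?ler0n// -sqrtrM; last exact: ltW.
  apply: ler_wsqrtr; rewrite ler_wpM2r ?invr_ge0 ?ler0n//.
  have Nd : (0 < N * d)%N by rewrite muln_gt0 N0.
  have := max_information_gain_ge k_pd lambda_gt0 k_le1 Nd (ltW kz0).
  have l1 : 0 < lambda + 1 by rewrite addr_gt0.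
  rewrite -/k0 mulrA ler_pdivrMr// => h.
  have k00 : 0 < k0 by [].
  have := ler_wpM2l (ltW (lt_le_trans ltr01 dR)) h.
  nra.
have err l : `|f v ord0 l - posterior_mean k lambda x (fun i => f (x i) + noise i w) N v ord0 l| <=
    c3 * b * s.
  rewrite distrC; apply: le_trans (hE w Ew v l) _.
  rewrite -/t2 -/c /c3 [X in _ <= X * s]mulrDl [leRHS]mulrDl.
  apply: lerD; first exact: ler_wpM2r.
  have -> : c / Num.sqrt N%:R = c * lambda / (sigma * Num.sqrt k0) *
      (sigma / lambda) * (Num.sqrt k0 / Num.sqrt N%:R).
    by field; rewrite !gt_eqF.
  have cc : 0 <= c * lambda / (sigma * Num.sqrt k0) by rewrite divr_ge0// ?mulr_ge0// ltW.
  apply: ler_pM => //.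
  - by rewrite mulr_ge0// ltW.
  - exact: ler_wpM2l.
have b0 : 0 < b by exact: lt_le_trans b2.
have -> : 2 * c3 ^+ 2 * (lambda + 1) * (b ^+ 2 * d%:R ^+ 2 * max_information_gain k lambda (N * d)) =
    N%:R * (d%:R * (c3 * b * s) ^+ 2).
  rewrite !exprMn sqr_sqrtr.
    by field; rewrite gt_eqF; lra.
  have l1 : 0 <= lambda + 1 by rewrite addr_ge0// ltW.
  by rewrite !mulr_ge0 ?invr_ge0 ?ler0n//; exact: mvr_information_gain_ge0.
rewrite ler_pM2l; last by lra.
rewrite mulr_natl -[X in _ *+ X]card_ord -sumr_const; apply: ler_sum => l _.
rewrite -real_normK ?num_real//; apply: lerXn2r => //; rewrite nnegrE//.
by rewrite !mulr_ge0// ltW.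
Qed.

End mvr_learning.

(** * Continuity of the estimated dynamics and comparison of the optimal policies *)

Lemma continuous_rV (R : realType) (U : topologicalType) p (g : U -> 'rV[R]_p) :
  (forall l, continuous (fun t => g t ord0 l)) -> continuous g.
Proof.
move=> cg t W [P Pnbhs PW]; rewrite nbhs_simpl /=.
have : \forall t' \near t, forall l, P ord0 l (g t' ord0 l).
  by apply: filter_forall => l; exact: (cg l t (P ord0 l) (Pnbhs ord0 l)).
by apply: filterS => t' Pt; apply: PW => i l; rewrite ord1.
Qed.

Lemma continuous_posterior_mean (R : realType) (X : topologicalType) (d : nat)
    (k : X * 'I_d -> X * 'I_d -> R) (lambda : R) (x : nat -> X) y N :
  (forall l l' : 'I_d, continuous (fun xx' : X * X => k (xx'.1, l) (xx'.2, l'))) ->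
  continuous (posterior_mean k lambda x y N).
Proof.
move=> ck; apply: continuous_rV => l.
have [c cE] : exists c : 'cV[R]_(N * d), c =
  invmx (gram k (query_output x (n := N)) + lambda%:M) *m responses y N by eexists.
rewrite (_ : (fun t => _) = fun t => \sum_j k (t, l) (query_output x j) * c j ord0).
  apply: continuous_big => [|j _]; first exact: add_continuous.
  move=> t; apply: cvgMr_tmp; case: (query_output x j) => x' l'.
  apply: (@continuous_comp _ _ _ (fun t : X => (t, x')) (fun xx' : X * X => k (xx'.1, l) (xx'.2, l'))).
    by apply: cvg_pair; [exact: cvg_id|exact: cvg_cst].
  exact: ck.
by apply/funext => t; rewrite mxE /gp_mean -mulmxA -cE mxE; apply: eq_bigr => j _; rewrite mxE.
Qed.

Theorem proposition1 (R : realType) (d q : nat)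
  (S : set 'rV[R]_d) (A : set 'rV[R]_q)
  (k : state_action S A * 'I_d -> state_action S A * 'I_d -> R) (sigma lambda : R)
  (d_gt0 : (0 < d)%N)
  (compact_SA : compact (S `*` A))
  (k_continuous : forall l l' : 'I_d,
     continuous (fun xx' : state_action S A * state_action S A => k (xx'.1, l) (xx'.2, l')))
  (k_pd : positive_definite_kernel k)
  (k_le1 : forall z z', k z z' <= 1)
  (sigma_gt0 : 0 < sigma) (lambda_gt0 : 0 < lambda) :
  exists2 C0 : R, 0 < C0 &
  forall (H : set (state_action S A * 'I_d -> R))
    (ip : (state_action S A * 'I_d -> R) -> (state_action S A * 'I_d -> R) -> R),
  is_rkhs k H ip ->
  forall (r : 'rV[R]_d * 'rV[R]_q -> R) (gamma rho B C : R)
    (f : state_action S A -> 'rV[R]_d) (proj : {mfun 'rV[R]_d >-> 'rV[R]_d}),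
  measurable_fun (S `*` A) r ->
  (forall x, (S `*` A) x -> 0 <= r x <= 1) ->
  0 < gamma < 1 ->
  0 < rho ->
  continuous f ->
  H (fun z => f z.1 ord0 z.2) ->
  ip_norm ip (fun z => f z.1 ord0 z.2) <= B ->
  discretization H ip B C ->
  (forall s, S (proj s)) ->
  (forall s, S s -> proj s = s) ->
  forall (disp : measure_display) (T : measurableType disp)
    (Pr : probability T R) (noise : nat -> {mfun T >-> 'rV[R]_d}),
  iid_gaussian_noise Pr sigma noise ->
  forall (delta eps : R) (N : nat),
  0 < delta < 1 ->
  0 < eps < (1 - gamma)^-1 ->
  (0 < N)%N ->
  N%:R >= C0 * ((1 + 2 * rho) / (Num.sqrt (1 + 2 * rho) - 1)) ^+ 4 *
    (gamma ^+ 4 * beta_ (d + q) d B C sigma lambda N delta ^+ 2 * d%:R ^+ 2 *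
       max_information_gain k lambda (N * d) /
     ((1 - gamma) ^+ 8 * eps ^+ 4)) ->
  forall x : nat -> state_action S A,
  mvr_queries k lambda x N ->
  let fhat (w : T) : state_action S A -> 'rV[R]_d :=
    posterior_mean k lambda x (fun i => f (x i) + noise i w) N in
  let V (pi : {mfun 'rV[R]_d >-> 'rV[R]_q}) : 'rV[R]_d -> \bar R :=
    robust_value r gamma rho sigma proj (deterministic pi) f in
  forall (pihat : T -> {mfun 'rV[R]_d >-> 'rV[R]_q})
    (pistar : {mfun 'rV[R]_d >-> 'rV[R]_q}),
  (forall w, robust_optimal r gamma rho sigma proj (fhat w) (pihat w)) ->
  robust_optimal r gamma rho sigma proj f pistar ->
  exists E : set T,
  [/\ measurable E,
      (Pr E >= (1 - delta)%:E)%E &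
      forall w, E w ->
        (ereal_sup [set `|V (pihat w) s - V pistar s| | s in S] <= eps%:E)%E].
Proof.
have [C1 C10 learning] := mvr_learning d_gt0 k_pd k_le1 sigma_gt0 lambda_gt0.
(* With u as chosen below, (sigma u)^2 = sigma^2 eps^4 (1 - gamma)^8 / (64 K^4 gamma^4), and N times
   the squared error has to stay below N times this. *)
exists (64 * C1 / sigma ^+ 2); first by rewrite divr_gt0 ?exprn_gt0// mulr_gt0.
move=> H ip rkhs r gamma rho B C f proj mr r01 gamma01 rho_gt0 cf Hf fB disc projS _.
move=> disp T Pr noise iid delta eps N delta01 eps01 N0 NC x mvr fhat V pihat pistar hat_opt star_opt.
have [E [mE PE hE]] := learning _ _ _ _ _ _ _ _ _ _ _ _ rkhs Hf fB disc iid delta01 N0 mvr.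
exists E; split => // w Ew.
have /andP[g0 g1] := gamma01; have /andP[eps0 _] := eps01.
have [pihatA hatP] := hat_opt w; have [pistarA starP] := star_opt.
have g1' : 0 < 1 - gamma by rewrite subr_gt0.
have NR : 0 < N%:R :> R by rewrite ltr0n.
set K := (1 + 2 * rho) / (Num.sqrt (1 + 2 * rho) - 1) in NC.
have K0 : 0 < K.
  have r1 : 0 < 1 + 2 * rho by rewrite addr_gt0// mulr_gt0.
  by rewrite divr_gt0// subr_gt0 -[ltLHS]sqrtr1 ltr_sqrt// ltrDl mulr_gt0.
(* Chosen so that one exchange of f and [fhat] costs exactly eps / 2. *)
pose tau := eps * (1 - gamma) ^+ 2 / (2 * K * gamma).
have tau0 : 0 < tau by apply: divr_gt0; repeat apply: mulr_gt0 => //; rewrite exprn_gt0.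
pose u := tau ^+ 2 / 2.
have u0 : 0 < u by rewrite divr_gt0// exprn_gt0.
have tauE : Num.sqrt (2 * u) = tau.
  by rewrite /u mulrC divfK// sqrtr_sqr gtr0_norm.
have err v : \sum_(l < d) (f v ord0 l - fhat w v ord0 l) ^+ 2 <= (sigma * u) ^+ 2.
  rewrite -(ler_pM2l NR); apply: le_trans (hE w Ew v) _.
  set b := beta_ _ _ _ _ _ _ _ _ in NC *; set Ga := max_information_gain _ _ _ in NC *.
  have su : 0 <= (sigma * u) ^+ 2 by exact: sqr_ge0.
  have := ler_wpM2r su NC; apply: le_trans; rewrite le_eqVlt; apply/orP; left; apply/eqP.
  by rewrite /u /tau; field; rewrite !gt_eqF.
have cfhat : continuous (fhat w) by exact: continuous_posterior_mean.
have err' v : \sum_(l < d) (fhat w v ord0 l - f v ord0 l) ^+ 2 <= (sigma * u) ^+ 2.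
  by apply: le_trans (err v); apply: ler_sum => l _; rewrite -sqrrN opprB.
have half : K * Num.sqrt (2 * u) * gamma / (1 - gamma) ^+ 2 = eps / 2.
  by rewrite tauE /tau; field; rewrite !gt_eqF.
have policy (pi : {mfun 'rV[R]_d >-> 'rV[R]_q}) :
    is_deterministic_policy S A pi -> is_policy S A (deterministic pi).
  by move=> piA s Ss; rewrite /deterministic /= /kdirac diracE mem_set//; exact: piA.
apply: ge_ereal_sup => _ [s Ss <-].
have fin_hat : V (pihat w) s \is a fin_num.
  exact: (robust_value_fin_num d_gt0 sigma_gt0 rho_gt0 gamma01 compact_SA mr r01 projS pihatA iid).
have fin_star : V pistar s \is a fin_num.
  exact: (robust_value_fin_num d_gt0 sigma_gt0 rho_gt0 gamma01 compact_SA mr r01 projS pistarA iid).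
have le1 : (V (pihat w) s <= V pistar s)%E by apply: starP => //; exact: policy.
(* Two exchanges: [pistar] from f to [fhat], where [pihat w] is at least as good, then [pihat w]
   from [fhat] back to f. *)
have le2 : (V pistar s <= V (pihat w) s + eps%:E)%E.
  have := robust_value_close d_gt0 sigma_gt0 rho_gt0 gamma01 compact_SA mr r01 projS
    pihatA iid s cf cfhat u0 err.
  have := robust_value_close d_gt0 sigma_gt0 rho_gt0 gamma01 compact_SA mr r01 projS
    pistarA iid s cfhat cf u0 err'.
  rewrite -/K half => star_hat hat_hat.
  apply: le_trans star_hat _; rewrite [eps in leRHS]splitr EFinD addeA leeD2r//.
  by apply: le_trans hat_hat; apply: hatP => //; exact: policy.
move: fin_hat fin_star le1 le2; case: (V (pihat w) s) => [a| |]//; case: (V pistar s) => [b| |]//= _ _.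
rewrite -EFinD !lee_fin => ab ba; rewrite ler_norml; apply/andP; split; lra.
Qed.
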